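(* Let $(R,\mathfrak m,K)$ be a local ring and $\mathcal M=\{M_n\}_n$ a lim Cohen-Macaulay sequence over $R$. Let $x_1,\dots,x_k$ be part of a system of parameters for $R$, let $a_1,\dots,a_k$ be positive integers, and let $b_1,\dots,b_k$ be nonnegative integers. Then $$(x_1^{a_1+b_1},\dots,x_k^{a_k+b_k})^{*\mathcal M,\nu}:_R x_1^{b_1}\cdots x_k^{b_k}=(x_1^{a_1},\dots,x_k^{a_k})^{*\mathcal M,\nu}.$$ The same result holds for $\mathcal M$-closures with respect to rank when all of the modules $M_n$ have a well-defined rank.
   Context: A local ring is Noetherian. $\ell$ is length, $\nu(M)=\dim_K(K\otimes_RM)$, $H_i(\underline x;M)$ is Koszul homology. A sequence $\{M_n\}_n$ of nonzero finitely generated $R$-modules is lim Cohen-Macaulay if for some (equivalently, every) system of parameters $\underline x$ of $R$, $\ell(H_i(\underline x;M_n))=\mathrm o(\nu(M_n))$ as $n\to\infty$ for all $i\ge1$. A finitely generated $R$-module $M$ has rank $r$ if $\ell_{R_{\mathfrak p}}(M_{\mathfrak p})=r\,\ell_{R_{\mathfrak p}}(R_{\mathfrak p})$ for every minimal prime $\mathfrak p$ of $R$ with $\dim(R/\mathfrak p)=\dim R$. Closure: let $\alpha$ be a function assigning a positive value to each $M_n$ (here $\nu$, or rank when it is defined and positive on all the $M_n$). For finitely generated $R$-modules $A\subseteq B$ with $B/A$ of finite length, the $\mathcal M$-closure $A^{*\mathcal M,\alpha}_B$ of $A$ in $B$ with respect to $\alpha$ is the largest submodule $A'$ with $A\subseteq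 A'\subseteq B$ such that $\ell\big(\operatorname{Im}(M_n\otimes_R(A'/A)\to M_n\otimes_R(B/A))\big)=\mathrm o(\alpha(M_n))$ as $n\to\infty$. In general $A^{*\mathcal M,\alpha}_B=\bigcap_t(A+\mathfrak m^tB)^{*\mathcal M,\alpha}_B$. For an ideal $I$ of $R$, $I^{*\mathcal M,\alpha}$ means $I^{*\mathcal M,\alpha}_R$. *)

(* Defs.v *)
From HB Require Import structures.
From mathcomp Require Import all_boot all_order all_algebra.
From mathcomp Require Import ring freeg.
From mathcomp Require Import boolp classical_sets filter topology normedtype landau.

Set Implicit Arguments.
Unset Strict Implicit.
Unset Printing Implicit Defensive.

Import GRing.Theory Num.Theory.
Import numFieldNormedType.Exports.

Local Open Scope ring_scope.
Local Open Scope classical_set_scope.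
Local Open Scope quotient_scope.

Section Submodules.
Variables (R : nzRingType) (V : lmodType R).

Definition submodule (N : set V) : Prop := GRing.submod_closed (mem N).

Lemma submoduleP (N : set V) :
  submodule N <-> N 0 /\ forall a u v, N u -> N v -> N (a *: u + v).
Proof.
rewrite /submodule; split.
  case=> /set_mem N0 NZ; split=> // a u v Nu Nv.
  by apply: set_mem; apply: NZ; apply: mem_set.
case=> N0 NZ; split; first exact: mem_set.
by move=> a u v /set_mem Nu /set_mem Nv; apply/mem_set/NZ.
Qed.

Definition span (N : set V) : {pred V} :=
  fun v => `[< forall P : set V, submodule P -> N `<=` P -> P v >].

Lemma span_closed N : GRing.submod_closed (span N).
Proof.
split; first by apply/asboolP=> P /submoduleP[].
move=> a u v /asboolP Nu /asboolP Nv; apply/asboolP=> P sP NP.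
by case/submoduleP: (sP) => _; apply; [exact: Nu | exact: Nv].
Qed.

HB.instance Definition _ N :=
  GRing.isSubmodClosed.Build R V (span N) (span_closed N).

Lemma mem_span (N : set V) v : N v -> v \in span N.
Proof. by move=> Nv; apply/asboolP=> P _; apply. Qed.

Lemma span_id (N : set V) v : submodule N -> v \in span N -> N v.
Proof. by move=> sN /asboolP; apply. Qed.

Definition finitely_generated (N : set V) : Prop :=
  exists s : seq V, N = [set` span [set` s]].

End Submodules.

(** The submodule [span N] as a module, and the quotient of [V] by [span N];
    when [N] is a submodule these are [N] and [V / N]. *)
Definition sub_module (R : nzRingType) (V : lmodType R) (N : set V) : Type :=
  {v : V | v \in span N}.

HB.instance Definition _ (R : nzRingType) (V : lmodType R) (N : set V) :=
  SubChoice.on (sub_module N).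
HB.instance Definition _ (R : nzRingType) (V : lmodType R) (N : set V) :=
  [SubChoice_isSubLmodule of sub_module N by <:].

Definition quot_module (R : nzRingType) (V : lmodType R) (N : set V) : Type :=
  Quotient.quot (span N).

Section QuotModule.
Variables (R : nzRingType) (V : lmodType R) (N : set V).
Local Notation Q := (quot_module N).

HB.instance Definition _ := GRing.Zmodule.on Q.

Definition pi_quot (v : V) : Q := \pi_(Quotient.quot (span N)) v.
Definition repr_quot (q : Q) : V := @repr _ (Quotient.quot (span N)) q.

Lemma repr_quotK : cancel repr_quot pi_quot.
Proof. exact: reprK. Qed.

Lemma pi_quotP u v : (pi_quot u = pi_quot v) <-> (u - v \in span N).
Proof. by rewrite (Quotient.idealrBE (span N)); split=> [/eqP|/eqP]. Qed.

Lemma pi_quotB : zmod_morphism pi_quot.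
Proof. by move=> u v; rewrite /pi_quot [LHS]raddfB. Qed.

HB.instance Definition _ :=
  GRing.isZmodMorphism.Build V Q pi_quot pi_quotB.

Definition scale_quot (a : R) (q : Q) : Q := pi_quot (a *: repr_quot q).

Lemma pi_quotZ a v : pi_quot (a *: v) = scale_quot a (pi_quot v).
Proof.
apply/pi_quotP; rewrite -scalerBr rpredZ //.
by apply/pi_quotP; rewrite repr_quotK.
Qed.

Lemma scale_quotA a b q : scale_quot a (scale_quot b q) = scale_quot (a * b) q.
Proof. by rewrite -[q]repr_quotK -!pi_quotZ scalerA. Qed.

Lemma scale_quot1 : left_id 1 scale_quot.
Proof. by move=> q; rewrite -[q]repr_quotK -pi_quotZ scale1r. Qed.

Lemma scale_quotDr : right_distributive scale_quot +%R.
Proof.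
move=> a p q; rewrite -[p]repr_quotK -[q]repr_quotK -raddfD -!pi_quotZ.
by rewrite scalerDr raddfD.
Qed.

Lemma scale_quotDl q : {morph scale_quot^~ q : a b / a + b}.
Proof.
by move=> a b; rewrite -[q]repr_quotK -!pi_quotZ scalerDl raddfD.
Qed.

HB.instance Definition _ := GRing.Zmodule_isLmodule.Build R Q
  scale_quotA scale_quot1 scale_quotDr scale_quotDl.

Lemma pi_quot_scalable : scalable pi_quot.
Proof. exact: pi_quotZ. Qed.

HB.instance Definition _ :=
  GRing.isScalable.Build R V Q *:%R pi_quot pi_quot_scalable.

End QuotModule.

(** [Z / A], for submodules [A] included in [Z]. *)
Definition subquot (R : nzRingType) (V : lmodType R) (Z A : set V) :
    lmodType R :=
  quot_module ([set z | A (val z)] : set (sub_module Z)).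

Definition subquot_incl (R : nzRingType) (V : lmodType R) (Z A : set V)
    (q : subquot Z A) : quot_module A :=
  pi_quot A (val (repr_quot q)).

Lemma subquot_incl_pi (R : nzRingType) (V : lmodType R) (Z A : set V)
    (z : sub_module Z) :
  subquot_incl (pi_quot [set y : sub_module Z | A (val y)] z) =
  pi_quot A (val z).
Proof.
set AZ := [set y | _]; apply/pi_quotP; rewrite -raddfB.
have : repr_quot (pi_quot AZ z) - z \in span AZ.
  by apply/pi_quotP; rewrite repr_quotK.
move/asboolP/(_ [set y | val y \in span A]); apply=> [|y Ay].
  apply/submoduleP; split=> [|a u v /= uA vA] /=.
    exact: rpred0.
  by rewrite rpredD ?rpredZ.
exact: mem_span.
Qed.

Definition has_length (R : nzRingType) (V : lmodType R) (l : nat) : Prop :=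
  let chain k := exists N : nat -> set V,
    (forall i, (i <= k)%N -> submodule (N i)) /\
    (forall i, (i < k)%N -> N i `<` N i.+1) in
  chain l /\ forall k, chain k -> (k <= l)%N.

Section Ideals.
Variable R : comNzRingType.

(** [prime_idealr R] is the library's type of prime ideals and [idealr R] its
    type of proper ideals; arbitrary ideals are submodules of [R^o]. *)
Definition krull_dim (d : nat) : Prop :=
  let chain k := exists p : nat -> prime_idealr R,
    forall i, (i < k)%N -> [set` p i] `<` [set` p i.+1] in
  chain d /\ forall k, chain k -> (k <= d)%N.

Definition minimal_prime (p : prime_idealr R) : Prop :=
  forall q : prime_idealr R, {subset q <= p} -> {subset p <= q}.

Definition maximal_ideal (m : idealr R) : Prop :=
  forall I : idealr R, {subset m <= I} -> {subset I <= m}.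

Definition noetherian : Prop :=
  forall I : set R^o, submodule I -> finitely_generated I.

Definition local_ring (m : idealr R) : Prop :=
  [/\ noetherian, maximal_ideal m & forall I, maximal_ideal I -> I =i m].

Definition ideal_gen k (x : 'I_k -> R) : set R^o :=
  [set` span (range x : set R^o)].

Definition ideal_mul (V : lmodType R) (I : set R^o) (N : set V) : set V :=
  [set` span [set a *: v | a in I & v in N]].

Fixpoint ideal_exp (I : set R^o) (t : nat) : set R^o :=
  if t is s.+1 then ideal_mul I (ideal_exp I s) else setT.

Definition colon (I : set R^o) (y : R) : set R^o := [set r | I (r * y)].

(** The ideal generated by the [dim R] elements [x i] is [m]-primary. *)
Definition sop (m : idealr R) d (x : 'I_d -> R) : Prop :=
  krull_dim d /\ forall r, r \in m <-> exists n, ideal_gen x (r ^+ n).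

Definition part_of_sop (m : idealr R) k (x : 'I_k -> R) : Prop :=
  exists d (y : 'I_d -> R) (f : 'I_k -> 'I_d),
    [/\ sop m y, injective f & x =1 y \o f].

End Ideals.

Section Tensor.
Variables (R : comNzRingType) (M N : lmodType R).
Local Notation F := {freeg (M * N) / R}.
Local Notation "[ m ; n ]" := (<< (m, n) >> : F).

Inductive tensor_rel : F -> Prop :=
| TensorDl m m' n : tensor_rel ([(m + m') ; n] - [m ; n] - [m' ; n])
| TensorDr m n n' : tensor_rel ([m ; (n + n')] - [m ; n] - [m ; n'])
| TensorZl a m n : tensor_rel ([(a *: m) ; n] - a *: [m ; n])
| TensorZr a m n : tensor_rel ([m ; (a *: n)] - a *: [m ; n]).

Definition tensor : lmodType R := quot_module (tensor_rel : set F).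

Definition tens (m : M) (n : N) : tensor := pi_quot tensor_rel [m ; n].

Lemma tensDl m m' n : tens (m + m') n = tens m n + tens m' n.
Proof.
rewrite -raddfD; apply/pi_quotP; rewrite opprD addrA.
exact/mem_span/TensorDl.
Qed.

Lemma tensDr m n n' : tens m (n + n') = tens m n + tens m n'.
Proof.
rewrite -raddfD; apply/pi_quotP; rewrite opprD addrA.
exact/mem_span/TensorDr.
Qed.

Lemma tensZl a m n : tens (a *: m) n = a *: tens m n.
Proof. by rewrite -linearZ; apply/pi_quotP/mem_span/TensorZl. Qed.

Lemma tensZr a m n : tens m (a *: n) = a *: tens m n.
Proof. by rewrite -linearZ; apply/pi_quotP/mem_span/TensorZr. Qed.

Lemma tensE (t : tensor) :
  exists s : seq (R * (M * N)), t = \sum_(z <- s) z.1 *: tens z.2.1 z.2.2.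
Proof.
pose D := repr_quot t.
exists [seq (coeff z D, z) | z <- dom D].
rewrite -[LHS]repr_quotK -/D -{1}[D]freeg_sumE raddf_sum [RHS]big_map.
apply: eq_bigr => -[m n] _ /=; rewrite /tens -linearZ; congr pi_quot.
by apply/eqP/freeg_eqP => z; rewrite coeffZ !coeffU mul1r.
Qed.

End Tensor.

Section FreegLinear.
Variables (R : comNzRingType) (W : lmodType R) (K : choiceType).

Lemma fglift_linear (f : K -> W) :
  linear (fglift f : {freeg K / R} -> W).
Proof.
have fB := lift_is_additive f.
have f0 : fglift f (0 : {freeg K / R}) = 0.
  by have := fB 0 0; rewrite !subrr.
have fN u : fglift f (- u) = - fglift f u.
  by have := fB 0 u; rewrite !sub0r f0 sub0r.
have fD u v : fglift f (u + v) = fglift f u + fglift f v.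
  by have := fB u (- v); rewrite fN !opprK.
move=> a u v; rewrite fD; congr (_ + _).
have fS (I : Type) (r : seq I) (G : I -> {freeg K / R}) :
    fglift f (\sum_(i <- r) G i) = \sum_(i <- r) fglift f (G i).
  exact: (big_morph _ fD f0).
rewrite -{2}[u]freeg_sumE fS scaler_sumr [a *: u]/(fgscale a u) /fgscale fS.
by apply: eq_bigr => i _; rewrite !liftU scalerA.
Qed.

HB.instance Definition _ (f : K -> W) :=
  GRing.isLinear.Build R {freeg K / R} W *:%R (fglift f) (fglift_linear f).

End FreegLinear.

Section TensorLift.
Variables (R : comNzRingType) (M N W : lmodType R).

Definition tensor_lift (f : M -> N -> W) (t : tensor M N) : W :=
  fglift (fun z => f z.1 z.2) (repr_quot t).

Variable f : M -> N -> W.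
Hypothesis fl : forall n, linear (f^~ n).
Hypothesis fr : forall m, linear (f m).

Lemma tensor_lift_pi (z : {freeg (M * N) / R}) :
  tensor_lift f (pi_quot _ z) = fglift (fun z => f z.1 z.2) z.
Proof.
pose g (y : {freeg (M * N) / R}) := fglift (fun z => f z.1 z.2) y.
have gP : linear g := fglift_linear _.
have gB u v : g (u - v) = g u - g v by exact: lift_is_additive.
have gZ a u : g (a *: u) = a *: g u by exact: linearZ.
rewrite -[LHS]/(g (repr_quot _)) -[RHS]/(g z); apply/subr0_eq.
have: repr_quot (pi_quot (@tensor_rel R M N) z) - z \in span (@tensor_rel R M N).
  by apply/pi_quotP; rewrite repr_quotK.
rewrite -gB; move/asboolP/(_ [set y | g y = 0]); apply.
  apply/submoduleP; split=> [|a u v /= gu gv] /=; first exact: linear0.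
  by rewrite gP gu gv scaler0 addr0.
pose flA n : {linear M -> W} :=
  HB.pack (f^~ n) (GRing.isLinear.Build _ _ _ _ _ (fl n)).
pose frA m : {linear N -> W} :=
  HB.pack (f m) (GRing.isLinear.Build _ _ _ _ _ (fr m)).
have gE m n : g << (m, n) >> = f m n by rewrite [LHS]liftU scale1r.
have flE n m : f m n = flA n m by [].
have frE n m : f m n = frA m n by [].
move=> _ [m m' n|m n n'|a m n|a m n]; rewrite /= ?gB ?gZ ?gE.
- by rewrite !flE linearD addrAC addrK subrr.
- by rewrite !frE linearD addrAC addrK subrr.
- by rewrite !flE linearZ subrr.
- by rewrite !frE linearZ subrr.
Qed.

Lemma tensor_lift_tens m n : tensor_lift f (tens m n) = f m n.
Proof. by rewrite tensor_lift_pi liftU scale1r. Qed.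

Lemma tensor_lift_linear : linear (tensor_lift f).
Proof.
move=> a u v; rewrite -[u]repr_quotK -[v]repr_quotK -linearP !tensor_lift_pi.
exact: fglift_linear.
Qed.

End TensorLift.

Definition tensor_map (R : comNzRingType) (M M' N N' : lmodType R)
    (f : M -> M') (g : N -> N') : tensor M N -> tensor M' N' :=
  tensor_lift (fun m n => tens (f m) (g n)).

Section TensorMap.
Variables (R : comNzRingType).

Lemma tensor_eq (M N W : lmodType R) (f g : tensor M N -> W) :
  linear f -> linear g -> (forall m n, f (tens m n) = g (tens m n)) -> f =1 g.
Proof.
move=> fl gl fg t.
pose f' : {linear tensor M N -> W} :=
  HB.pack f (GRing.isLinear.Build _ _ _ _ f fl).
pose g' : {linear tensor M N -> W} :=
  HB.pack g (GRing.isLinear.Build _ _ _ _ g gl).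
rewrite -[f t]/(f' t) -[g t]/(g' t).
have [s ->] := tensE t; rewrite !linear_sum; apply: eq_bigr => z _.
by rewrite !linearZ; congr (_ *: _); apply: fg.
Qed.

Variables (M M' N N' : lmodType R).
Variables (f : {linear M -> M'}) (g : {linear N -> N'}).

Lemma tensor_map_linl n : linear (fun m => tens (f m) (g n)).
Proof. by move=> a u v; rewrite linearP tensDl tensZl. Qed.

Lemma tensor_map_linr m : linear (fun n => tens (f m) (g n)).
Proof. by move=> a u v; rewrite linearP tensDr tensZr. Qed.

Lemma tensor_map_tens m n : tensor_map f g (tens m n) = tens (f m) (g n).
Proof.
exact: (tensor_lift_tens tensor_map_linl tensor_map_linr).
Qed.

Lemma tensor_map_linear : linear (tensor_map f g).
Proof.
exact: (tensor_lift_linear tensor_map_linl tensor_map_linr).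
Qed.

HB.instance Definition _ :=
  GRing.isLinear.Build R (tensor M N) (tensor M' N') *:%R
    (tensor_map f g) tensor_map_linear.

End TensorMap.

(** [S (x)_R M] as an [S]-module, [S] acting on the left factor. *)
Section ExtensionOfScalars.
Variables (R : comNzRingType) (S : comAlgType R) (M : lmodType R).

Definition extension : Type := tensor S M.

HB.instance Definition _ := GRing.Zmodule.on extension.

Definition lmul (s x : S) : S := s * x.

Lemma lmul_linear s : linear (lmul s).
Proof. by move=> a u v; rewrite /lmul mulrDr scalerAr. Qed.

HB.instance Definition _ s :=
  GRing.isLinear.Build R S S *:%R (lmul s) (lmul_linear s).

Definition ext_scale (s : S) (t : extension) : extension :=
  tensor_map (lmul s) (@idfun M) t.

Lemma ext_scale_tens s s' m : ext_scale s (tens s' m) = tens (s * s') m.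
Proof. exact: tensor_map_tens. Qed.

Lemma ext_scale_linear s : linear (ext_scale s : tensor S M -> tensor S M).
Proof. exact: tensor_map_linear. Qed.

Lemma ext_scaleA s s' t : ext_scale s (ext_scale s' t) = ext_scale (s * s') t.
Proof.
move: t; apply: (@tensor_eq _ _ _ (tensor S M)) => [a u v||s'' m].
- by rewrite !ext_scale_linear.
- exact: ext_scale_linear.
- by rewrite !ext_scale_tens mulrA.
Qed.

Lemma ext_scale1 : left_id 1 ext_scale.
Proof.
apply: (@tensor_eq _ _ _ (tensor S M)) => [|a u v|s m] //.
- exact: ext_scale_linear.
- by rewrite ext_scale_tens mul1r.
Qed.

Lemma ext_scaleDr : right_distributive ext_scale +%R.
Proof.
by move=> s u v; have := ext_scale_linear s 1 u v; rewrite !scale1r.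
Qed.

Lemma ext_scaleDl t : {morph ext_scale^~ t : s s' / s + s'}.
Proof.
move=> s s'; move: t; apply: (@tensor_eq _ _ _ (tensor S M)) => [|a u v|s'' m].
- exact: ext_scale_linear.
- by rewrite !ext_scale_linear scalerDr addrACA.
- by rewrite !ext_scale_tens mulrDl tensDl.
Qed.

HB.instance Definition _ := GRing.Zmodule_isLmodule.Build S extension
  ext_scaleA ext_scale1 ext_scaleDr ext_scaleDl.

End ExtensionOfScalars.

Section QuotientAlgebra.
Variables (R : comNzRingType) (I : idealr R).

Definition quot_ring : Type := {ideal_quot I}.
HB.instance Definition _ := GRing.ComNzRing.on quot_ring.

Definition pi_ring (a : R) : quot_ring := \pi_{ideal_quot I} a.

Lemma pi_ringD : {morph pi_ring : a b / a + b}.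
Proof. by move=> a b; rewrite /pi_ring [LHS]rmorphD. Qed.

Lemma pi_ringM : {morph pi_ring : a b / a * b}.
Proof. by move=> a b; rewrite /pi_ring [LHS]rmorphM. Qed.

Lemma pi_ring1 : pi_ring 1 = 1.
Proof. by rewrite /pi_ring [LHS]rmorph1. Qed.

Definition quot_ring_scale (a : R) (q : quot_ring) : quot_ring := pi_ring a * q.

Lemma quot_ring_scaleA a b q :
  quot_ring_scale a (quot_ring_scale b q) = quot_ring_scale (a * b) q.
Proof. by rewrite /quot_ring_scale mulrA pi_ringM. Qed.

Lemma quot_ring_scale1 : left_id 1 quot_ring_scale.
Proof. by move=> q; rewrite /quot_ring_scale pi_ring1 mul1r. Qed.

Lemma quot_ring_scaleDr : right_distributive quot_ring_scale +%R.
Proof. by move=> a p q; apply: mulrDr. Qed.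

Lemma quot_ring_scaleDl q : {morph quot_ring_scale^~ q : a b / a + b}.
Proof. by move=> a b; rewrite /quot_ring_scale pi_ringD mulrDl. Qed.

HB.instance Definition _ := GRing.Zmodule_isLmodule.Build R quot_ring
  quot_ring_scaleA quot_ring_scale1 quot_ring_scaleDr quot_ring_scaleDl.

Lemma quot_ring_scaleAl (a : R) (p q : quot_ring) : a *: (p * q) = a *: p * q.
Proof. exact: mulrA. Qed.

HB.instance Definition _ :=
  GRing.Lmodule_isLalgebra.Build R quot_ring quot_ring_scaleAl.
HB.instance Definition _ := GRing.Lalgebra_isComAlgebra.Build R quot_ring.

End QuotientAlgebra.

Section Localization.
Variables (R : comNzRingType) (p : prime_idealr R).

Definition denom : Type := {s : R | s \notin p}.
HB.instance Definition _ := SubChoice.on denom.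

Lemma denomM_subproof (s t : denom) : val s * val t \notin p.
Proof. by rewrite prime_idealrM negb_or (valP s) (valP t). Qed.

Lemma denom1_subproof : 1 \notin p.
Proof. by rewrite idealr1. Qed.

Definition denomM (s t : denom) : denom :=
  exist (fun s => s \notin p) _ (denomM_subproof s t).
Definition denom1 : denom :=
  exist (fun s => s \notin p) _ denom1_subproof.

Lemma val_denomM s t : val (denomM s t) = val s * val t. Proof. by []. Qed.
Lemma val_denom1 : val denom1 = 1. Proof. by []. Qed.

Section LocalModule.
Variable M : lmodType R.

Definition frac_equiv : rel (M * denom) := fun x y =>
  `[< exists u : denom, val u *: (val y.2 *: x.1 - val x.2 *: y.1) = 0 >].

Lemma frac_equiv_refl : reflexive frac_equiv.
Proof. by move=> x; apply/asboolP; exists denom1; rewrite subrr scaler0. Qed.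

Lemma frac_equiv_sym : symmetric frac_equiv.
Proof.
suff sub x y : frac_equiv x y -> frac_equiv y x.
  by move=> x y; apply/idP/idP; apply: sub.
move=> /asboolP[u uP]; apply/asboolP; exists u.
by rewrite -opprB scalerN uP oppr0.
Qed.

Lemma frac_equiv_trans : transitive frac_equiv.
Proof.
move=> [m2 s2] [m1 s1] [m3 s3] /asboolP[u uP] /asboolP[v vP].
apply/asboolP; exists (denomM (denomM u v) s2); move: uP vP.
case: u v s1 s2 s3 => [u _] [v _] [s1 _] [s2 _] [s3 _] /= uP vP.
transitivity ((v * s3) *: (u *: (s2 *: m1 - s1 *: m2))
    + (u * s1) *: (v *: (s3 *: m2 - s2 *: m3))).
  rewrite !scalerBr !scalerA addrA; congr (_ - _); last first.
    by congr (_ *: _); ring.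
  by rewrite -addrA [- _ + _]addrC; set a := _ *: m2; set b := _ *: m2;
    have -> : a = b by [congr (_ *: _); ring]; rewrite subrr addr0;
    congr (_ *: _); ring.
by rewrite uP vP !scaler0 addr0.
Qed.

Canonical frac_equiv_rel :=
  EquivRel frac_equiv frac_equiv_refl frac_equiv_sym frac_equiv_trans.

Definition localization : Type := {eq_quot frac_equiv}.
HB.instance Definition _ := Choice.on localization.

Definition frac (m : M) (s : denom) : localization :=
  \pi_{eq_quot frac_equiv} (m, s).
Definition unfrac (x : localization) : M * denom :=
  @repr _ {eq_quot frac_equiv} x.

Lemma unfracK x : frac (unfrac x).1 (unfrac x).2 = x.
Proof. by rewrite /frac -surjective_pairing; apply: reprK. Qed.

Lemma fracP m s n t :
  frac m s = frac n t <->
  exists u : denom, val u *: (val t *: m - val s *: n) = 0.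
Proof.
split; first by move/eqmodP/asboolP.
by move=> h; apply/eqmodP/asboolP.
Qed.

Lemma frac_eqW m s n t : val t *: m = val s *: n -> frac m s = frac n t.
Proof. by move=> e; apply/fracP; exists denom1; rewrite e subrr scaler0. Qed.

Definition frac_add (x y : localization) : localization :=
  let: (m, s) := unfrac x in let: (n, t) := unfrac y in
  frac (val t *: m + val s *: n) (denomM s t).

Definition frac_opp (x : localization) : localization :=
  let: (m, s) := unfrac x in frac (- m) s.

Lemma unfracP m s : exists u : denom,
  val u *: (val s *: (unfrac (frac m s)).1) =
  val u *: (val (unfrac (frac m s)).2 *: m).
Proof.
have /fracP[u] := unfracK (frac m s); rewrite scalerBr => /subr0_eq.
by exists u.
Qed.

Lemma frac_addE m s n t :
  frac_add (frac m s) (frac n t) = frac (val t *: m + val s *: n) (denomM s t).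
Proof.
rewrite /frac_add; have [u] := unfracP m s; have [v] := unfracP n t.
case: (unfrac (frac m s)) (unfrac (frac n t)) => [m' s'] [n' t'] /= vP uP.
apply/fracP; exists (denomM u v); move: uP vP.
case: u v s t s' t' => [u _] [v _] [s _] [t _] [s' _] [t' _] /= uP vP.
apply/eqP; rewrite scalerBr subr_eq0; apply/eqP; rewrite !scalerDr !scalerA.
congr (_ + _).
  transitivity ((v * t * t') *: (u *: (s *: m'))).
    by rewrite !scalerA; congr (_ *: _); ring.
  by rewrite uP !scalerA; congr (_ *: _); ring.
transitivity ((u * s * s') *: (v *: (t *: n'))).
  by rewrite !scalerA; congr (_ *: _); ring.
by rewrite vP !scalerA; congr (_ *: _); ring.
Qed.

Lemma frac_oppE m s : frac_opp (frac m s) = frac (- m) s.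
Proof.
rewrite /frac_opp; have [u] := unfracP m s.
case: (unfrac (frac m s)) => [m' s'] /= uP.
by apply/fracP; exists u; rewrite scalerBr !scalerN uP subrr.
Qed.

Lemma frac_addA : associative frac_add.
Proof.
move=> x y z; rewrite -[x]unfracK -[y]unfracK -[z]unfracK !frac_addE.
apply: frac_eqW; rewrite ?val_denomM ?val_denom1 !scalerDr !scalerA addrA.
by congr (_ + _ + _); congr (_ *: _); ring.
Qed.

Lemma frac_addC : commutative frac_add.
Proof.
move=> x y; rewrite -[x]unfracK -[y]unfracK !frac_addE.
by apply: frac_eqW; rewrite ?val_denomM ?val_denom1 addrC mulrC.
Qed.

Lemma frac_add0 : left_id (frac 0 denom1) frac_add.
Proof.
move=> x; rewrite -[x]unfracK !frac_addE.
by apply: frac_eqW; rewrite ?val_denomM ?val_denom1 scaler0 add0r !scalerA; congr (_ *: _); ring.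
Qed.

Lemma frac_addN : left_inverse (frac 0 denom1) frac_opp frac_add.
Proof.
move=> x; rewrite -[x]unfracK !frac_oppE !frac_addE.
by apply: frac_eqW; rewrite ?val_denomM ?val_denom1 scalerN addNr !scaler0.
Qed.

HB.instance Definition _ := GRing.isZmodule.Build localization
  frac_addA frac_addC frac_add0 frac_addN.

Lemma fracD m s n t :
  frac m s + frac n t = frac (val t *: m + val s *: n) (denomM s t).
Proof. exact: frac_addE. Qed.

End LocalModule.

(** [(a / s) (m / t) = (a m) / (s t)]; for [M = R] this is the product of [R_p]. *)
Definition frac_scale (M : lmodType R) (x : localization R^o)
    (y : localization M) : localization M :=
  let: (a, s) := unfrac x in let: (m, t) := unfrac y in
  frac ((a : R) *: m) (denomM s t).

Lemma frac_scaleE (M : lmodType R) (a : R^o) s (m : M) t :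
  frac_scale (frac a s) (frac m t) = frac ((a : R) *: m) (denomM s t).
Proof.
rewrite /frac_scale; have [u] := unfracP a s; have [v] := unfracP m t.
case: (unfrac (frac a s)) (unfrac (frac m t)) => [a' s'] [m' t'] /= vP uP.
apply/fracP; exists (denomM u v); move: uP vP.
case: u v s t s' t' => [u _] [v _] [s _] [t _] [s' _] [t' _] /= uP vP.
rewrite scalerBr; apply/eqP; rewrite subr_eq0; apply/eqP; rewrite !scalerA.
transitivity ((u * (s * a')) *: (v *: (t *: m'))).
  by rewrite !scalerA; congr (_ *: _); ring.
have -> : u * (s * a') = u * (s' * a) by exact: uP.
by rewrite vP !scalerA; congr (_ *: _); ring.
Qed.

Section ScaleTheory.
Variable M : lmodType R.
Implicit Types (x y : localization R^o) (z : localization M).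

Lemma frac_scaleA x y z :
  frac_scale x (frac_scale y z) = frac_scale (frac_scale x y) z.
Proof.
rewrite -[x]unfracK -[y]unfracK -[z]unfracK !frac_scaleE.
apply: frac_eqW; rewrite !val_denomM !scalerA.
by congr (_ *: _); rewrite /GRing.scale /=; ring.
Qed.

Lemma frac_scale1 z : frac_scale (frac (1 : R^o) denom1) z = z.
Proof.
rewrite -[z]unfracK frac_scaleE; apply: frac_eqW.
by rewrite val_denomM val_denom1 scale1r mul1r.
Qed.

Lemma frac_scaleDr x : {morph @frac_scale M x : z w / z + w}.
Proof.
move=> z w; rewrite -[x]unfracK -[z]unfracK -[w]unfracK.
rewrite !fracD !frac_scaleE fracD; apply: frac_eqW.
rewrite !val_denomM !scalerDr !scalerA.
by congr (_ + _); congr (_ *: _); rewrite /GRing.scale /=; ring.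
Qed.

Lemma frac_scaleDl z : {morph (@frac_scale M)^~ z : x y / x + y}.
Proof.
move=> x y; rewrite -[x]unfracK -[y]unfracK -[z]unfracK.
rewrite !fracD !frac_scaleE fracD; apply: frac_eqW.
rewrite !val_denomM !scalerDl !scalerDr !scalerA.
by congr (_ + _); congr (_ *: _); rewrite /GRing.scale /=; ring.
Qed.

End ScaleTheory.

Definition local_at : Type := localization R^o.
HB.instance Definition _ := GRing.Zmodule.on local_at.

Definition local_mul : local_at -> local_at -> local_at := @frac_scale R^o.
Definition local_one : local_at := frac (1 : R^o) denom1.

Lemma local_mulA : associative local_mul.
Proof. exact: (@frac_scaleA R^o). Qed.

Lemma local_mulC : commutative local_mul.
Proof.
move=> x y; rewrite -[x]unfracK -[y]unfracK /local_mul !frac_scaleE.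
by apply: frac_eqW; rewrite !val_denomM /GRing.scale /=; ring.
Qed.

Lemma local_mul1 : left_id local_one local_mul.
Proof. exact: (@frac_scale1 R^o). Qed.

Lemma local_mulDl : left_distributive local_mul +%R.
Proof. by move=> x y z; apply: (@frac_scaleDl R^o). Qed.

Lemma local_one_neq0 : local_one != 0.
Proof.
apply/eqP => /fracP[[u up]] /=.
rewrite !scale1r subr0 /GRing.scale /= mulr1 => u0.
by move: up; rewrite u0 idealr0.
Qed.

HB.instance Definition _ := GRing.Zmodule_isComNzRing.Build local_at
  local_mulA local_mulC local_mul1 local_mulDl local_one_neq0.

HB.instance Definition _ (M : lmodType R) :=
  GRing.Zmodule_isLmodule.Build local_at (localization M)
    (@frac_scaleA M) (@frac_scale1 M) (@frac_scaleDr M) (@frac_scaleDl M).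

End Localization.

Section Koszul.
Variables (R : comNzRingType) (M : lmodType R) (d : nat) (x : 'I_d -> R).

(** The Koszul complex is the exterior algebra on [e_0, ..., e_{d-1}] tensored
    with [M]: [f] stands for the sum over the subsets [S] of ['I_d] of
    [f S * e_S], which has degree [i] when [f] lives on the [S] of
    cardinality [i]. *)
Definition koszul_chain (i : nat) : set {ffun {set 'I_d} -> M} :=
  [set f : {ffun {set 'I_d} -> M} | forall S : {set 'I_d}, #|S| != i -> f S = 0].

(** The coefficient at [e_T] comes from the [e_(T + j)], whose differential has
    the term [(-1)^k x_j e_T], where [k] is the number of elements of [T] below
    [j]. *)
Definition koszul_diff (f : {ffun {set 'I_d} -> M}) : {ffun {set 'I_d} -> M} :=
  [ffun T : {set 'I_d} => \sum_(j | j \notin T)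
     (-1) ^+ #|[set i in T | (i < j)%N]%SET| *: (x j *: f (j |: T)%SET)].

Definition koszul_homology (i : nat) : lmodType R :=
  subquot (koszul_chain i `&` [set f | koszul_diff f = 0])
          (koszul_diff @` koszul_chain i.+1).

End Koszul.

(** [K (x)_R M] has dimension [d] over the residue field [K = R / m], that is,
    it is isomorphic to [K^d]. *)
Definition nu (R : comNzRingType) (m : idealr R) (M : lmodType R) : nat :=
  xget 0%N [set d | inhabited (Vector.axiom d (extension (quot_ring m) M))].

Definition has_rank (R : comNzRingType) (M : lmodType R) (r : rat) : Prop :=
  forall p : prime_idealr R, minimal_prime p ->
    (exists2 d, krull_dim R d & krull_dim (quot_ring p) d) ->
  exists l l0, [/\ has_length (localization p M) l,
    has_length (local_at p)^o l0 & l%:R = r * l0%:R].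

(** The lengths of the [V n] are finite for large [n], and are [o(alpha n)]. *)
Definition length_littleo (R : nzRingType) (V : nat -> lmodType R)
    (alpha : nat -> rat) : Prop :=
  exists2 l : nat -> nat, \forall n \near \oo, has_length (V n) (l n) &
    (fun n => (l n)%:R : rat^o) =o_\oo (fun n => alpha n : rat^o).

Section LimCohenMacaulay.
Variables (R : comNzRingType) (m : idealr R) (M : nat -> lmodType R).

Definition lim_CM : Prop :=
  (forall n, finitely_generated [set: M n] /\ exists v : M n, v != 0) /\
  exists d (x : 'I_d -> R), sop m x /\ forall i, (0 < i)%N ->
    length_littleo (fun n => koszul_homology (M n) x i)
                   (fun n => (nu m (M n))%:R).

Section Closure.
Variables (alpha : nat -> rat) (B : lmodType R).

(** [Im (M n (x) A'/A -> M n (x) B/A)]. *)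
Definition closure_image (A A' : set B) (n : nat) : lmodType R :=
  sub_module (range (tensor_map (@idfun (M n)) (@subquot_incl R B A' A))).

Definition closure_candidate (A A' : set B) : Prop :=
  [/\ submodule A', A `<=` A' & length_littleo (closure_image A A') alpha].

(** The closure when [B / A] has finite length, as the union of the candidates;
    see [fl_closure_largest]. *)
Definition fl_closure (A : set B) : set B :=
  \bigcup_(A' in closure_candidate A) A'.

Lemma fl_closure_largest (A C : set B) :
  closure_candidate A C -> (forall A', closure_candidate A A' -> A' `<=` C) ->
  fl_closure A = C.
Proof.
move=> CC Cmax; apply/seteqP; split=> [b [A' /Cmax] | b Cb]; first exact.
by exists C.
Qed.

Definition Mclosure (A : set B) : set B :=
  \bigcap_(t in [set: nat]) fl_closure
    [set a + b | a in A & b in ideal_mul (ideal_exp [set` m] t) [set: B]].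

End Closure.
End LimCohenMacaulay.

(* Main.v *)
(** Proof idea. For an ideal [A], the image of [M_n (x) A'/A] in [M_n (x) R/A]
    is [A' M_n / A M_n], so [u] is in the closure of [A] when
    [l((A + R u) M_n / A M_n) = o(alpha n)], and in the definition of the closure
    the ideals [A + m^t] may be replaced by the ideals generated by [A] and the
    [t]-th powers of the remaining parameters. The theorem then compares, for a
    full system of parameters, [M_n / (x^a) M_n] with [M_n / (x^(a + b)) M_n]
    through the multiplication by [x^b], whose kernel has a length bounded by a
    multiple of the length of [H_1(x; M_n)], which is [o(nu(M_n))].

    That this holds for every system of parameters [x] when it holds for one, [w],
    follows from the Koszul complex on [w] and [x] together: since [x] has [d]
    elements, its homology is [o(nu)] in degrees larger than [d], and since each
    [w_i] is nilpotent on the homology of [x], [l(H_j(x))] is at most a constant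
    times the length of its homology in degree [d + j].

    For the rank, [nu(M_n) = O(rank M_n)]: with [x] a system of parameters,
    [nu(M)] is at most [l(M / x M) <= t^(-d) l(M / (x_1^t, ..., x_d^t) M) +
    d l(H_1(x; M))], and a filtration of [M] with quotients [R / P] bounds the
    first term for large [t] by a constant times the number of quotients
    with [dim R / P = d], which is at most the sum of the lengths of the [M_P]. *)
Require Import Defs.
From HB Require Import structures.
From mathcomp Require Import all_boot all_order all_algebra.
From mathcomp Require Import ring lra zify boolp classical_sets filter topology normedtype landau.

Set Implicit Arguments.
Unset Strict Implicit.
Unset Printing Implicit Defensive.

Import Order.TTheory GRing.Theory Num.Theory.
Import numFieldNormedType.Exports.

Local Open Scope ring_scope.
Local Open Scope classical_set_scope.

(** * Lengths of intervals of submodules *)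

Section SubmoduleSets.
Variables (R : nzRingType) (V : lmodType R).
Implicit Types A B N : set V.

(** The obstacle is uniformity in [n]: constants may depend on [R], the parameters and the
    exponents, never on [M_n]. For the Koszul complex everything rests on one short exact sequence,
    for a set [S] of parameters and a further [x_j]: 0 -> H_(i+1)(S) / x_j -> H_(i+1)(S + j) -> ann
    of x_j in H_i(S) -> 0. Read forwards it bounds homology after adding an element, read backwards
    it bounds annihilators, and the constants are products of exponents, of powers of 2 and of
    nilpotency orders. For the rank, [t] tends to infinity with [M_n] fixed, so the lower-order
    constant of the growth may depend on [M_n], but the leading one must come from the finitely many
    primes of maximal dimension in [R]. The error due to H_1 has to stay of order [t^d]; bounding
    the annihilator of [y^k] by [k] times that of [y] would lose a factor [t]. What saves it is that
    on a module of finite length the kernel and the cokernel of [y] have equal lengths. *)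

Definition sadd A B : set V := [set a + b | a in A & b in B].

Lemma submod0 N : submodule N -> N 0.
Proof. by case/submoduleP. Qed.

Lemma submodD N u v : submodule N -> N u -> N v -> N (u + v).
Proof. by case/submoduleP => _ h Nu Nv; rewrite -[u]scale1r; exact: h. Qed.

Lemma submodZ N a u : submodule N -> N u -> N (a *: u).
Proof.
by move=> sN Nu; rewrite -[_ *: _]addr0; case/submoduleP: sN => N0; apply.
Qed.

Lemma submodN N u : submodule N -> N u -> N (- u).
Proof. by move=> sN Nu; rewrite -scaleN1r; exact: submodZ. Qed.

Lemma submodB N u v : submodule N -> N u -> N v -> N (u - v).
Proof. by move=> sN Nu Nv; apply: submodD => //; exact: submodN. Qed.

Lemma submod_sum (I : Type) (r : seq I) (P : pred I) (F : I -> V) N :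
  submodule N -> (forall i, P i -> N (F i)) -> N (\sum_(i <- r | P i) F i).
Proof.
by move=> sN NF; elim/big_rec: _ => [|i x Pi Nx]; [exact: submod0|
  apply: submodD => //; exact: NF].
Qed.

Lemma submodT : submodule [set: V].
Proof. by apply/submoduleP. Qed.

Lemma submod_span N : submodule [set` Defs.span N].
Proof.
by apply/submoduleP; split=> [|a u v /= Nu Nv] /=;
  [exact: rpred0|rewrite rpredD ?rpredZ].
Qed.

Lemma span_sub N (B : set V) : submodule B -> N `<=` B -> [set` Defs.span N] `<=` B.
Proof. by move=> sB NB v /asboolP; apply. Qed.

Lemma submodI A B : submodule A -> submodule B -> submodule (A `&` B).
Proof.
move=> /submoduleP[A0 AP] /submoduleP[B0 BP].
by apply/submoduleP; split=> // a u v [Au Bu] [Av Bv]; split; [exact: AP|exact: BP].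
Qed.

Lemma submod_add A B : submodule A -> submodule B -> submodule (sadd A B).
Proof.
move=> /submoduleP[A0 AP] /submoduleP[B0 BP].
apply/submoduleP; split=> [|a _ _ [x Ax [y By <-]] [z Az [w Bw <-]]].
  by exists 0 => //; exists 0 => //; rewrite addr0.
exists (a *: x + z); first exact: AP.
by exists (a *: y + w); [exact: BP|rewrite scalerDr addrACA].
Qed.

Lemma saddl A B : B 0 -> A `<=` sadd A B.
Proof. by move=> B0 a Aa; exists a => //; exists 0 => //; rewrite addr0. Qed.

Lemma saddr A B : A 0 -> B `<=` sadd A B.
Proof. by move=> A0 b Bb; exists 0 => //; exists b => //; rewrite add0r. Qed.

Lemma sadd_sub A B N : submodule N -> A `<=` N -> B `<=` N -> sadd A B `<=` N.
Proof.
by move=> sN AN BN _ [a /AN Na [b /BN Nb <-]]; exact: submodD.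
Qed.

Lemma saddS A A' B B' : A `<=` A' -> B `<=` B' -> sadd A B `<=` sadd A' B'.
Proof. by move=> AA BB _ [a /AA Aa [b /BB Bb <-]]; exists a => //; exists b. Qed.

End SubmoduleSets.

Section SubmoduleMaps.
Variables (R : nzRingType) (V W : lmodType R) (f : {linear V -> W}).

Lemma submod_preim (N : set W) : submodule N -> submodule (f @^-1` N).
Proof.
move=> /submoduleP[N0 NP]; apply/submoduleP.
by split=> [|a u v Nu Nv]; rewrite /preimage /= ?linear0 ?linearP //; exact: NP.
Qed.

Lemma submod_im (N : set V) : submodule N -> submodule (f @` N).
Proof.
move=> /submoduleP[N0 NP]; apply/submoduleP.
split=> [|a _ _ [u Nu <-] [v Nv <-]]; first by exists 0; rewrite ?linear0.
by exists (a *: u + v); [exact: NP|rewrite linearP].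
Qed.

End SubmoduleMaps.

Section Length.
Variables (R : nzRingType) (V : lmodType R).
Implicit Types (A B C : set V) (N : nat -> set V).

Definition chain A B N :=
  (forall i, [/\ submodule (N i), A `<=` N i & N i `<=` B]) /\
  (forall i, N i `<=` N i.+1).

Definition jumps N k : nat := \sum_(i < k) `[< ~ N i.+1 `<=` N i >].

(** [\ell (B / A) <= l], as a bound on the chains of submodules between [A] and
    [B], so that no quotient module is needed. *)
Definition length_le A B l := forall N k, chain A B N -> (jumps N k <= l)%N.

Lemma length_leW A B l l' : (l <= l')%N -> length_le A B l -> length_le A B l'.
Proof. by move=> ll h N k /h/leq_trans; apply. Qed.

Lemma length_le_same A B l : B `<=` A -> length_le A B l.
Proof.
move=> BA N k [sN _]; rewrite /jumps big1 // => i _.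
apply/eqP; rewrite eqb0; apply/asboolPn => -[] v Nv.
by case: (sN i) => _ AN _; case: (sN i.+1) => _ _ NB; apply/AN/BA/NB.
Qed.

Lemma length_leS A A' B B' l :
  A' `<=` A -> B `<=` B' -> length_le A' B' l -> length_le A B l.
Proof.
move=> AA BB h N k [sN NS]; apply: h; split=> // i.
by case: (sN i) => s AN NB; split=> //; [apply: subset_trans AN|apply: subset_trans BB].
Qed.

Lemma jumps_strict N k : (forall i, (i < k)%N -> N i `<` N i.+1) -> jumps N k = k.
Proof.
move=> h; rewrite /jumps (eq_bigr (fun=> 1%N)) ?sum1_card ?card_ord // => i _.
by rewrite asboolT //; have [_] := h i (ltn_ord i).
Qed.

Lemma length_le_strict A B l N k : length_le A B l ->
  (forall i, (i <= k)%N -> [/\ submodule (N i), A `<=` N i & N i `<=` B]) ->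
  (forall i, (i < k)%N -> N i `<` N i.+1) -> (k <= l)%N.
Proof.
move=> h sN NS; pose N' i := N (minn i k).
rewrite -(@jumps_strict N' k) => [|i ik]; last first.
  by rewrite /N' (minn_idPl (ltnW ik)) (minn_idPl ik); exact: NS.
apply: h; split=> i; first by apply: sN; rewrite geq_minr.
rewrite /N'; have [ik|ki] := boolP (i < k)%N; last first.
  by rewrite !(minn_idPr _) //; lia.
by rewrite (minn_idPl (ltnW ik)) (minn_idPl ik); have [] := NS i ik.
Qed.

Lemma chain_strict A B N k : chain A B N -> exists N' : nat -> set V,
  [/\ forall i, (i <= jumps N k)%N ->
        [/\ submodule (N' i), A `<=` N' i & N' i `<=` B],
     forall i, (i < jumps N k)%N -> N' i `<` N' i.+1
   & N' (jumps N k) = N k].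
Proof.
move=> [sN NS]; elim: k => [|k [N' [sN' N'S N'k]]].
  by exists N; rewrite /jumps big_ord0; split.
rewrite /jumps big_ord_recr /= -/(jumps N k).
case: asboolP => [ne|/contrapT h] /=; [rewrite addn1|rewrite addn0]; last first.
  by exists N'; split=> //; rewrite N'k; exact/seteqP.
exists (fun i => if (i <= jumps N k)%N then N' i else N k.+1); split=> [i|i|].
- by case: ifP => [/sN'|_ _].
- rewrite ltnS => ik; rewrite ik; case: ltnP => ik'; first exact: N'S.
  by have -> : i = jumps N k by [apply/eqP; rewrite eqn_leq ik]; rewrite N'k; split.
- by rewrite ltnn.
Qed.

Lemma length_leP A B l :
  (forall N k, (forall i, (i <= k)%N -> [/\ submodule (N i), A `<=` N i & N i `<=` B]) ->
    (forall i, (i < k)%N -> N i `<` N i.+1) -> (k <= l)%N) -> length_le A B l.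
Proof. by move=> h N k /(@chain_strict _ _ _ k)[N' [? ? _]]; exact: (h N'). Qed.

(** By the modular law, a strict step of [N] remains strict in [N i] intersected with [B] or in
    [N i + B]. *)
Lemma length_le_add A B C a b : submodule A -> submodule B ->
  A `<=` B -> B `<=` C -> submodule C ->
  length_le A B a -> length_le B C b -> length_le A C (a + b).
Proof.
move=> sA sB AB BC sC ha hb N k [sN NS].
have c1 : chain A B (fun i => N i `&` B).
  split=> i; last exact: setSI.
  by case: (sN i) => s AN NC; split=> //; [exact: submodI|move=> v ?; split; auto].
have c2 : chain B C (fun i => sadd (N i) B).
  split=> i; last exact: saddS.
  case: (sN i) => s AN NC; split; first exact: submod_add.
    by apply: saddr; exact: submod0.
  exact: sadd_sub.
apply: leq_trans (leq_add (ha _ k c1) (hb _ k c2)).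
rewrite /jumps -big_split; apply: leq_sum => i _ /=.
case: (asboolP (~ N i.+1 `<=` N i)) => //= ne.
case: asboolP => [//|/contrapT h1]; case: asboolP => [//|/contrapT h2].
case: ne => v Nv; case: (sN i) => si _ _; case: (sN i.+1) => s1 _ _.
have [|u Nu [w Bw uw]] := h2 v; first by exists v => //; exists 0; rewrite ?addr0 //; exact: submod0.
have [|Nw _] := h1 w.
  split=> //; have -> : w = v - u by rewrite -uw [u + w]addrC addrK.
  by apply: submodB => //; exact: NS.
by rewrite -uw; exact: submodD.
Qed.

(** Any chain from [B] to [C] can be put on top of a longest chain from [A] to [B]. *)
Lemma length_le_split A B C l : A `<=` B -> B `<=` C -> submodule B ->
  length_le A C l -> exists a b, [/\ (a + b <= l)%N, length_le A B a & length_le B C b].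
Proof.
move=> AB BC sB h.
pose P a := `[< exists N k, chain A B N /\ jumps N k = a >].
have exP : exists a, P a.
  exists 0%N; apply/asboolP; exists (fun=> B), 0%N.
  by split; [by split=> [i|i v //]; split|rewrite /jumps big_ord0].
have Pl a : P a -> (a <= l)%N.
  move=> /asboolP[N [k [cN <-]]]; apply: h; case: cN => sN NS; split=> // i.
  by case: (sN i) => s AN NB; split=> //; apply: subset_trans BC.
case: (ex_maxnP exP Pl) => a /asboolP[N [k [[sN NS] Na]]] amax.
have ha : length_le A B a by move=> N' k' c; apply: amax; apply/asboolP; exists N', k'.
have al : (a <= l)%N by rewrite Pl //; apply/asboolP; exists N, k.
exists a, (l - a)%N; split=> //; first by rewrite subnKC.
move=> N2 k2 [sN2 NS2]; rewrite leq_subRL //.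
(* The passage from index [k] to [k.+1], where the two chains meet, may or may not be strict; it is
   left out of the count. *)
pose N3 i := if (i <= k)%N then N i else N2 (i - k.+1)%N.
have c3 : chain A C N3.
  split=> i; rewrite /N3.
    case: ifP => _; [case: (sN i)|case: (sN2 (i - k.+1)%N)] => s h1 h2; split=> //.
      exact: subset_trans BC.
    exact: subset_trans h1.
  case: (ltngtP i k) => ik.
  - exact: NS.
  - by rewrite subSn //; exact: NS2.
  rewrite -ik subnn; case: (sN i) => _ _ NB; case: (sN2 0%N) => _ BN _.
  exact: subset_trans BN.
apply: leq_trans (h _ (k.+1 + k2)%N c3).
rewrite -Na /jumps big_split_ord /=; apply: leq_add.
  rewrite big_ord_recr /=; apply: leq_trans (leq_addr _ _).
  by apply: leq_sum => i _; rewrite /N3 /= ltn_ord (ltnW (ltn_ord i)).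
apply: leq_sum => i _; rewrite /N3.
have -> : ((k.+1 + i).+1 <= k)%N = false by lia.
have -> : (k.+1 + i <= k)%N = false by lia.
have -> : ((k.+1 + i).+1 - k.+1 = i.+1)%N by lia.
by rewrite addKn.
Qed.

Definition finite_len A B := exists l, length_le A B l.

(** The default [0] stands for infinite length, so [len] carries information only together with
    [finite_len]. *)
Definition len A B : nat :=
  xget 0%N [set l | length_le A B l /\ forall l', length_le A B l' -> (l <= l')%N].

Lemma lenP A B : finite_len A B -> length_le A B (len A B).
Proof.
move=> [l h]; rewrite /len; case: xgetP => [x _ []//|].
have ex : exists l, `[< length_le A B l >] by exists l; exact/asboolP.
case: (ex_minnP ex) => n /asboolP hn nmin /(_ n)[]; split=> // l' hl'.
by apply: nmin; exact/asboolP.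
Qed.

Lemma len_le A B l : length_le A B l -> (len A B <= l)%N.
Proof.
by move=> h; rewrite /len; case: xgetP => [x _ [_ /(_ _ h)]|].
Qed.

Lemma length_len A B l :
  length_le A B l <-> finite_len A B /\ (len A B <= l)%N.
Proof.
split=> [h|[/lenP h hl]]; last exact: length_leW h.
by split; [exists l|exact: len_le].
Qed.

Lemma finite_len_sub A A' B B' :
  A' `<=` A -> B `<=` B' -> finite_len A' B' -> finite_len A B.
Proof. by move=> AA BB [l h]; exists l; exact: length_leS h. Qed.

Lemma lenD A B C : submodule A -> submodule B -> submodule C ->
  A `<=` B -> B `<=` C -> finite_len A C -> len A C = (len A B + len B C)%N.
Proof.
move=> sA sB sC AB BC fl; apply/eqP; rewrite eqn_leq; apply/andP; split.
  apply/len_le/(length_le_add sA sB AB BC sC); apply: lenP.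
    exact: finite_len_sub fl.
  exact: finite_len_sub fl.
have [a [b [ab ha hb]]] := length_le_split AB BC sB (lenP fl).
exact: leq_trans (leq_add (len_le ha) (len_le hb)) ab.
Qed.

End Length.

Lemma length_le_transfer (R R' : nzRingType) (V : lmodType R) (V' : lmodType R')
    (A B : set V) (A' B' : set V') (phi : set V -> set V') l :
  (forall N, submodule N -> A `<=` N -> N `<=` B ->
    [/\ submodule (phi N), A' `<=` phi N & phi N `<=` B']) ->
  (forall N N', submodule N -> submodule N' -> A `<=` N -> N' `<=` B ->
    N `<=` N' -> phi N `<=` phi N' /\ (phi N' `<=` phi N -> N' `<=` N)) ->
  length_le A' B' l -> length_le A B l.
Proof.
move=> phiP phiS h N k [sN NS].
have c : chain A' B' (phi \o N).
  split=> i /=; first by case: (sN i) => *; exact: phiP.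
  case: (sN i) (sN i.+1) => s AN NB [s1 AN1 NB1].
  by have [//|//|//|//||//] := phiS (N i) (N i.+1); auto.
apply: leq_trans (h _ k c); apply: leq_sum => i _ /=.
case: (asboolP (~ N i.+1 `<=` N i)) => // ne.
case: asboolP => // /contrapT h1; case: ne.
case: (sN i) (sN i.+1) => s AN NB [s1 AN1 NB1].
by have [//|//|//|//||_] := phiS (N i) (N i.+1); auto.
Qed.

Section LengthMaps.
Variables (R : nzRingType) (V W : lmodType R) (f : {linear V -> W}).
Variables (A B : set V) (A' B' : set W).
Hypotheses (sA : submodule A) (sB : submodule B).
Hypotheses (sA' : submodule A') (sB' : submodule B').

(** [N] goes to [A' + f(N)], which determines it because the elements of [B] that [f] sends into
    [A'] lie in [A]. *)
Lemma length_le_inj l : A' `<=` B' -> f @` B `<=` B' ->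
  (forall v, B v -> A' (f v) -> A v) ->
  length_le A' B' l -> length_le A B l.
Proof.
move=> AB' fB fA; apply: (@length_le_transfer _ _ _ _ _ _ _ _ (fun N => sadd A' (f @` N))).
  move=> N sN AN NB; split.
  - by apply: submod_add => //; exact: submod_im.
  - by apply: saddl; exists 0; rewrite ?linear0 //; exact: submod0.
  - by apply: sadd_sub => //; apply: subset_trans fB; exact: image_subset.
move=> N N' sN sN' AN NB NN; split; first by apply: saddS => //; exact: image_subset.
move=> h v Nv; have [|a Aa [_ [u Nu <-] e]] := h (f v).
  by exists 0; [exact: submod0|exists (f v); [exists v|rewrite add0r]].
have -> : v = (v - u) + u by rewrite subrK.
apply: submodD => //; apply: AN; apply: fA.
  by apply: submodB => //; auto.
by rewrite raddfB /= -e addrK.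
Qed.

(** [N] goes to its preimage in [B], which determines it because [B'] is covered by [A' + f(B)]. *)
Lemma length_le_surj l : A `<=` B ->
  (forall v, A v -> A' (f v)) -> B' `<=` sadd A' (f @` B) ->
  length_le A B l -> length_le A' B' l.
Proof.
move=> AB fA fB; apply: (@length_le_transfer _ _ _ _ _ _ _ _ (fun N => (f @^-1` N) `&` B)).
  move=> N sN AN NB; split.
  - by apply: submodI => //; exact: submod_preim.
  - by move=> v Av; split; [apply/AN/fA|exact: AB].
  - by move=> v [].
move=> N N' sN sN' AN NB NN; split; first by move=> v [Nv Bv]; split=> //; exact: NN.
move=> h w Nw; have [|a Aa [_ [u Bu <-] e]] := fB w; first exact: NB.
have [|Nu _] := h u.
  split=> //; rewrite /preimage /=.
  have -> : f u = w - a by rewrite -e [a + _]addrC addrK.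
  by apply: submodB => //; apply/NN/AN.
by rewrite -e; apply: submodD => //; exact: AN.
Qed.

End LengthMaps.

Arguments length_le_inj {R V W} f {A B A' B'} _ _ _ {l}.
Arguments length_le_surj {R V W} f {A B A' B'} _ {l}.

Section LengthIso.
Variables (R : nzRingType) (V W : lmodType R) (f : {linear V -> W}).
Variables (A B : set V) (A' B' : set W).
Hypotheses (sA : submodule A) (sB : submodule B).
Hypotheses (sA' : submodule A') (sB' : submodule B').
Hypotheses (AB : A `<=` B) (AB' : A' `<=` B').
Hypotheses (fA : forall v, B v -> (A v <-> A' (f v))) (fB : f @` B `<=` B').
Hypothesis fB' : B' `<=` sadd A' (f @` B).

Lemma length_le_iso l : length_le A B l <-> length_le A' B' l.
Proof.
split; last by apply: (length_le_inj f sB sA' sB' AB' fB) => v Bv /fA; apply.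
by apply: (length_le_surj f sB AB) => // v Av; rewrite -fA //; exact: AB.
Qed.

Lemma len_iso : len A B = len A' B'.
Proof.
by rewrite /len; congr xget; apply/seteqP; split=> l [hl lmin] /=;
  split=> [|l' hl']; (exact/length_le_iso || apply/lmin/length_le_iso).
Qed.

End LengthIso.

Arguments length_le_iso {R V W} f {A B A' B'}.
Arguments len_iso {R V W} f {A B A' B'}.

(** * The Koszul complex *)

Section KoszulOperators.
Variables (R : comNzRingType) (M : lmodType R) (d : nat).
Implicit Types (x : 'I_d -> R) (f g : {ffun {set 'I_d} -> M}).
Implicit Types (S T : {set 'I_d}) (j l : 'I_d) (i : nat).

Definition ksign j T : R := (-1) ^+ #|[set l in T | (l < j)%N]%SET|.

Lemma ksignK j T (v : M) : ksign j T *: (ksign j T *: v) = v.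
Proof. by rewrite scalerA -expr2 sqrr_sign scale1r. Qed.

Lemma ksignU j l T : l \notin T ->
  ksign j (l |: T) = (-1) ^+ (l < j)%N * ksign j T.
Proof.
move=> lT; rewrite -exprD; congr (_ ^+ _).
have [lj|lj] := boolP (l < j)%N.
  have -> : [set k in l |: T | (k < j)%N]%SET = (l |: [set k in T | (k < j)%N])%SET.
    by apply/setP => k; rewrite !inE; case: eqP => [->|].
  by rewrite cardsU1 !inE (negPf lT).
apply: eq_card => k; rewrite !inE.
by case: eqP => [->|//]; rewrite (negPf lj) !andbF.
Qed.

Lemma ksignU1 j T : ksign j (j |: T) = ksign j T.
Proof.
congr (_ ^+ _); apply: eq_card => l; rewrite !inE.
by case: eqP => [->|//]; rewrite ltnn !andbF.
Qed.

Lemma ksignD1 j T : ksign j (T :\ j) = ksign j T.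
Proof.
congr (_ ^+ _); apply: eq_card => l; rewrite !inE.
by case: eqP => [->|//]; rewrite ltnn !andbF.
Qed.

(** The term [e_l] moves past [e_j] or the other way around, but not both. *)
Lemma ksign_swap j l T : j != l -> j \notin T -> l \notin T ->
  ksign j T * ksign l (j |: T) = - (ksign l T * ksign j (l |: T)).
Proof.
move=> jl jT lT; rewrite !ksignU //.
have : val j != val l by [].
by case: ltngtP => // _ _ /=; ring.
Qed.

Definition wedge j f : {ffun {set 'I_d} -> M} :=
  [ffun T : {set 'I_d} => if j \in T then ksign j T *: f (T :\ j)%SET else 0].

Definition contract j f : {ffun {set 'I_d} -> M} :=
  [ffun T : {set 'I_d} => if j \in T then 0 else ksign j T *: f (j |: T)%SET].

Lemma koszul_diffE x f T :
  koszul_diff x f T = \sum_(j | j \notin T) ksign j T *: (x j *: f (j |: T)%SET).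
Proof. by rewrite ffunE. Qed.

Lemma wedge_linear j : linear (wedge j).
Proof.
move=> a f g; apply/ffunP => T; rewrite !ffunE.
by case: ifP => _; rewrite ?scaler0 ?addr0 // scalerDr !scalerA mulrC.
Qed.

Lemma contract_linear j : linear (contract j).
Proof.
move=> a f g; apply/ffunP => T; rewrite !ffunE.
by case: ifP => _; rewrite ?scaler0 ?addr0 // scalerDr !scalerA mulrC.
Qed.

Lemma koszul_diff_linear x : linear (koszul_diff x : {ffun {set 'I_d} -> M} -> _).
Proof.
move=> a f g; apply/ffunP => T; rewrite !ffunE scaler_sumr -big_split /=.
apply: eq_bigr => j _; rewrite !ffunE !scalerDr !scalerA; congr (_ *: _ + _).
by ring.
Qed.

HB.instance Definition _ j := GRing.isLinear.Build R _ _ _ (wedge j) (wedge_linear j).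
HB.instance Definition _ j :=
  GRing.isLinear.Build R _ _ _ (contract j) (contract_linear j).
HB.instance Definition _ x := GRing.isLinear.Build R _ _ _
  (koszul_diff x : {ffun {set 'I_d} -> M} -> _) (koszul_diff_linear x).

(** The two terms are the part of [f] without [e_j] and the part with [e_j]; this splitting drives
    every argument that adds one element to the sequence. *)
Lemma contract_wedge j f : contract j (wedge j f) + wedge j (contract j f) = f.
Proof.
apply/ffunP => T; rewrite !ffunE; have [jT|jT] := boolP (j \in T).
  by rewrite !inE eqxx /= add0r ksignD1 ksignK finset.setD1K.
by rewrite !inE eqxx /= addr0 ksignU1 ksignK finset.setU1K.
Qed.

(** The Leibniz rule: [wedge j] is a homotopy from multiplication by [x j] to zero, whence [x j]
    annihilates the homology. *)
Lemma diff_wedge x j f :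
  koszul_diff x (wedge j f) + wedge j (koszul_diff x f) = x j *: f.
Proof.
apply/ffunP => T; rewrite ffunE koszul_diffE [wedge j _ T]ffunE [RHS]ffunE koszul_diffE.
have [jT|jT] := boolP (j \in T); last first.
  rewrite addr0 (bigD1 j) //= [X in _ + X]big1 => [|l /andP[lT lj]]; last first.
    rewrite ffunE !inE eq_sym (negPf lj) (negPf jT) /= !scaler0 //.
  rewrite ffunE !inE eqxx /= addr0 ksignU1 finset.setU1K //.
  by rewrite scalerA mulrC -scalerA ksignK.
rewrite [X in _ *: X](bigD1 j) /= ?inE ?eqxx //.
rewrite finset.setD1K // ksignD1 scalerDr ksignK addrCA -[RHS]addr0; congr (_ + _).
rewrite scaler_sumr; under [X in _ + X]eq_bigl => l.
  rewrite !inE negb_and negbK andbC.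
  have -> : (l != j) && ((l == j) || (l \notin T)) = (l \notin T).
    by case: eqP => [->|]; rewrite ?jT.
  over.
(* For [l != j], removing [e_l] and inserting [e_j] in the two orders gives opposite signs. *)
rewrite -big_split big1 //= => l lT.
have jl : j != l by apply: contraNneq lT => <-.
rewrite ffunE !inE jT orbT.
have -> : ((l |: T) :\ j = l |: (T :\ j))%SET.
  by apply/setP => k; rewrite !inE; case: (k =P l) => [->|]; rewrite ?andbT // eq_sym jl.
have jT' : j \notin (T :\ j)%SET by rewrite !inE eqxx.
have lT' : l \notin (T :\ j)%SET by rewrite !inE (negPf lT) andbF.
rewrite -(finset.setD1K jT) ksignU1; set T' := (T :\ j)%SET in jT' lT' *.
have -> : ksign j (l |: (j |: T')) = ksign j (l |: T').
  by rewrite finset.setUCA ksignU1.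
rewrite !scalerA -scalerDl finset.setU1K // [X in X *: _](_ : _ = 0) ?scale0r //.
rewrite !ksignU //; have : val j != val l by [].
by case: ltngtP => // _ _ /=; ring.
Qed.

Lemma diff_contract x j f :
  koszul_diff x (contract j f) = - contract j (koszul_diff x f).
Proof.
apply/ffunP => T; rewrite koszul_diffE [RHS]ffunE [contract j _ T]ffunE koszul_diffE.
have [jT|jT] := boolP (j \in T).
  by rewrite oppr0 big1 // => l lT; rewrite ffunE !inE jT orbT !scaler0.
rewrite (bigD1 j) //= ffunE !inE eqxx /= !scaler0 add0r scaler_sumr -sumrN.
apply: eq_big => [l|l /andP[lT lj]]; first by rewrite !inE negb_or andbC.
have jl : j != l by rewrite eq_sym.
rewrite ffunE !inE (negPf jl) (negPf jT) /= finset.setUCA !scalerA -scaleNr.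
by congr (_ *: _); rewrite mulrAC -(mulrAC (ksign j T)) ksign_swap //; ring.
Qed.

End KoszulOperators.

(** * Multiplication by a ring element on a quotient [B / A] *)

Section Homothety.
Variables (R : comNzRingType) (V : lmodType R).
Implicit Types (A B : set V) (y : R).

Definition homoth y (v : V) : V := y *: v.

Lemma homoth_linear y : linear (homoth y).
Proof. by move=> a u v; rewrite /homoth scalerDr !scalerA mulrC. Qed.

HB.instance Definition _ y := GRing.isLinear.Build R V V _ (homoth y) (homoth_linear y).

Lemma submod_homoth y B : submodule B -> submodule (homoth y @` B).
Proof. exact: submod_im. Qed.

Lemma homoth_sub y B : submodule B -> homoth y @` B `<=` B.
Proof. by move=> sB _ [v Bv <-]; exact: submodZ. Qed.

Variables (A B : set V) (y : R).
Hypotheses (sA : submodule A) (sB : submodule B).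

(** [B / A] contains the annihilator [ann_in / A] of [y], and has the quotient
    [B / im_plus] by the multiples of [y]. *)
Definition ann_in : set V := B `&` homoth y @^-1` A.
Definition im_plus : set V := sadd A (homoth y @` B).

Lemma submod_ann : submodule ann_in.
Proof. by apply: submodI => //; exact: submod_preim. Qed.

Lemma submod_im_plus : submodule im_plus.
Proof. by apply: submod_add => //; exact: submod_homoth. Qed.

End Homothety.

Section HomothetyPowers.
Variables (R : comNzRingType) (V : lmodType R).
Variables (A B : set V) (y : R).
Hypotheses (sA : submodule A) (sB : submodule B) (AB : A `<=` B).

(** Multiplication by [y ^+ t] embeds the annihilator of [y ^+ t.+1], modulo that of [y ^+ t], into
    the annihilator of [y]. *)
Lemma length_ann_exp t l : length_le A (ann_in A B y) l ->
  length_le A (ann_in A B (y ^+ t)) (t * l).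
Proof.
move=> h; elim: t => [|t IH].
  by apply: length_le_same => v [_]; rewrite /preimage /= /homoth expr0 scale1r.
rewrite mulSn addnC.
have sy k : submodule (ann_in A B (y ^+ k)) := submod_ann (y ^+ k) sA sB.
apply: (length_le_add sA (sy t)) => // [v Av|v [Bv Av]|].
- by split; [exact: AB|exact: submodZ].
- by split; rewrite // /preimage /= /homoth exprS -scalerA; exact: submodZ.
apply: (length_le_inj (homoth (y ^+ t)) _ sA (submod_ann y sA sB) _ _ _ h).
- exact: sy.
- by move=> v Av; split; [exact: AB|exact: submodZ].
- move=> _ [v [Bv Av] <-]; split; first exact: submodZ.
  by move: Av; rewrite /preimage /= /homoth scalerA exprS.
- by move=> v [Bv _] Av; split.
Qed.

(** Multiplication by [y ^+ t] maps [B / (A + y B)] onto [(A + y^t B) / (A + y^(t+1) B)]. *)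
Lemma length_im_exp t l : length_le (im_plus A B y) B l ->
  length_le (im_plus A B (y ^+ t)) B (t * l).
Proof.
move=> h; elim: t => [|t IH].
  apply: length_le_same => v Bv; exists 0; first exact: submod0.
  by exists v; rewrite ?add0r // ; exists v; rewrite // /homoth expr0 scale1r.
rewrite mulSn.
have sy k : submodule (im_plus A B (y ^+ k)) := submod_im_plus (y ^+ k) sA sB.
have le : im_plus A B (y ^+ t.+1) `<=` im_plus A B (y ^+ t).
  apply: saddS => // _ [v Bv <-]; exists (y *: v); first exact: submodZ.
  by rewrite /homoth scalerA exprSr.
have leB : im_plus A B (y ^+ t) `<=` B.
  by apply: sadd_sub => //; exact: homoth_sub.
apply: (length_le_add (sy t.+1) (sy t) le leB sB _ IH).
apply: (length_le_surj (homoth (y ^+ t)) sB _ _ _ h).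
- by apply: sadd_sub => //; exact: homoth_sub.
- move=> _ [a Aa [_ [b Bb <-] <-]]; rewrite linearD; exists (homoth (y ^+ t) a).
    exact: submodZ.
  by exists (homoth (y ^+ t.+1) b); [exists b|rewrite /= /homoth scalerA exprSr].
- by apply: saddS => //; apply: saddl; exact: submod0 (submod_homoth _ sB).
Qed.

Lemma length_nilp s l : (forall v, B v -> A (y ^+ s *: v)) ->
  length_le A (ann_in A B y) l -> length_le A B (s * l).
Proof.
move=> h hl; apply: (length_leS _ _ (@length_ann_exp s _ hl)) => // v Bv.
by split=> //; exact: h.
Qed.

End HomothetyPowers.

Section KoszulSubcomplex.
Variables (R : comNzRingType) (M : lmodType R) (d : nat).
Implicit Types (x : 'I_d -> R) (f g : {ffun {set 'I_d} -> M}).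
Implicit Types (S T : {set 'I_d}) (j l : 'I_d) (i : nat).

(** A single exterior algebra holds the Koszul complexes of all subsequences: adding an element only
    enlarges [S], without changing the type of the chains. *)
Definition supp S i : set {ffun {set 'I_d} -> M} :=
  [set f | forall T : {set 'I_d}, ~~ ((T \subset S) && (#|T| == i)) -> f T = 0].

(** Cycles and boundaries of the Koszul complex on the [x j] with [j] in [S]. *)
Definition cyc x S i : set {ffun {set 'I_d} -> M} :=
  supp S i `&` [set f | koszul_diff x f = 0].
Definition bnd x S i : set {ffun {set 'I_d} -> M} :=
  koszul_diff x @` supp S i.+1.

Lemma submod_supp S i : submodule (supp S i).
Proof.
apply/submoduleP; split=> [T _|a f g fS gS T nT]; first by rewrite ffunE.
by rewrite !ffunE fS // gS // scaler0 addr0.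
Qed.

Lemma submod_cyc x S i : submodule (cyc x S i).
Proof.
apply: submodI; first exact: submod_supp.
by apply/submoduleP; split=> [|a f g /= f0 g0] /=;
  [exact: linear0|rewrite linearP /= f0 g0 scaler0 addr0].
Qed.

Lemma submod_bnd x S i : submodule (bnd x S i).
Proof. by apply: submod_im; exact: submod_supp. Qed.

Lemma suppS S S' i : S \subset S' -> supp S i `<=` supp S' i.
Proof.
by move=> SS f fS T nT; apply: fS; apply: contra nT => /andP[TS ->]; rewrite (fintype.subset_trans TS SS).
Qed.

Lemma supp_koszul_chain i : supp [set: 'I_d]%SET i = @koszul_chain _ _ _ i.
Proof. by apply/seteqP; split=> f fS T; have := fS T; rewrite finset.subsetT. Qed.

Lemma supp_diff x S i f : supp S i.+1 f -> supp S i (koszul_diff x f).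
Proof.
move=> fS T nT; rewrite koszul_diffE big1 // => l lT.
rewrite fS ?scaler0 //; apply: contra nT; rewrite finset.subUset => /andP[/andP[_ ->]].
by rewrite cardsU1 lT add1n eqSS.
Qed.

Lemma supp_wedge S i j f : supp S i f -> supp (j |: S)%SET i.+1 (wedge j f).
Proof.
move=> fS T nT; rewrite ffunE; case: ifP => // jT.
rewrite fS ?scaler0 //; apply: contra nT => /andP[TS /eqP Ti].
by rewrite -finset.subDset TS (cardsD1 j) jT Ti add1n /=.
Qed.

Lemma supp_wedge_in S i j f : j \in S -> supp S i f -> supp S i.+1 (wedge j f).
Proof.
by move=> jS /(@supp_wedge _ _ j); rewrite (finset.setUidPr _) // finset.sub1set.
Qed.

Lemma supp_contract S i j f : j \notin S ->
  supp (j |: S)%SET i.+1 f -> supp S i (contract j f).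
Proof.
move=> jS fS T nT; rewrite ffunE; case: ifPn => // jT.
rewrite fS ?scaler0 //; apply: contra nT.
rewrite cardsU1 jT add1n eqSS => /andP[/fintype.subsetP TS ->]; rewrite andbT.
apply/fintype.subsetP => l lT; have := TS l; rewrite !inE lT orbT => /(_ isT).
by case/predU1P => // lj; rewrite -lj lT in jT.
Qed.

Lemma contract_supp S i j f : j \notin S -> supp S i f -> contract j f = 0.
Proof.
move=> jS fS; apply/ffunP => T; rewrite !ffunE; case: ifPn => // jT.
rewrite fS ?scaler0 //; apply/negP => /andP[/fintype.subsetP/(_ j)].
by rewrite !inE eqxx (negPf jS) => /(_ isT).
Qed.

Lemma supp_uncontract S i j f : supp (j |: S)%SET i f -> contract j f = 0 -> supp S i f.
Proof.
move=> fS f0 T nT; have [jT|jT] := boolP (j \in T).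
  have := congr1 (fun h : {ffun {set 'I_d} -> M} => h (T :\ j)%SET) f0.
  rewrite !ffunE !inE eqxx /= finset.setD1K // => e.
  by rewrite -[f T](ksignK j (T :\ j)%SET) e scaler0.
apply: fS; apply: contra nT => /andP[/fintype.subsetP TS ->]; rewrite andbT.
apply/fintype.subsetP => l lT; have := TS l lT; rewrite !inE.
by case/predU1P => // lj; rewrite -lj lT in jT.
Qed.

(** Induction on a set containing the support: the part without [e_j] has smaller support, and for
    the part with [e_j] the Leibniz rule used twice makes the terms in [x j] cancel. *)
Lemma diff_diff x f : koszul_diff x (koszul_diff x f) = 0.
Proof.
suff main n S : #|S| = n -> forall f, (forall T, ~~ (T \subset S) -> f T = 0) ->
    koszul_diff x (koszul_diff x f) = 0.
  by apply: (main _ [set: 'I_d]%SET erefl) => T; rewrite finset.subsetT.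
elim: n S => [|n IH] S Sn {}f fS.
  have -> : koszul_diff x f = 0; last exact: linear0.
  apply/ffunP => T; rewrite koszul_diffE ffunE big1 // => j _.
  rewrite fS ?scaler0 //; apply/negP => /fintype.subsetP/(_ j); rewrite !inE eqxx.
  by move/eqP: Sn; rewrite cards_eq0 => /eqP->; rewrite inE => /(_ isT).
have [j jS] : exists j, j \in S by apply/finset.set0Pn; rewrite -cards_eq0 Sn.
have cardS' : #|(S :\ j)%SET| = n by move: Sn; rewrite (cardsD1 j) jS => -[].
have supp_c g : (forall T, ~~ (T \subset S) -> g T = 0) ->
    forall T, ~~ (T \subset S :\ j)%SET -> contract j g T = 0.
  move=> gS T nT; rewrite ffunE; case: ifPn => // jT; rewrite gS ?scaler0 //.
  apply: contra nT; rewrite finset.subUset => /andP[_ TS].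
  by rewrite finset.subsetD1 TS.
have dd0 g : (forall T, ~~ (T \subset S) -> g T = 0) ->
  koszul_diff x (koszul_diff x (contract j g)) = 0.
  by move=> gS; apply: (IH _ cardS'); exact: supp_c.
rewrite -[f](contract_wedge j) !linearD /= dd0; last first.
  move=> T nT; rewrite ffunE; case: ifP => // jT; rewrite fS ?scaler0 //.
  by apply: contra nT => TS; rewrite -(finset.setD1K jT) finset.subUset finset.sub1set jS.
have /eqP := diff_wedge x j (contract j f); rewrite eq_sym -subr_eq => /eqP <-.
rewrite add0r linearB linearZ /=.
have /eqP := diff_wedge x j (koszul_diff x (contract j f)).
by rewrite dd0 // linear0 addr0 => /eqP ->; rewrite subrr.
Qed.

Lemma bnd_cyc x S i : bnd x S i `<=` cyc x S i.
Proof.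
by move=> _ [f fS <-]; split; [exact: supp_diff|exact: diff_diff].
Qed.

Lemma cyc_mul x S i j f : j \in S -> cyc x S i f -> bnd x S i (x j *: f).
Proof.
move=> jS [fS /= f0]; exists (wedge j f); last first.
  by rewrite -diff_wedge f0 linear0 addr0.
exact: supp_wedge_in.
Qed.

Lemma cyc_span x S i k (y : 'I_k -> R) r f :
  (forall e, exists2 j, j \in S & x j = y e) ->
  ideal_gen y r -> cyc x S i f -> bnd x S i (r *: f).
Proof.
move=> yS xr cf; have : [set r : R^o | bnd x S i ((r : R) *: f)] r.
  apply: (span_sub _ _ xr).
    apply/submoduleP; split=> [|a u v /= bu bv] /=.
      by rewrite scale0r; apply: submod0; exact: submod_bnd.
    rewrite scalerDl -scalerA; have sb := submod_bnd x S i.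
    by apply: submodD => //; exact: submodZ.
  by move=> _ [e _ <-] /=; have [j jS <-] := yS e; exact: cyc_mul.
by [].
Qed.

Section AddElement.
Variables (x : 'I_d -> R) (S : {set 'I_d}) (j : 'I_d) (i : nat).
Hypothesis jS : j \notin S.
Let S' := (j |: S)%SET.
Let mid := sadd (bnd x S' i.+1) (cyc x S i.+1).

Let sS' : submodule (bnd x S' i.+1) := submod_bnd _ _ _.
Let scS : submodule (cyc x S i.+1) := submod_cyc _ _ _.
Let smid : submodule mid := submod_add sS' scS.

Let SS' : S \subset S'. Proof. exact: finset.subsetUr. Qed.

Lemma cycS k : cyc x S k `<=` cyc x S' k.
Proof. by move=> f [fS f0]; split=> //; exact: suppS fS. Qed.

(** The left end of the short exact sequence: [mid] modulo the boundaries is the image of H_(i+1)(S)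
    in H_(i+1)(S'), and the kernel of H_(i+1)(S) -> H_(i+1)(S') consists of the multiples of
    [x j]. *)
Let coker_iso (n : nat) :
  length_le (im_plus (bnd x S i.+1) (cyc x S i.+1) (x j)) (cyc x S i.+1) n <->
  length_le (bnd x S' i.+1) mid n.
Proof.
have sb := submod_bnd x S i.+1.
apply: (length_le_iso (@idfun _)) => //.
- apply: sadd_sub => //; first exact: bnd_cyc.
  exact: homoth_sub.
- by apply: saddl; exact: submod0.
- move=> f [fS f0]; split.
    case=> _ [g gS <-] [_ [h [hS h0] <-] <-]; exists (g + wedge j h).
      apply: (submodD (submod_supp _ _)); [exact: suppS gS|exact: supp_wedge].
    rewrite linearD /= /homoth; congr (_ + _).
    by rewrite -diff_wedge h0 linear0 addr0.
  (* Write g = g' + e_j g''. As [f], the differential of [g], has no term in [e_j], g'' is a cycle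
     and f = d g' + x_j g''. *)
  case=> g gS /= gf; exists (koszul_diff x (contract j (wedge j g))).
    exists (contract j (wedge j g)) => //; apply: supp_contract => //.
    by apply: supp_wedge_in => //; rewrite !inE eqxx.
  exists (homoth (x j) (contract j g)); last first.
    rewrite /homoth -diff_wedge [koszul_diff x (contract j g)]diff_contract gf.
    rewrite (contract_supp jS fS) oppr0 linear0 addr0 -linearD /=.
    by rewrite contract_wedge.
  exists (contract j g) => //; split; first exact: supp_contract.
  by rewrite /= diff_contract gf (contract_supp jS fS) oppr0.
- by move=> _ [f cf <-]; apply: saddr cf; exact: submod0.
- by apply: saddS => // f cf; exists f.
Qed.

(** The right end: a cycle f' + e_j f'' satisfies d f'' = 0 and d f' = - x_j f'', so [contract j]
    takes it to a class annihilated by [x j]. *)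
Let ann_iso (n : nat) :
  length_le mid (cyc x S' i.+1) n <->
  length_le (bnd x S i) (ann_in (bnd x S i) (cyc x S i) (x j)) n.
Proof.
have sb := submod_bnd x S i; have sc := submod_cyc x S' i.+1.
have split_f f : koszul_diff x f = 0 ->
    koszul_diff x (contract j (wedge j f)) = - (x j *: contract j f).
  move=> f0; apply/eqP; rewrite -addr_eq0 -diff_wedge.
  rewrite [koszul_diff x (contract j f)]diff_contract f0 !(linear0, oppr0, addr0).
  by rewrite -linearD /= contract_wedge f0.
apply: (length_le_iso (contract j)) => //.
- by apply: submod_ann => //; exact: submod_cyc.
- by apply: sadd_sub => //; [exact: bnd_cyc|exact: cycS].
- move=> f bf; split; last exact: submodZ.
  exact: bnd_cyc.
- move=> f [fS' /= f0]; split.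
    case=> _ [g gS' <-] [h [hS h0] <-]; rewrite linearD /= (contract_supp jS hS) addr0.
    rewrite -[contract _ _]opprK -diff_contract -linearN /=.
    exists (- contract j g) => //; apply: (submodN (submod_supp _ _)).
    exact: supp_contract.
  case=> g gS gf; exists (koszul_diff x (- wedge j g)).
    exists (- wedge j g) => //; apply: (submodN (submod_supp _ _)).
    exact: supp_wedge.
  have e := diff_wedge x j g.
  exists (f + koszul_diff x (wedge j g)); last by rewrite linearN addrC addrK.
  split; last by rewrite /= linearD /= f0 diff_diff addr0.
  apply: (@supp_uncontract _ _ j).
    apply: (submodD (submod_supp _ _)) => //.
    by apply: supp_diff; exact: supp_wedge.
  have w : contract j (wedge j g) = g.
    by rewrite -[RHS](contract_wedge j) (contract_supp jS gS) linear0 addr0.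
  rewrite linearD /= -[contract j (koszul_diff _ _)]opprK -diff_contract w gf.
  by rewrite subrr.
- move=> _ [f [fS' /= f0] <-]; split.
    split; first exact: supp_contract.
    by rewrite /= diff_contract f0 linear0 oppr0.
  rewrite /preimage /=; exists (- contract j (wedge j f)); last first.
    by rewrite linearN /= split_f // opprK.
  apply: (submodN (submod_supp _ _)).
  apply: supp_contract => //.
  by apply: supp_wedge_in => //; rewrite !inE eqxx.
move=> f [[fS /= f0] [g gS /= gf]]; apply: saddr; first exact: submod0.
(* Here [g] has differential [x j *: f], which is also the differential of [wedge j f]; the
   difference is a cycle. *)
exists (wedge j f - g); last first.
  rewrite linearB /= (contract_supp jS gS) subr0.
  by rewrite -[RHS](contract_wedge j) (contract_supp jS fS) linear0 addr0.
split.
  apply: (submodB (submod_supp _ _)); [exact: supp_wedge|exact: suppS gS].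
by rewrite /= linearB /= gf /homoth -diff_wedge f0 linear0 addr0 subrr.
Qed.

Lemma koszul_add_length (a b : nat) :
  length_le (im_plus (bnd x S i.+1) (cyc x S i.+1) (x j)) (cyc x S i.+1) a ->
  length_le (bnd x S i) (ann_in (bnd x S i) (cyc x S i) (x j)) b ->
  length_le (bnd x S' i.+1) (cyc x S' i.+1) (a + b).
Proof.
move=> ha hb.
have {}ha := (coker_iso _).1 ha; have {}hb := (ann_iso _).2 hb.
apply: (length_le_add sS' smid _ _ _ ha hb).
- by apply: saddl; exact: submod0.
- by apply: sadd_sub; [exact: submod_cyc|exact: bnd_cyc|exact: cycS].
- exact: submod_cyc.
Qed.

Lemma koszul_split_length (n : nat) : length_le (bnd x S' i.+1) (cyc x S' i.+1) n ->
  exists a b, [/\ (a + b <= n)%N,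
    length_le (im_plus (bnd x S i.+1) (cyc x S i.+1) (x j)) (cyc x S i.+1) a
  & length_le (bnd x S i) (ann_in (bnd x S i) (cyc x S i) (x j)) b].
Proof.
move=> h; have [||a [b [ab ha hb]]] := length_le_split _ _ smid h.
- by apply: saddl; exact: submod0.
- by apply: sadd_sub; [exact: submod_cyc|exact: bnd_cyc|exact: cycS].
by exists a, b; split; [|exact: (coker_iso _).2|exact: (ann_iso _).1].
Qed.

End AddElement.

End KoszulSubcomplex.

Lemma finset_ind (T : finType) (P : {set T} -> Prop) :
  P finset.set0 -> (forall (j : T) (S : {set T}), j \notin S -> P S -> P (j |: S)%SET) ->
  forall S, P S.
Proof.
move=> P0 PU S; elim: {S}_.+1 {-2}S (ltnSn #|S|) => // n IH S.
have [->//|[j jS]] := set_0Vmem S.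
rewrite (cardsD1 j) jS ltnS => lt; rewrite -(finset.setD1K jS).
by apply: PU; [rewrite !inE eqxx|exact: IH].
Qed.

Section KoszulLength.
Variables (R : comNzRingType) (M : lmodType R) (d : nat).
Implicit Types (x : 'I_d -> R) (f g : {ffun {set 'I_d} -> M}).
Implicit Types (S T : {set 'I_d}) (j : 'I_d) (i : nat).

Definition homology_le x S i n := length_le (@bnd R M d x S i) (@cyc R M _ x S i) n.

Lemma koszul_diff_ext x x' S i f : {in S, x =1 x'} -> supp S i f ->
  koszul_diff x f = koszul_diff x' f.
Proof.
move=> xx' fS; apply/ffunP => T; rewrite !koszul_diffE; apply: eq_bigr => j _.
have [jS|jS] := boolP (j \in S); first by rewrite xx'.
rewrite fS ?scaler0 //; apply/negP => /andP[/fintype.subsetP/(_ j)].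
by rewrite !inE eqxx (negPf jS) => /(_ isT).
Qed.

Lemma cyc_ext x x' S i : {in S, x =1 x'} -> @cyc R M _ x S i = @cyc R M _ x' S i.
Proof.
move=> xx'; apply/seteqP; split=> f [fS f0]; split=> //.
  by rewrite /= -(koszul_diff_ext xx' fS).
by rewrite /= (koszul_diff_ext xx' fS).
Qed.

Lemma bnd_ext x x' S i : {in S, x =1 x'} -> @bnd R M d x S i = bnd x' S i.
Proof.
move=> xx'; apply/seteqP; split=> _ [f fS <-]; exists f => //.
  by rewrite (koszul_diff_ext xx' fS).
by rewrite (koszul_diff_ext xx' fS).
Qed.

(** The homology on the other elements is unchanged; its cokernel and its annihilator for [x j ^+ t]
    are at most [t] times as long as those for [x j]. *)
Lemma homology_exp1 x x' i n j t : (forall l, l != j -> x' l = x l) ->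
  x' j = x j ^+ t ->
  homology_le x [set: 'I_d]%SET i.+1 n -> homology_le x' [set: 'I_d]%SET i.+1 (t * n).
Proof.
move=> xx' xj; pose S := [set~ j]%SET.
have jS : j \notin S by rewrite !inE eqxx.
have ST : [set: 'I_d]%SET = (j |: S)%SET by apply/setP => l; rewrite !inE orbN.
have xS : {in S, x =1 x'} by move=> l; rewrite !inE => /xx'.
rewrite /homology_le ST => /(koszul_split_length jS)[a [b [ab ha hb]]].
apply: (@length_leW _ _ _ _ (t * a + t * b)); first by rewrite -mulnDr leq_mul2l ab orbT.
have sb k := @submod_bnd R M d x S k; have sc k := @submod_cyc R M _ x S k.
have bc k := @bnd_cyc R M d x S k.
apply: koszul_add_length => //; rewrite -(bnd_ext _ xS) -(cyc_ext _ xS) xj.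
  exact: length_im_exp.
exact: length_ann_exp.
Qed.

Lemma homology_exp x (c : 'I_d -> nat) i n :
  homology_le x [set: 'I_d]%SET i.+1 n ->
  homology_le (fun l => x l ^+ c l) [set: 'I_d]%SET i.+1 (\prod_l c l * n).
Proof.
move=> h; pose xc S l := if l \in S then x l ^+ c l else x l.
suff main S : homology_le (xc S) [set: 'I_d]%SET i.+1 (\prod_(l in S) c l * n).
  have := main [set: 'I_d]%SET; rewrite (eq_bigl predT) => [|l]; last by rewrite inE.
  by congr homology_le; apply/funext => l; rewrite /xc inE.
elim/finset_ind: S => [|j S jS IH].
  rewrite big_set0 mul1n; have -> : xc finset.set0 = x by apply/funext => l; rewrite /xc inE.
  by [].
rewrite big_setU1 //= -mulnA; apply: (@homology_exp1 _ _ _ _ j (c j) _ _ IH) => [l lj|].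
  by rewrite /xc !inE (negPf lj).
by rewrite /xc !inE eqxx (negPf jS).
Qed.

Lemma homology_big x S i n : (#|S| < i)%N -> homology_le x S i n.
Proof.
move=> Si; apply: length_le_same => f [fS _].
have -> : f = 0; last exact: (submod0 (submod_bnd _ _ _ _)).
apply/ffunP => T; rewrite fS ?ffunE //; apply/negP => /andP[/subset_leq_card TS /eqP Ti].
by move: Si; rewrite -Ti ltnNge TS.
Qed.

Lemma homology_up x S E n : (S :&: E)%SET = finset.set0 ->
  (forall i, (0 < i)%N -> homology_le x S i n) ->
  forall i, (#|E| < i)%N -> homology_le x (S :|: E)%SET i (2 ^ #|E| * n).
Proof.
move=> + h; elim/finset_ind: E => [|j E jE IH] SE.
  by move=> i; rewrite cards0 finset.setU0 mul1n; exact: h.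
have SE0 : (S :&: E)%SET = finset.set0.
  apply/eqP; rewrite -finset.subset0 -SE; apply: finset.setIS; exact: finset.subsetUr.
case=> // i; rewrite cardsU1 jE add1n ltnS => Ei.
rewrite finset.setUCA expnS mul2n -addnn mulnDl.
have jSE : j \notin (S :|: E)%SET.
  rewrite !inE (negPf jE) orbF; apply/negP => jS.
  by have := congr1 (fun A : {set 'I_d} => j \in A) SE; rewrite !inE eqxx jS.
apply: koszul_add_length => //.
  apply: length_leS (IH SE0 i.+1 (leqW Ei)) => //.
  by apply: saddl; exact: (submod0 (submod_homoth _ (submod_cyc _ _ _ _))).
by apply: length_leS (IH SE0 i Ei) => // f [].
Qed.

(** H_(i+1) after adding [j] has the annihilator of [x j] in H_i as a quotient, and a module killed
    by [x j ^+ s] is at most [s] times as long as this annihilator. *)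
Lemma homology_down x S E i n s : (S :&: E)%SET = finset.set0 ->
  (forall j, j \in E -> forall S', S \subset S' -> forall k f,
     @cyc R M _ x S' k f -> bnd x S' k (x j ^+ s *: f)) ->
  homology_le x (S :|: E)%SET (#|E| + i) n -> homology_le x S i (s ^ #|E| * n).
Proof.
elim/finset_ind: E n => [|j E jE IH] n SE nil.
  by rewrite cards0 finset.setU0 mul1n.
have SE0 : (S :&: E)%SET = finset.set0.
  apply/eqP; rewrite -finset.subset0 -SE; apply: finset.setIS; exact: finset.subsetUr.
have jSE : j \notin (S :|: E)%SET.
  rewrite !inE (negPf jE) orbF; apply/negP => jS.
  by have := congr1 (fun A : {set 'I_d} => j \in A) SE; rewrite !inE eqxx jS.
rewrite finset.setUCA cardsU1 jE add1n addSn.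
case/(koszul_split_length jSE) => a [b [ab _ hb]].
rewrite expnSr -mulnA; apply: IH => // [k kE|]; first by apply: nil; rewrite !inE kE orbT.
apply: (@length_leW _ _ _ _ (s * b)); first by rewrite leq_mul2l (leq_trans _ ab) ?leq_addl ?orbT.
apply: length_nilp hb; [exact: submod_bnd|exact: submod_cyc|exact: bnd_cyc|].
by move=> f; apply: nil; rewrite ?inE ?eqxx //; exact: finset.subsetUl.
Qed.

Definition gen_mul x S : set M := [set v | exists w : 'I_d -> M,
  v = \sum_(l in S) x l *: w l].

Lemma submod_gen_mul x S : submodule (gen_mul x S).
Proof.
apply/submoduleP; split=> [|a _ _ [u ->] [v ->]].
  by exists (fun=> 0); rewrite big1 // => l _; rewrite scaler0.
exists (fun l => a *: u l + v l); rewrite scaler_sumr -big_split; apply: eq_bigr => l _.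
by rewrite scalerDr !scalerA mulrC.
Qed.

Lemma gen_mul_mem x S l v : l \in S -> gen_mul x S (x l *: v).
Proof.
move=> lS; exists (fun k => if k == l then v else 0).
rewrite (bigD1 l) //= eqxx big1 ?addr0 // => k /andP[_ /negPf ->].
by rewrite scaler0.
Qed.

Lemma gen_mul_sub x S (N : set M) : submodule N ->
  (forall l v, l \in S -> N (x l *: v)) -> gen_mul x S `<=` N.
Proof. by move=> sN h _ [w ->]; apply: submod_sum => // l lS; exact: h. Qed.

Definition const_chain (v : M) : {ffun {set 'I_d} -> M} :=
  [ffun T : {set 'I_d} => if T == finset.set0 then v else 0].

Lemma const_chain_linear : linear const_chain.
Proof.
move=> a u v; apply/ffunP => T; rewrite !ffunE.
by case: ifP; rewrite ?scaler0 ?addr0.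
Qed.
HB.instance Definition _ := GRing.isLinear.Build R _ _ _ const_chain const_chain_linear.

Lemma supp_const S v : supp S 0 (const_chain v).
Proof.
move=> T nT; rewrite ffunE; case: eqP => // T0; move: nT.
by rewrite T0 finset.sub0set cards0.
Qed.

Lemma diff_const x v : koszul_diff x (const_chain v) = 0.
Proof.
apply/ffunP => T; rewrite koszul_diffE ffunE big1 // => j _.
rewrite ffunE; case: eqP => [/setP/(_ j)|]; rewrite ?scaler0 //.
by rewrite !inE eqxx.
Qed.

Lemma bnd_const x S v : bnd x S 0 (const_chain v) <-> gen_mul x S v.
Proof.
split=> [[f fS fv]|[w ->]]; last first.
  rewrite linear_sum; apply: submod_sum; first exact: submod_bnd.
  move=> l lS; rewrite linearZ /=; apply: cyc_mul => //.
  by split; [exact: supp_const|exact: diff_const].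
have := congr1 (fun h : {ffun {set 'I_d} -> M} => h finset.set0) fv.
rewrite koszul_diffE ffunE eqxx => <-.
apply: submod_sum; first exact: submod_gen_mul.
move=> l _; apply: submodZ; first exact: submod_gen_mul.
have [lS|lS] := boolP (l \in S); first exact: gen_mul_mem.
rewrite fS ?scaler0; first exact: (submod0 (submod_gen_mul _ _)).
by rewrite finset.setU0 finset.sub1set (negPf lS).
Qed.

(** [M / Z] is the H_0 of the other elements, through [const_chain], and the annihilator of [x j] in
    it is a quotient of H_1(x; M). *)
Lemma length_gen_ann x j n : homology_le x [set: 'I_d]%SET 1 n ->
  let Z := gen_mul x [set~ j]%SET in length_le Z (homoth (x j) @^-1` Z) n.
Proof.
pose S := [set~ j]%SET.
have jS : j \notin S by rewrite !inE eqxx.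
have ST : [set: 'I_d]%SET = (j |: S)%SET by apply/setP => l; rewrite !inE orbN.
rewrite /homology_le ST => /(koszul_split_length jS)[a [b [ab _ hb]]] /=.
apply: (@length_leW _ _ _ _ b); first by rewrite (leq_trans _ ab) ?leq_addl.
have sb := @submod_bnd R M d x S 0; have sc := @submod_cyc R M _ x S 0.
apply: (length_le_inj const_chain _ sb (submod_ann (x j) sb sc) _ _ _ hb).
- by apply: submod_preim; exact: submod_gen_mul.
- by move=> f bf; split; [exact: bnd_cyc|exact: submodZ].
- move=> _ [v Zv <-]; split; first by split; [exact: supp_const|exact: diff_const].
  by rewrite /preimage /= /homoth -linearZ /=; apply/bnd_const.
- by move=> v _ /bnd_const.
Qed.

End KoszulLength.

Section KoszulReindex.
Variables (R : comNzRingType) (M : lmodType R) (d D : nat) (h : 'I_d -> 'I_D).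
Hypothesis hmono : forall i j, (h i < h j)%N = (i < j)%N.
Variable x : 'I_D -> R.
Let S := (h @: [set: 'I_d])%SET.

Let hinj : injective h.
Proof.
move=> i j e; apply: val_inj; apply/eqP.
by have := hmono i j; have := hmono j i; rewrite e ltnn; case: ltngtP.
Qed.

Definition restrict (f : {ffun {set 'I_D} -> M}) : {ffun {set 'I_d} -> M} :=
  [ffun T : {set 'I_d} => f (h @: T)%SET].

Lemma restrict_linear : linear restrict.
Proof. by move=> a f g; apply/ffunP => T; rewrite !ffunE. Qed.
HB.instance Definition _ := GRing.isLinear.Build R _ _ _ restrict restrict_linear.

Definition extend (f : {ffun {set 'I_d} -> M}) : {ffun {set 'I_D} -> M} :=
  [ffun T : {set 'I_D} => if T \subset S then f (h @^-1: T)%SET else 0].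

Let preimK (T : {set 'I_d}) : (h @^-1: (h @: T))%SET = T.
Proof. by apply/setP => i; rewrite inE mem_imset. Qed.

Let imK (T : {set 'I_D}) : T \subset S -> (h @: (h @^-1: T))%SET = T.
Proof.
move=> TS; apply/setP => l; apply/imsetP/idP => [[i]|lT]; first by rewrite inE => ? ->.
have /imsetP[i _ li] := fintype.subsetP TS l lT.
by exists i => //; rewrite inE -li.
Qed.

Let imS (T : {set 'I_d}) : (h @: T)%SET \subset S.
Proof. by apply: imsetS; exact: finset.subsetT. Qed.

Lemma extendK : cancel extend restrict.
Proof. by move=> f; apply/ffunP => T; rewrite !ffunE imS preimK. Qed.

Lemma restrictK i f : supp S i f -> extend (restrict f) = f.
Proof.
move=> fS; apply/ffunP => T; rewrite !ffunE; case: ifPn => [/imK->//|TS].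
by rewrite fS // negb_and TS.
Qed.

Lemma supp_restrict i f : supp S i f -> supp [set: 'I_d]%SET i (restrict f).
Proof.
move=> fS T; rewrite finset.subsetT ffunE => Ti; apply: fS.
by rewrite card_imset // imS.
Qed.

Lemma supp_extend i f : supp [set: 'I_d]%SET i f -> supp S i (extend f).
Proof.
move=> fS T; rewrite ffunE; case: ifP => //= TS Ti; apply: fS.
by rewrite finset.subsetT -(card_imset _ hinj) imK.
Qed.

(** The signs agree because [h] preserves the order of the indices. *)
Lemma diff_restrict i f : supp S i f ->
  koszul_diff (x \o h) (restrict f) = restrict (koszul_diff x f).
Proof.
move=> fS; apply/ffunP => T; rewrite koszul_diffE [RHS]ffunE koszul_diffE.
rewrite big_mkcond [RHS]big_mkcond /=.
rewrite [RHS](bigID (mem S)) /= [X in _ + X]big1 ?addr0; last first.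
  move=> l lS; case: ifP => // _; rewrite fS ?scaler0 //; apply/negP => /andP[].
  by rewrite finset.subUset finset.sub1set (negPf lS).
rewrite big_imset /=; last by move=> i1 i2 _ _; exact: hinj.
apply: eq_big => [j|j _]; first by rewrite inE.
rewrite mem_imset //; case: ifP => // _; rewrite ffunE imsetU1.
congr (_ ^+ _ *: _); rewrite -(card_imset _ hinj); apply: eq_card => l.
rewrite !inE; apply/imsetP/andP => [[k]|[/imsetP[k kT ->]]].
  by rewrite inE => /andP[kT kj] ->; rewrite mem_imset // hmono.
by rewrite hmono => kj; exists k; rewrite // inE kT.
Qed.

Lemma diff_extend i f : supp [set: 'I_d]%SET i.+1 f ->
  koszul_diff x (extend f) = extend (koszul_diff (x \o h) f).
Proof.
move=> /supp_extend fS; rewrite -(restrictK (supp_diff x fS)).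
by rewrite -(diff_restrict fS) extendK.
Qed.

Lemma homology_reindex i n :
  @homology_le R M _ x S i n <-> @homology_le R M _ (x \o h) [set: 'I_d]%SET i n.
Proof.
have cycR f : @cyc R M _ x S i f -> @cyc R M _ (x \o h) [set: 'I_d]%SET i (restrict f).
  move=> [fS /= f0]; split; first exact: supp_restrict.
  by rewrite /= (diff_restrict fS) f0 linear0.
apply: (length_le_iso restrict); [exact: submod_cyc|exact: submod_bnd|exact: submod_cyc|exact: bnd_cyc|exact: bnd_cyc|..].
- move=> f [fS f0]; split=> [[g gS <-]|[g gS e]].
    by exists (restrict g); [exact: supp_restrict|exact: diff_restrict gS].
  exists (extend g); first exact: supp_extend.
  by rewrite (diff_extend gS) e (restrictK fS).
- by move=> _ [f cf <-]; exact: cycR.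
- move=> f [fS /= f0]; apply: saddr; first exact: (submod0 (submod_bnd _ _ _ _)).
  exists (extend f); last by rewrite extendK.
  split; first exact: supp_extend.
  case: i fS => [|i] fS in cycR *; last by rewrite /= (diff_extend fS) f0; apply/ffunP => T; rewrite !ffunE if_same.
  apply/ffunP => T; rewrite koszul_diffE ffunE big1 // => j _.
  rewrite (supp_extend fS) ?scaler0 //; apply/negP => /andP[_].
  by rewrite cards_eq0 => /eqP/setP/(_ j); rewrite !inE eqxx.
Qed.

End KoszulReindex.

(** * Change of the system of parameters *)

Section SopExchange.
Variables (R : comNzRingType) (M : lmodType R) (d s : nat) (w x : 'I_d -> R).
Hypothesis ws : forall i, ideal_gen x (w i ^+ s).

Let z (l : 'I_(d + d)) : R := match split l with inl i => w i | inr i => x i end.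
Let W := (@lshift d d @: [set: 'I_d])%SET.
Let X := (@rshift d d @: [set: 'I_d])%SET.

Let zl : z \o @lshift d d = w.
Proof. by apply/funext => i; rewrite /z /= -[lshift _ _]/(unsplit (inl i)) unsplitK. Qed.

Let zr : z \o @rshift d d = x.
Proof. by apply/funext => i; rewrite /z /= -[rshift _ _]/(unsplit (inr i)) unsplitK. Qed.

Let cardW : #|W| = d.
Proof. by rewrite card_imset ?cardsT ?card_ord //; exact: lshift_inj. Qed.

Let cardX : #|X| = d.
Proof. by rewrite card_imset ?cardsT ?card_ord //; exact: rshift_inj. Qed.

Let WX : (W :&: X)%SET = finset.set0.
Proof.
apply/setP => l; rewrite !inE; apply/andP => -[/imsetP[i _ ->] /imsetP[j _ e]].
by move: e => /eqP; rewrite eq_lrshift.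
Qed.

(** Adding the [x i] one by one to the [w i] shifts by at most [d] the degrees
    where the homology may be long. On the other hand the [w i] are nilpotent on
    the homology of the [x i], so the annihilators in this homology of the
    [w i] added one by one are large. *)
Lemma homology_exchange n : (forall i, (0 < i)%N -> homology_le M w [set: 'I_d]%SET i n) ->
  forall i, (0 < i)%N -> homology_le M x [set: 'I_d]%SET i (s ^ d * (2 ^ d * n)).
Proof.
move=> hw i i0; rewrite -zr; apply/homology_reindex => [k l /=|]; first by rewrite ltn_add2l.
rewrite -/X -[in (s ^ _)%N]cardW; apply: homology_down => [|l lW S' XS' k f|].
- by rewrite finset.setIC.
- apply: (@cyc_span _ _ _ _ _ _ _ x) => [e|].
    exists (rshift d e); last by rewrite -[RHS](congr1 (fun h => h e) zr).
    by apply: (fintype.subsetP XS'); exact: imset_f.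
  by have /imsetP[e _ ->] := lW; rewrite (congr1 (fun h => h e) zl : z (lshift d e) = _).
rewrite finset.setUC cardW -[in (2 ^ _)%N]cardX; apply: homology_up => //; last first.
  by rewrite cardX -[ltnLHS]addn0 ltn_add2l.
move=> k k0; apply/homology_reindex => //; rewrite zl.
exact: hw.
Qed.

End SopExchange.

(** * The kernel of multiplication by a monomial in the parameters *)

Section Kernels.
Variables (R : comNzRingType) (M : lmodType R) (d : nat).
Variables (x : 'I_d -> R) (a b : 'I_d -> nat) (n : nat).
Hypothesis hx : forall c : 'I_d -> nat, (forall l, c l <= a l + b l)%N ->
  homology_le M (fun l => x l ^+ c l) [set: 'I_d]%SET 1 n.

Let e (S : {set 'I_d}) l := if l \in S then (a l + b l)%N else a l.
Let I (S : {set 'I_d}) := @gen_mul R M d (fun l => x l ^+ e S l) [set: 'I_d]%SET.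
Let y (S : {set 'I_d}) := \prod_(l in S) x l ^+ b l.

Let sI S : submodule (I S). Proof. exact: submod_gen_mul. Qed.

Let gen_mul_setC1 (c : 'I_d -> nat) j v : @gen_mul R M d (fun l => x l ^+ c l) [set: 'I_d]%SET v ->
  exists u, @gen_mul R M d (fun l => x l ^+ c l) [set~ j]%SET (v - x j ^+ c j *: u).
Proof.
move=> [u ->]; exists (u j); exists u; rewrite (bigD1 j) ?inE //= addrC addrK.
by apply: eq_bigl => l; rewrite !inE.
Qed.

(** Multiplication by [y S] embeds this quotient into [(I (j |: S) : x_j^(b_j)) / I S]. Up to
    multiples of [x_j^(a_j)], which lie in [I S], the numerator comes from [(Z : x_j^(b_j))]; so the
    annihilator of [x_j^(b_j)] in [M / Z] bounds the length. Hence the Koszul complex with exponent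
    [b j] at [j]. *)
Let colon_step (S : {set 'I_d}) j : j \notin S ->
  length_le (homoth (y S) @^-1` I S) (homoth (y (j |: S)%SET) @^-1` I (j |: S)%SET) n.
Proof.
move=> jS; pose c l := if l == j then b j else e S l.
pose Z := @gen_mul R M d (fun l => x l ^+ c l) [set~ j]%SET.
have sZ : submodule Z by exact: submod_gen_mul.
have : length_le Z (homoth (x j ^+ b j) @^-1` Z) n.
  have := @length_gen_ann _ _ _ (fun l => x l ^+ c l) j n; rewrite /c eqxx; apply.
  apply: hx => l; rewrite /e; case: eqP => [->|_]; first exact: leq_addl.
  by case: ifP => _; rewrite ?leq_addr.
have ZI : Z `<=` I S.
  apply: gen_mul_sub => // l v; rewrite !inE /c => /negPf ->.
  by apply: gen_mul_mem; rewrite inE.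
have eZ c' : (forall l, l != j -> c' l = e S l) ->
    @gen_mul R M d (fun l => x l ^+ c' l) [set~ j]%SET = Z.
  move=> cc'; apply/seteqP; split=> _ [u ->]; exists u; apply: eq_bigr => l;
    by rewrite !inE => lj; rewrite /c (negPf lj) cc'.
pose IU := I (j |: S)%SET.
have sW : submodule (homoth (x j ^+ b j) @^-1` IU) by apply: submod_preim; exact: sI.
move=> h; have {}h : length_le (I S) (homoth (x j ^+ b j) @^-1` IU) n.
  apply: (length_le_surj idfun _ _ _ _ h) => [||v /ZI//|v].
  - by apply: submod_preim; exact: submod_gen_mul.
  - by move=> v; exact: submodZ.
  move=> /(gen_mul_setC1 j)[u]; rewrite eZ => [|l lj]; last by rewrite /e !inE (negPf lj).
  rewrite /e !inE eqxx /= => hv; exists (x j ^+ a j *: u).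
    have -> : a j = e S j by rewrite /e (negPf jS).
    by apply: gen_mul_mem; rewrite inE.
  exists (v - x j ^+ a j *: u); last by rewrite addrC subrK.
  exists (v - x j ^+ a j *: u) => //; move: hv.
  by rewrite /preimage /= /homoth scalerBr scalerA addnC exprD.
have yU : y (j |: S)%SET = x j ^+ b j * y S by rewrite /y big_setU1.
apply: (length_le_inj (homoth (y S)) _ (sI S) sW _ _ _ h).
- by apply: submod_preim; exact: submod_gen_mul.
- apply: gen_mul_sub => // l v _; rewrite /preimage /= /homoth /e.
  have : IU (x l ^+ e (j |: S)%SET l *: (if l == j then v else x j ^+ b j *: v)).
    by apply: gen_mul_mem; rewrite inE.
  congr IU; rewrite !scalerA /e !inE; case: eqP => [->|_] /=.
    by rewrite (negPf jS) addnC exprD.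
  by case: ifP => _; rewrite scalerA mulrC.
- by move=> _ [v Bv <-]; move: Bv; rewrite /preimage /= /homoth scalerA -yU.
- by [].
Qed.

Let colon_sub (S : {set 'I_d}) j : j \notin S ->
  homoth (y S) @^-1` I S `<=` homoth (y (j |: S)%SET) @^-1` I (j |: S)%SET.
Proof.
move=> jS v; rewrite /preimage /= /homoth /y big_setU1 //= -/(y S) -scalerA.
have sJ : submodule (homoth (x j ^+ b j) @^-1` I (j |: S)%SET) by apply: submod_preim; exact: sI.
suff : I S `<=` homoth (x j ^+ b j) @^-1` I (j |: S)%SET by apply.
apply: gen_mul_sub => // l u _; rewrite /preimage /= /homoth.
have : I (j |: S)%SET (x l ^+ e (j |: S)%SET l *: (if l == j then u else x j ^+ b j *: u)).
  by apply: gen_mul_mem; rewrite inE.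
congr (I _); rewrite !scalerA /e !inE; case: eqP => [->|_] /=.
  by rewrite (negPf jS) addnC exprD.
by case: ifP => _; rewrite scalerA mulrC.
Qed.

(** The kernel of the multiplication by [\prod_l x l ^+ b l] from
    [M / (x^a) M] to [M / (x^(a + b)) M]. *)
Lemma length_colon :
  length_le (@gen_mul R M d (fun l => x l ^+ a l) [set: 'I_d]%SET)
    (homoth (\prod_l x l ^+ b l) @^-1`
       @gen_mul R M d (fun l => x l ^+ (a l + b l)) [set: 'I_d]%SET) (d * n).
Proof.
suff main S : I finset.set0 `<=` homoth (y S) @^-1` I S /\
  length_le (I finset.set0) (homoth (y S) @^-1` I S) (#|S| * n).
  have [_] := main [set: 'I_d]%SET; rewrite cardsT card_ord /I.
  have -> : y [set: 'I_d]%SET = \prod_l x l ^+ b l by apply: eq_bigl => l; rewrite inE.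
  have -> : e [set: 'I_d]%SET = (fun l => a l + b l)%N by apply/funext => l; rewrite /e inE.
  by have -> : e finset.set0 = a by apply/funext => l; rewrite /e inE.
elim/finset_ind: S => [|j S jS [sub IH]].
  have y0 v : homoth (y finset.set0) v = v by rewrite /homoth /y big_set0 scale1r.
  by split; [|apply: length_le_same] => v; rewrite /preimage /= y0.
have sp S' : submodule (homoth (y S') @^-1` I S') by apply: submod_preim; exact: sI.
split; first by apply: subset_trans sub _; exact: colon_sub.
rewrite cardsU1 jS add1n mulSn addnC.
exact: (length_le_add (sI _) (sp S) sub (colon_sub jS) (sp _) IH (colon_step jS)).
Qed.

End Kernels.

(** * Closures *)

Section Negligible.
Implicit Types (alpha beta : nat -> rat) (P Q : nat -> nat -> Prop).

(** [P n l] says that a length attached to [n] is [l], or is at most [l]; with the second reading,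
    estimates combine without exact lengths. *)
Definition negligible alpha P := exists2 l : nat -> nat,
  exists N, forall n, (N <= n)%N -> P n (l n) &
  forall e : rat, 0 < e -> exists N, forall n, (N <= n)%N -> (l n)%:R <= e * `|alpha n|.

Lemma length_littleoP (R : nzRingType) (V : nat -> lmodType R) alpha :
  length_littleo V alpha <-> negligible alpha (fun n => has_length (V n)).
Proof.
split=> -[l hl ho]; exists l.
- by case: hl => N _ hN; exists N => n Nn; exact: hN.
- move=> e e0; have /eqoP/(_ e e0)[N _ hN] := ho; exists N => n Nn.
  by have := hN n Nn; rewrite /= ger0_norm.
- by case: hl => N hN; exists N => // n Nn; exact: hN.
- apply/eqoP => e e0; have [N hN] := ho e e0; exists N => // n Nn /=.
  by rewrite ger0_norm //; exact: hN.
Qed.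

Lemma negligible_add alpha P Q (T : nat -> nat -> Prop) :
  (forall n a b, P n a -> Q n b -> T n (a + b)%N) ->
  negligible alpha P -> negligible alpha Q -> negligible alpha T.
Proof.
move=> h [a [N1 h1] ha] [b [N2 h2] hb]; exists (fun n => a n + b n)%N.
  by exists (maxn N1 N2) => n; rewrite geq_max => /andP[/h1 ? /h2 ?]; exact: h.
move=> e e0; have e2 : 0 < e / 2 by rewrite divr_gt0.
have [N3 h3] := ha _ e2; have [N4 h4] := hb _ e2.
exists (maxn N3 N4) => n; rewrite geq_max => /andP[/h3 l1 /h4 l2].
by rewrite natrD (splitr e) mulrDl lerD.
Qed.

Lemma negligible_bound alpha P Q C :
  (forall n l, P n l -> Q n (C * l)%N) -> negligible alpha P -> negligible alpha Q.
Proof.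
move=> h [a [N1 h1] ha]; exists (fun n => C * a n)%N; first by exists N1 => n /h1/h.
(* Dividing by [C.+1] also covers [C = 0]. *)
move=> e e0; have C0 : 0 < C.+1%:R :> rat by rewrite ltr0n.
have [N hN] := ha (e / C.+1%:R) (divr_gt0 e0 C0).
exists N => n /hN ln; rewrite natrM.
have le1 : C%:R <= C.+1%:R :> rat by rewrite ler_nat.
apply: le_trans (ler_wpM2r (ler0n _ _) le1) _.
by apply: le_trans (ler_wpM2l (ltW C0) ln) _; rewrite mulrA mulrCA divff ?mulr1 // gt_eqF.
Qed.

Lemma negligible_imp alpha P Q :
  (forall n l, P n l -> Q n l) -> negligible alpha P -> negligible alpha Q.
Proof. by move=> h; apply: (@negligible_bound _ _ _ 1%N) => n l /h; rewrite mul1n. Qed.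

(** One [l] has to serve every [q < k]; the sum of finitely many bounds does, and is still
    [o(alpha)]. *)
Lemma negligible_all alpha k (P : nat -> nat -> nat -> Prop) :
  (forall q n l l', (l <= l')%N -> P q n l -> P q n l') ->
  (forall q, (q < k)%N -> negligible alpha (P q)) ->
  negligible alpha (fun n l => forall q, (q < k)%N -> P q n l).
Proof.
move=> Pup; elim: k => [|k IH] h.
  exists (fun=> 0%N); first by exists 0%N.
  by move=> e e0; exists 0%N => n _; rewrite mulr_ge0 // ltW.
apply: negligible_add (IH _) (h k _) => // [n a b ha hb q|q qk]; last by apply: h; rewrite ltnW.
rewrite ltnS leq_eqVlt => /predU1P[->|/ha]; first by apply: Pup hb; exact: leq_addl.
by apply: Pup; exact: leq_addr.
Qed.

Lemma negligible_dom alpha beta (C : rat) P :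
  (exists N, forall n, (N <= n)%N -> `|alpha n| <= C * `|beta n|) ->
  negligible alpha P -> negligible beta P.
Proof.
move=> [N0 h0] [l hl ho]; exists l => // e e0.
have C0 : 0 < `|C| + 1 by rewrite ltr_wpDl.
have [N hN] := ho (e / (`|C| + 1)) (divr_gt0 e0 C0).
exists (maxn N0 N) => n; rewrite geq_max => /andP[/h0 ab /hN ln].
apply: le_trans ln _; rewrite -mulrA; apply: ler_wpM2l; first exact: ltW.
rewrite mulrC ler_pdivrMr // mulrC; apply: le_trans ab _.
by apply: ler_wpM2r => //; apply: le_trans (ler_norm C) _; rewrite lerDl.
Qed.

End Negligible.

Section HasLength.
Variable R : nzRingType.

Lemma has_length_le (V : lmodType R) l :
  has_length V l -> length_le [set 0 : V] [set: V] l.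
Proof.
move=> [_ h]; apply: length_leP => N k sN NS; apply: h; exists N.
by split=> // i /sN[].
Qed.

Lemma le_has_length (V : lmodType R) l : length_le [set 0 : V] [set: V] l ->
  exists2 l', (l' <= l)%N & has_length V l'.
Proof.
move=> h; pose chn k := exists N : nat -> set V,
  (forall i, (i <= k)%N -> submodule (N i)) /\ (forall i, (i < k)%N -> N i `<` N i.+1).
have chl k : `[< chn k >] -> (k <= l)%N.
  move=> /asboolP[N [sN NS]]; apply: (length_le_strict h (N := N)) => // i /sN sNi.
  by split=> // _ ->; exact: submod0.
have ex : exists k, `[< chn k >].
  by exists 0%N; apply/asboolP; exists (fun=> setT); split=> // i _; exact: submodT.
case: (ex_maxnP ex chl) => l' /asboolP hl' lmax.
exists l'; first by apply: chl; exact/asboolP.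
by split=> // k hk; apply: lmax; exact/asboolP.
Qed.

Lemma has_length_len (V : lmodType R) l :
  has_length V l -> len [set 0 : V] [set: V] = l.
Proof.
move=> hV; have hl := has_length_le hV; case: hV => [[N [sN NS]] _].
apply/eqP; rewrite eqn_leq (len_le hl).
apply: (length_le_strict (lenP (ex_intro _ l hl)) (N := N)) => // i /sN sNi.
by split=> // _ ->; exact: submod0.
Qed.

Lemma length_sub_module (V : lmodType R) (A Z : set V) l :
  submodule A -> submodule Z -> A `<=` Z ->
  length_le [set z : sub_module Z | A (val z)] [set: sub_module Z] l <->
  length_le A Z l.
Proof.
move=> sA sZ AZ; apply: (length_le_iso val) => //.
- exact: submodT.
- by move=> _ [z _ <-]; exact: span_id (valP z).
- move=> v Zv; apply: saddr; first exact: submod0.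
  by exists (Sub v (mem_span Zv)); rewrite ?SubK.
Qed.

Lemma submod_0 (V : lmodType R) : submodule [set 0 : V].
Proof. by apply/submoduleP; split=> // a _ _ -> ->; rewrite /= scaler0 addr0. Qed.

Lemma has_length_sub (V : lmodType R) (Z : set V) l : submodule Z ->
  length_le [set 0 : sub_module Z] [set: sub_module Z] l <-> length_le [set 0] Z l.
Proof.
move=> sZ; have Z0 : [set 0] `<=` Z by move=> _ ->; exact: submod0.
rewrite -(length_sub_module l (@submod_0 _) sZ Z0).
have -> // : [set z : sub_module Z | [set 0] (val z)] = [set 0].
by apply/seteqP; split=> z /= => [z0|->]; [apply: val_inj; rewrite [LHS]z0|]; rewrite ?raddf0.
Qed.

Lemma has_length_subquot (V : lmodType R) (A Z : set V) l :
  submodule A -> submodule Z -> A `<=` Z ->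
  has_length (subquot Z A) l -> length_le A Z l.
Proof.
move=> sA sZ AZ /has_length_le h; apply/(length_sub_module l sA sZ AZ).
pose A' := [set z : sub_module Z | A (val z)].
suff [_] : length_le A' setT l <-> length_le [set 0] [set: subquot Z A] l by apply.
apply: (length_le_iso (pi_quot A')) => //.
- exact: submodT.
- exact: submod_0.
- exact: submodT.
- have sA' : submodule A' by exact: (@submod_preim _ _ _ val).
  move=> z _; split=> [Az|/= z0].
    by rewrite /= -[RHS](linear0 (pi_quot _)); apply/pi_quotP; rewrite subr0; exact: mem_span.
  apply: span_id => //; rewrite -[z]subr0; apply/pi_quotP.
  by rewrite z0 linear0.
- move=> q _; exists 0 => //; exists q; last by rewrite add0r.
  by exists (repr_quot q) => //; exact: repr_quotK.
Qed.

End HasLength.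

Lemma has_length_koszul (R : comNzRingType) (M : lmodType R) d (x : 'I_d -> R) i l :
  has_length (koszul_homology M x i) l -> homology_le M x [set: 'I_d]%SET i l.
Proof.
rewrite /koszul_homology -!supp_koszul_chain => h; apply: has_length_subquot h.
- exact: submod_bnd.
- exact: submod_cyc.
- exact: bnd_cyc.
Qed.

(** * The image of [M (x) A'/A] in [M (x) R/A] as [A' M / A M] *)

Section TensorQuotient.
Variables (R : comNzRingType) (M : lmodType R) (A A' : set R^o).
Hypotheses (sA : submodule A) (sA' : submodule A') (AA' : A `<=` A').

Let AM := ideal_mul A [set: M].
Let A'M := ideal_mul A' [set: M].

Lemma ideal_mul_mem (I : set R^o) (a : R^o) (v : M) : I a -> ideal_mul I setT ((a : R) *: v).
Proof. by move=> Ia; apply: mem_span; exists a => //; exists v. Qed.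

Lemma ideal_mul_sub (I : set R^o) (N : set M) : submodule N ->
  (forall (a : R^o) v, I a -> N ((a : R) *: v)) -> ideal_mul I setT `<=` N.
Proof. by move=> sN h; apply: span_sub => // _ [a Ia [v _ <-]]; exact: h. Qed.

Definition tens1 (v : M) : tensor M (quot_module A) := tens v (pi_quot A (1 : R^o)).

Lemma tens1_linear : linear tens1.
Proof. by move=> a u v; rewrite /tens1 tensDl tensZl. Qed.
HB.instance Definition _ := GRing.isLinear.Build R _ _ _ tens1 tens1_linear.

Lemma tens1Z (a : R) v : tens1 (a *: v) = tens v (pi_quot A (a : R^o)).
Proof.
rewrite /tens1 tensZl -tensZr -linearZ /=; congr (tens v (pi_quot A _)).
exact: mulr1.
Qed.

Lemma submod_ideal_mul (I : set R^o) : submodule (ideal_mul I [set: M]).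
Proof. exact: submod_span. Qed.

Let evalM (v : M) (q : quot_module A) : quot_module AM :=
  pi_quot AM ((repr_quot q : R) *: v).

Let evalM_pi v (r : R^o) : evalM v (pi_quot A r) = pi_quot AM ((r : R) *: v).
Proof.
apply/pi_quotP; rewrite -scalerBl; apply/mem_span/ideal_mul_mem.
by apply: (span_id sA); apply/pi_quotP; rewrite repr_quotK.
Qed.

Let evalMl q : linear (evalM^~ q).
Proof.
by move=> a u v; rewrite /evalM -linearP /= scalerDr !scalerA mulrC.
Qed.

Let evalMr v : linear (evalM v).
Proof.
move=> a p q; rewrite -[p]repr_quotK -[q]repr_quotK -linearP /= !evalM_pi.
by rewrite -linearP /= scalerDl scalerA.
Qed.

(** For the converse, [evalM] induces a map from the tensor product to [M / A M] sending [tens1 v]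
    back to the class of [v]. *)
Lemma tens1_eq0 v : AM v <-> tens1 v = 0.
Proof.
split.
  have sK : submodule (tens1 @^-1` [set 0]) by apply: submod_preim; exact: submod_0.
  apply: (ideal_mul_sub sK) => a u Aa; rewrite /preimage /= tens1Z.
  have -> : pi_quot A a = 0.
    by rewrite -[RHS](linear0 (pi_quot A)); apply/pi_quotP; rewrite subr0; exact: mem_span.
  by have := tensZr 0 u (0 : quot_module A); rewrite !scale0r.
move=> v0; have := congr1 (tensor_lift evalM) v0.
rewrite /tens1 (tensor_lift_tens evalMl evalMr) evalM_pi scale1r.
have -> : tensor_lift evalM 0 = 0.
  have := tensor_lift_linear evalMl evalMr (-1) 0 0.
  by rewrite scaler0 addr0 scaleN1r addNr.
move=> e; apply: (span_id (submod_ideal_mul _)).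
by rewrite -[v]subr0; apply/pi_quotP; rewrite e linear0.
Qed.

Lemma subquot_incl_linear : linear (@subquot_incl _ _ A' A).
Proof.
move=> a p q; rewrite -[p]repr_quotK -[q]repr_quotK -linearP /= !subquot_incl_pi.
by rewrite !linearP.
Qed.
HB.instance Definition _ :=
  GRing.isLinear.Build R _ _ _ (@subquot_incl _ _ A' A) subquot_incl_linear.

Let S := range (tensor_map (@idfun M) (@subquot_incl _ _ A' A)).

Lemma length_tensor_image l :
  length_le [set 0] S l <-> length_le AM A'M l.
Proof.
have sS : submodule S by apply: submod_im; exact: submodT.
apply: iff_sym; apply: (length_le_iso tens1).
- exact: submod_ideal_mul.
- exact: submod_0.
- exact: sS.
- by apply: ideal_mul_sub => [|a v /AA']; [exact: submod_ideal_mul|exact: ideal_mul_mem].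
- by move=> _ ->; exact: submod0.
- by move=> v _; exact: tens1_eq0.
- have sP : submodule (tens1 @^-1` S) by exact: submod_preim.
  suff : A'M `<=` tens1 @^-1` S by move=> h _ [v /h ? <-].
  apply: ideal_mul_sub => // a v A'a; rewrite /preimage /= tens1Z.
  exists (tens v (pi_quot _ (Sub a (mem_span A'a) : sub_module A'))) => //.
  by rewrite tensor_map_tens /= subquot_incl_pi SubK.
- move=> _ [t _ <-]; apply: saddr => //.
  have sG : submodule (tens1 @` A'M) by apply: submod_im; exact: submod_ideal_mul.
  have [s ->] := tensE t; rewrite linear_sum; apply: (submod_sum _ sG) => z _.
  rewrite linearZ /=; apply: (submodZ _ sG).
  rewrite tensor_map_tens /= -[z.2.2]repr_quotK subquot_incl_pi.
  exists ((val (repr_quot z.2.2) : R) *: z.2.1); last by rewrite tens1Z.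
  by apply: ideal_mul_mem; exact: span_id (valP _).
Qed.

End TensorQuotient.

Section ClosureElements.
Variables (R : comNzRingType) (M : nat -> lmodType R) (alpha : nat -> rat).
Implicit Types (A : set R^o) (u : R).

(** [\ell ((A + R u) M_n / A M_n) = o(alpha n)]. *)
Definition small A u := negligible alpha (fun n =>
  length_le (ideal_mul A [set: M n])
    (sadd (ideal_mul A [set: M n]) (range (homoth u)))).

Lemma closure_imageP A A' : submodule A -> submodule A' -> A `<=` A' ->
  length_littleo (closure_image M A A') alpha <->
  negligible alpha (fun n => length_le (ideal_mul A [set: M n]) (ideal_mul A' [set: M n])).
Proof.
move=> sA sA' AA'; pose S n := range (tensor_map (@idfun (M n)) (@subquot_incl _ _ A' A)).
have sS n : submodule (S n) by apply: submod_im; exact: submodT.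
have eS n l := length_tensor_image (M n) sA sA' AA' l.
split=> [/length_littleoP|].
  apply: negligible_imp => n l /has_length_le h; apply/eS.
  exact/(has_length_sub l (sS n)).
move=> [l [N hN] ho]; apply/length_littleoP.
have ex n : exists l', (N <= n)%N -> (l' <= l n)%N /\ has_length (closure_image M A A' n) l'.
  have [Nn|] := leqP N n; last by exists 0%N.
  have /eS/(has_length_sub _ (sS n))/le_has_length[l' ll hl'] := hN n Nn.
  by exists l'.
pose l' n := projT1 (cid (ex n)).
have hl' n := projT2 (cid (ex n)); exists l'.
  by exists N => n Nn; have [] := hl' n Nn.
move=> e e0; have [N' hN'] := ho e e0; exists (maxn N N') => n.
rewrite geq_max => /andP[Nn /hN']; apply: le_trans; rewrite ler_nat.
by have [] := hl' n Nn.
Qed.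

(** A candidate containing [u] contains [A + R u], and [A + R u] is itself a candidate when [u] is
    small; membership is thus tested one element at a time. *)
Lemma fl_closureP A u : submodule A -> fl_closure M alpha A u <-> small A u.
Proof.
move=> sA; split=> [[A' [sA' AA' /(closure_imageP sA sA' AA') h] A'u]|].
  apply: negligible_imp h => n l; apply: length_leS => //.
  apply: sadd_sub; first exact: submod_ideal_mul.
    by apply: ideal_mul_sub => [|a v /AA']; [exact: submod_ideal_mul|exact: ideal_mul_mem].
  by move=> _ [v _ <-]; exact: (@ideal_mul_mem _ _ _ u).
pose A' : set R^o := sadd A (range (homoth u : R^o -> R^o)).
have sA' : submodule A' by apply: submod_add => //; apply: submod_im; exact: submodT.
have AA' : A `<=` A' by apply: saddl; exists 0 => //; exact: scaler0.
move=> h; exists A'; last first.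
  by apply: saddr; [exact: submod0|exists 1 => //; exact: mulr1].
split=> //; apply/closure_imageP => //; apply: negligible_imp h => n l.
apply: length_leS => //; apply: ideal_mul_sub => [|_ v [a Aa [_ [r _ <-] <-]]].
  by apply: submod_add; [exact: submod_ideal_mul|apply: submod_im; exact: submodT].
exists ((a : R) *: v); first exact: ideal_mul_mem.
exists (homoth u (r *: v)); first by exists (r *: v).
by rewrite /homoth scalerDl scalerA.
Qed.

(** Multiplication by [y] maps [(A + R u) M / A M] onto [(A' + R u y) M / A' M]. *)
Lemma small_mul A A' u y : (forall a : R^o, A a -> A' (a * y : R)) ->
  small A u -> small A' (u * y).
Proof.
move=> AA'; apply: negligible_imp => n l.
have su N' r : submodule N' -> submodule (sadd N' (range (homoth r : M n -> M n))).
  by move=> sN; apply: submod_add => //; apply: submod_im; exact: submodT.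
apply: (length_le_surj (homoth y)).
- by apply: su; exact: submod_ideal_mul.
- by apply: saddl; exists 0 => //; exact: scaler0.
- have sP : submodule (homoth y @^-1` ideal_mul A' [set: M n]).
    by apply: submod_preim; exact: submod_ideal_mul.
  apply: (ideal_mul_sub sP) => a v /AA' Aa; rewrite /preimage /= /homoth scalerA mulrC.
  exact: ideal_mul_mem.
- apply: saddS => // _ [v _ <-]; exists (homoth u v).
    by apply: saddr; [exact: submod0 (submod_ideal_mul _ _)|exists v].
  by rewrite /= /homoth scalerA mulrC.
Qed.

Lemma smallS A A' u : A `<=` A' -> small A u -> small A' u.
Proof. by move=> AA' h; rewrite -[u]mulr1; apply: small_mul h => a /AA'; rewrite mulr1. Qed.

End ClosureElements.

Lemma ideal_mul_gen (R : comNzRingType) (M : lmodType R) d (x : 'I_d -> R) :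
  ideal_mul (ideal_gen x) [set: M] = gen_mul x [set: 'I_d]%SET.
Proof.
have sG := @submod_gen_mul R M d x [set: 'I_d]%SET.
apply/seteqP; split.
  apply: ideal_mul_sub => // a v; move: a.
  pose ev (r : R^o) : M := (r : R) *: v.
  have evl : linear ev by move=> a r s; rewrite /ev scalerDl scalerA.
  pose evL : {linear R^o -> M} := HB.pack ev (GRing.isLinear.Build _ _ _ _ ev evl).
  apply: (span_sub (B := evL @^-1` gen_mul x [set: 'I_d]%SET)).
    exact: submod_preim.
  by move=> _ [j _ <-]; apply: gen_mul_mem; rewrite inE.
apply: gen_mul_sub; first exact: submod_ideal_mul.
by move=> l v _; apply: ideal_mul_mem; apply: mem_span; exists l.
Qed.

(** * Prime filtrations *)

Section PrimeFiltrations.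
Variable R : comNzRingType.

Definition prime_set (P : set R^o) : Prop :=
  [/\ submodule P, ~ P (1 : R) & forall a b : R, P (a * b) -> P a \/ P b].

Lemma prime_set_exp (P : set R^o) (a : R) n : prime_set P -> P (a ^+ n) -> P a.
Proof.
move=> [_ P1 PM]; elim: n => [|n IH]; first by rewrite expr0.
by rewrite exprS => /PM[].
Qed.

Lemma prime_setP (P : set R^o) :
  prime_set P <-> exists p : prime_idealr R, [set` p] = P.
Proof.
split=> [[sP P1 PM]|[p <-]]; last first.
  split=> [||a b /=].
  - apply/submoduleP; split=> [|a u v /= pu pv] /=; first exact: idealr0.
    by apply: rpredD => //; exact: idealMr.
  - by rewrite /= idealr1.
  - by rewrite prime_idealrM => /orP.
pose S (r : R) := `[< P r >].
have SI : idealr_closed S.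
  split; [exact/asboolP/(submod0 sP)|exact/asboolPn|].
  move=> a u v /asboolP Pu /asboolP Pv; apply/asboolP.
  by apply: (submodD sP) => //; exact: (submodZ (V := R^o) a sP).
have SP : prime_idealr_closed S.
  by move=> u v /asboolP/PM[] Pu; apply/orP; [left|right]; apply/asboolP.
exists (HB.pack_for (prime_idealr R) S (isIdealr.Build R S SI)
  (isPrimeIdealrClosed.Build R S SP)).
by apply/seteqP; split=> r; [move/asboolP|move=> Pr; apply/asboolP].
Qed.

(** A counterexample would start, by choice, a strictly increasing sequence of ideals; the finitely
    many generators of its union already lie in one term. *)
Lemma noetherian_ind (P : set R^o -> Prop) : noetherian R ->
  (forall I, submodule I -> (forall J, submodule J -> I `<` J -> P J) -> P I) ->
  forall I, submodule I -> P I.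
Proof.
move=> noeth IH I0 sI0; apply: contrapT => nP0.
pose bad I := submodule I /\ ~ P I.
have next (I : {I | bad I}) : exists J : {I | bad I}, sval I `<` sval J.
  case: I => I [sI nPI] /=; apply: contrapT => h; apply: nPI; apply: (IH _ sI).
  move=> J sJ IJ; apply: contrapT => nPJ; apply: h.
  by exists (exist _ J (conj sJ nPJ)).
have [f fP] := choice next.
pose seqI n := sval (iter n f (exist _ I0 (conj sI0 nP0))).
have sI n : submodule (seqI n) by case: (svalP (iter n f (exist _ I0 (conj sI0 nP0)))).
have lt n : seqI n `<` seqI n.+1 by exact: fP.
have le i j : (i <= j)%N -> seqI i `<=` seqI j.
  elim: j => [|j IHj]; first by rewrite leqn0 => /eqP->.
  rewrite leq_eqVlt => /predU1P[->//|/IHj/subset_trans]; apply.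
  by case: (lt j).
pose U : set R^o := [set r | exists n, seqI n r].
have sU : submodule U.
  apply/submoduleP; split=> [|a u v [i iu] [j jv]].
    by exists 0%N; exact: (submod0 (sI 0%N)).
  exists (maxn i j); apply: (submodD (sI _)).
    by apply: (submodZ _ (sI _)); apply: le iu; exact: leq_maxl.
  by apply: le jv; exact: leq_maxr.
have [s sUs] := noeth U sU.
have [N hN] : exists N, forall r, r \in s -> seqI N r.
  have : forall r, r \in s -> U r by move=> r rs; rewrite sUs; exact: mem_span.
  elim: s {sUs} => [|r s IHs] hs; first by exists 0%N.
  have [r' r's|N hN] := IHs; first by apply: hs; rewrite inE r's orbT.
  have [n hn] := hs r (mem_head _ _).
  exists (maxn n N) => r'; rewrite inE => /predU1P[->|/hN].
    by apply: le hn; exact: leq_maxl.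
  by apply: le; exact: leq_maxr.
have [_] := lt N; apply => r rN.
have : U r by exists N.+1.
by rewrite sUs; apply: span_sub => // r'; exact: hN.
Qed.

Section Filtration.
Variable V : lmodType R.

Definition orb (e : V) (r : R^o) : V := (r : R) *: e.

Lemma orb_linear e : linear (orb e).
Proof. by move=> a u v; rewrite /orb scalerDl scalerA. Qed.
HB.instance Definition _ e := GRing.isLinear.Build R R^o V _ (orb e) (orb_linear e).

Lemma submod_cyclic e : submodule (range (orb e)).
Proof. by apply: submod_im; exact: submodT. Qed.

(** [prime_filt N N' s]: there is a chain of submodules from [N] to [N'] whose
    successive quotients are the [R / P] for [P] in [s], listed from the top. *)
Inductive prime_filt (N : set V) : set V -> seq (set R^o) -> Prop :=
| PrimeFiltNil : prime_filt N N [::]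
| PrimeFiltCons N' e P s : prime_filt N N' s -> prime_set P ->
    orb e @^-1` N' = P -> prime_filt N (sadd N' (range (orb e))) (P :: s).

Lemma prime_filt_sub N N' s : submodule N -> prime_filt N N' s ->
  submodule N' /\ N `<=` N'.
Proof.
move=> sN; elim=> [|N1 e P s1 _ [sN1 NN1] _ _]; [by split|split].
  by apply: submod_add => //; exact: submod_cyclic.
by apply: subset_trans NN1 _; apply: saddl; exact: (submod0 (submod_cyclic e)).
Qed.

Lemma prime_filt_cat N N' N'' s s' :
  prime_filt N N' s -> prime_filt N' N'' s' -> prime_filt N N'' (s' ++ s).
Proof.
move=> h; elim=> [//|N1 e P s1 _ IH pP eP].
exact: PrimeFiltCons.
Qed.

(** When [a b] is in the annihilator [I] of [e] modulo [N] and [a], [b] are not,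
    the annihilators of [a e] modulo [N] and of [e] modulo [N + R a e] are larger. *)
Lemma prime_filt_cyclic (noeth : noetherian R) (I : set R^o) : submodule I ->
  forall N e, submodule N -> orb e @^-1` N = I ->
  exists s, prime_filt N (sadd N (range (orb e))) s.
Proof.
move: I; apply: (noetherian_ind noeth) => I sI IH N e sN eI.
have memI r : I r = N (r *: e) by rewrite -eI.
have [I1|nI1] := pselect (I (1 : R)).
  exists [::]; have -> : sadd N (range (orb e)) = N; last exact: PrimeFiltNil.
  apply/seteqP; split; last by apply: saddl; exact: (submod0 (submod_cyclic e)).
  apply: sadd_sub => // _ [r _ <-]; apply: (submodZ _ sN).
  by move: I1; rewrite memI scale1r.
have [pI|npI] := pselect (forall a b : R, I (a * b) -> I a \/ I b).
  by exists [:: I]; apply: PrimeFiltCons => //; exact: PrimeFiltNil.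
have [a [b [Iab nIa nIb]]] : exists a b : R, [/\ I (a * b), ~ I a & ~ I b].
  apply: contrapT => h; apply: npI => a b Iab.
  have [Ia|nIa] := pselect (I a); [by left|right].
  by apply: contrapT => nIb; apply: h; exists a, b.
pose N1 := sadd N (range (orb (a *: e))).
have sN1 : submodule N1 by apply: submod_add => //; exact: submod_cyclic.
have NN1 : N `<=` N1 by apply: saddl; exact: (submod0 (submod_cyclic _)).
have subI (J : set R^o) : submodule J -> I `<=` J -> (exists2 r, J r & ~ I r) -> I `<` J.
  by move=> _ IJ [r Jr nIr]; split=> // JI; exact/nIr/JI.
have [||s1 h1] := IH (orb (a *: e) @^-1` N) _ _ N (a *: e) sN erefl.
- exact: submod_preim.
- apply: subI; first exact: submod_preim.
    move=> r; rewrite memI /preimage /= /orb scalerA mulrC -scalerA => Nr.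
    exact: submodZ.
  by exists b => //; move: Iab; rewrite memI /preimage /= /orb scalerA mulrC.
have [||s2 h2] := IH (orb e @^-1` N1) _ _ N1 e sN1 erefl.
- exact: submod_preim.
- apply: subI; first exact: submod_preim.
    by move=> r; rewrite memI => /NN1.
  exists a => //; apply: saddr; first exact: submod0.
  by exists 1; rewrite // /orb scale1r.
exists (s2 ++ s1); have -> : sadd N (range (orb e)) = sadd N1 (range (orb e)).
  apply/seteqP; split; first exact: saddS.
  apply: sadd_sub; first by apply: submod_add => //; exact: submod_cyclic.
    apply: saddS => // _ [r _ <-]; exists (r * a) => //.
    by rewrite /orb scalerA.
  by apply: saddr; exact: submod0.
exact: prime_filt_cat h1 h2.
Qed.

Lemma prime_filt_fg : noetherian R -> finitely_generated [set: V] ->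
  exists s, prime_filt [set 0] [set: V] s.
Proof.
move=> noeth [g gT].
have main (N : set V) : submodule N -> exists N' s,
    [/\ prime_filt N N' s, submodule N', N `<=` N' & forall v, v \in g -> N' v].
  elim: g {gT} N => [|e g IH] N sN; first by exists N, [::]; split=> //; exact: PrimeFiltNil.
  have [s1 h1] := prime_filt_cyclic noeth (submod_preim (orb e) sN) sN erefl.
  have sN1 : submodule (sadd N (range (orb e))).
    by apply: submod_add => //; exact: submod_cyclic.
  have [N' [s [h sN' NN' gN']]] := IH _ sN1.
  exists N', (s ++ s1); split=> //; first exact: prime_filt_cat h1 h.
    by apply: subset_trans NN'; apply: saddl; exact: (submod0 (submod_cyclic e)).
  move=> v; rewrite inE => /predU1P[->|/gN'//]; apply/NN'/saddr; first exact: submod0.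
  by exists 1; rewrite // /orb scale1r.
have [N' [s [h sN' _ gN']]] := main _ (@submod_0 _ V).
exists s; have <- : N' = [set: V]; last exact: h.
apply/seteqP; split=> // v _; have : [set: V] v by [].
by rewrite gT; apply: span_sub.
Qed.

Lemma prime_filt_primes (J : set R^o) N N' s : submodule N -> prime_filt N N' s ->
  (forall (r : R) v, J r -> N' v -> N (r *: v)) ->
  all (fun P => `[< prime_set P /\ J `<=` P >]) s.
Proof.
move=> sN; elim=> [//|N1 e P s1 h IH pP eP] JN /=.
have [sN1 NN1] := prime_filt_sub sN h.
apply/andP; split.
  apply/asboolP; split=> // r Jr; rewrite -eP; apply: NN1; apply: JN => //.
  by apply: saddr; [exact: submod0|exists 1; rewrite // /orb scale1r].
apply: IH => r v Jr N1v; apply: JN => //.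
by apply: saddl N1v; exact: (submod0 (submod_cyclic e)).
Qed.

(** Each factor [I] of the power goes down one layer of the filtration. *)
Lemma prime_filt_exp (I : set R^o) N N' s : submodule N -> prime_filt N N' s ->
  all (fun P : set R^o => `[< I `<=` P >]) s ->
  forall (z : R^o) v, ideal_exp I (size s) z -> N' v -> N ((z : R) *: v).
Proof.
move=> sN; elim=> [|N1 e P s1 h IH _ eP] /=; first by move=> _ z v _; exact: submodZ.
have [sN1 NN1] := prime_filt_sub sN h.
move=> /andP[/asboolP IP /IH{}IH] z v Iz Nv.
have step (a : R) : I a -> N1 (a *: v).
  case: Nv => u N1u [_ [r _ <-] <-] /IP; rewrite -eP /preimage /= /orb scalerDr => N1a.
  apply: submodD => //; first exact: submodZ.
  by rewrite scalerA mulrC -scalerA; exact: submodZ.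
have : [set z : R^o | N ((z : R) *: v)] z; last by [].
apply: (span_sub _ _ Iz); first exact: (submod_preim (orb v)).
move=> _ [a Ia [w Iw <-]] /=.
have -> : ((a *: w : R^o) : R) *: v = (w : R) *: ((a : R) *: v) by rewrite scalerA mulrC.
by apply: IH => //; exact: step.
Qed.

(** Each layer [R / P] is killed by an element of [P] outside [p]; [u] is the product of these, and
    the localization of [N' / N] at [p] vanishes. *)
Lemma prime_filt_avoid (p : set R^o) N N' s : prime_set p -> submodule N ->
  prime_filt N N' s -> ~~ has (fun P : set R^o => `[< P `<=` p >]) s ->
  exists2 u : R, ~ p u & forall v, N' v -> N (u *: v).
Proof.
move=> [_ p1 pM] sN; elim=> [_|N1 e P s1 h IH _ eP /=].
  by exists 1 => // v; rewrite scale1r.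
rewrite negb_or => /andP[/asboolPn Pp /IH[u pu uN1]].
have [q Pq pq] : exists2 q, P q & ~ p q.
  by apply: contrapT => hq; apply: Pp => q Pq; apply: contrapT => pq; apply: hq; exists q.
exists (u * q) => [/pM[]//|v [w N1w [_ [r _ <-] <-]]].
have [sN1 _] := prime_filt_sub sN h.
rewrite -scalerA; apply: uN1; rewrite scalerDr; apply: submodD => //; first exact: submodZ.
rewrite /orb scalerA mulrC -scalerA; apply: submodZ => //.
by move: Pq; rewrite -eP.
Qed.

End Filtration.

End PrimeFiltrations.

(** * Growth of the length of [R / (P + (x_1^t, ..., x_d^t))] *)

Section Pigeonhole.
Variable R : comNzRingType.
Variable J : set R^o.
Hypothesis sJ : submodule J.

(** In each monomial of the expansion some exponent reaches [t]. The added [1] is for the empty sum,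
    where the exponent [0] would give [1]. *)
Lemma sum_exp_mem (I : Type) (r : seq I) (F : I -> R) t :
  (forall i, J (F i ^+ t)) -> J ((\sum_(i <- r) F i) ^+ (1 + size r * t)).
Proof.
move=> JF; elim: r => [|i r IH].
  by rewrite big_nil expr1; exact: (submod0 sJ).
rewrite big_cons [size _]/= exprDn; apply: (submod_sum _ sJ) => j _.
rewrite -mulr_natl; apply: (submodZ (V := R^o) _ sJ).
have [tj|jt] := leqP t (1 + (size r).+1 * t - j).
  rewrite -(subnK tj) exprD mulrAC; exact: (submodZ (V := R^o) _ sJ).
have : (1 + size r * t <= j)%N by have := mulSn (size r) t; lia.
move/subnK => <-; rewrite exprD mulrA; exact: (submodZ (V := R^o) _ sJ).
Qed.

End Pigeonhole.

Section Growth.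
Variables (R : comNzRingType) (m : idealr R) (d : nat) (x : 'I_d -> R).
Hypotheses (loc : local_ring m).
Hypothesis xm : forall r, r \in m <-> exists n, ideal_gen x (r ^+ n).

Let xt t : set R^o := ideal_gen (fun i => x i ^+ t).
Let sxt t : submodule (xt t). Proof. exact: submod_span. Qed.

(** [y ^+ n] is a combination of the [k] elements [x l], so the exponent [n (1 + k t)] suffices; it
    is at most [n (1 + k) t], whence a [c] independent of [t]. *)
Lemma ideal_gen_exp (y : R) : y \in m -> exists c, forall t, (0 < t)%N -> xt t (y ^+ (c * t)).
Proof.
move=> /xm[n yn]; pose k := size (index_enum 'I_d).
have [w yE] : gen_mul x [set: 'I_d]%SET (y ^+ n : R^o).
  apply: (span_sub _ _ yn); first exact: submod_gen_mul.
  move=> _ [i _ <-]; rewrite -[x i]mulr1; apply: (@gen_mul_mem R R^o).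
  by rewrite inE.
have {}yE : y ^+ n = \sum_l x l * w l by rewrite yE; apply: eq_bigl => l; rewrite inE.
exists (n * (1 + k))%N => t t0; have : xt t ((y ^+ n) ^+ (1 + k * t)).
  rewrite yE; apply: sum_exp_mem => // i; rewrite exprMn mulrC.
  by apply: (submodZ (V := R^o) _ (sxt t)); apply: mem_span; exists i.
rewrite -exprM; have le : (n * (1 + k * t) <= n * (1 + k) * t)%N.
  by rewrite -mulnA leq_mul2l mulnDl mul1n leq_add2r t0 orbT.
by rewrite -(subnK le) exprD; exact: (submodZ (V := R^o) _ (sxt t)).
Qed.

Lemma proper_sub_max (J : set R^o) : submodule J -> ~ J (1 : R) ->
  [set` m] `<=` J -> J `<=` [set` m].
Proof.
move=> sJ J1 mJ; pose S (r : R) := `[< J r >].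
have SI : idealr_closed S.
  split; [exact/asboolP/(submod0 sJ)|exact/asboolPn|].
  move=> a u v /asboolP Pu /asboolP Pv; apply/asboolP.
  by apply: (submodD sJ) => //; exact: (submodZ (V := R^o) a sJ).
pose I := HB.pack_for (idealr R) S (isIdealr.Build R S SI).
have [_ mmax _] := loc; have sub : {subset m <= I}.
  by move=> r rm; apply/asboolP/mJ.
by move=> r Jr; apply: (mmax I sub); exact/asboolP.
Qed.

Lemma length_max (J : set R^o) : [set` m] `<=` J -> length_le J setT 1.
Proof.
move=> mJ; apply: length_leP => N k sN NS.
case: k sN NS => [|[|k]] // sN NS.
have [s0 J0 _] := sN 0%N isT; have [s1 J1 _] := sN 1%N isT.
have [_ n10] := NS 0%N isT; have [_ n21] := NS 1%N isT.
have [h|h] := pselect (N 1%N (1 : R)).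
  case: n21 => r _; have := submodZ r s1 h.
  by rewrite /GRing.scale /= mulr1.
by case: n10; apply: subset_trans (proper_sub_max s1 h (subset_trans mJ J1)) _; exact: subset_trans mJ J0.
Qed.

Definition prime_chain (P : set R^o) k := exists p : nat -> set R^o,
  [/\ p 0%N = P, forall i, (i <= k)%N -> prime_set (p i)
    & forall i, (i < k)%N -> p i `<` p i.+1].

(** [e] plays the role of [dim (R / P) + 1]: the extra factor [t] avoids a negative exponent and
    makes [e = 0] the vacuous start of the induction on dimension. *)
Definition growth_le (P : set R^o) C e := forall t, (0 < t)%N ->
  exists2 L, length_le (sadd P (xt t)) setT L & (L * t <= C * t ^ e)%N.

Lemma growth_leW P C C' e : (C <= C')%N -> growth_le P C e -> growth_le P C' e.
Proof.
move=> CC h t /h[L hL Lt]; exists L => //; apply: leq_trans Lt _.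
by rewrite leq_mul2r CC orbT.
Qed.

(** The leading constant [K] is given beforehand for all good primes, while [C] may depend on the
    filtration and so on the module. *)
Lemma prime_filt_growth (V : lmodType R) (good : pred (set R^o)) K e
    (N N' : set V) s : submodule N -> prime_filt N N' s ->
  all (fun P => `[< if good P then growth_le P K e.+1 else exists C, growth_le P C e >]) s ->
  exists C, forall t, (0 < t)%N -> exists2 L,
    length_le (sadd N (ideal_mul (xt t) [set: V])) (sadd N' (ideal_mul (xt t) [set: V])) L
  & (L * t <= K * count good s * t ^ e.+1 + C * t ^ e)%N.
Proof.
move=> sN; elim=> [_|N1 a P s1 h IH _ eP /=].
  by exists 0%N => t t0; exists 0%N; [exact: length_le_same|].
move=> /andP[/asboolP gP /IH[C hC]].
have [sN1 NN1] := prime_filt_sub sN h.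
have sI t : submodule (ideal_mul (xt t) [set: V]) by exact: submod_ideal_mul.
have sA t N2 : submodule N2 -> submodule (sadd N2 (ideal_mul (xt t) [set: V])).
  by move=> sN2; exact: submod_add.
have sc := submod_cyclic a.
have sN2 : submodule (sadd N1 (range (orb a))) by exact: submod_add.
have step t L : length_le (sadd P (xt t)) setT L ->
    length_le (sadd N1 (ideal_mul (xt t) [set: V]))
      (sadd (sadd N1 (range (orb a))) (ideal_mul (xt t) [set: V])) L.
  apply: (length_le_surj (orb a)) => //; first exact: submodT.
    move=> _ [r Pr [r' r't <-]]; rewrite linearD; exists (orb a r).
      by move: Pr; rewrite -eP.
    by exists (orb a r') => //; exact: ideal_mul_mem.
  move=> _ [_ [v Nv [w aw <-]] [u Iu <-]]; exists (v + u).
    by exists v => //; exists u.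
  by exists w => //; rewrite addrAC.
have [C' hC'] : exists C', forall t, (0 < t)%N -> exists2 L,
    length_le (sadd P (xt t)) setT L & (L * t <= K * good P * t ^ e.+1 + C' * t ^ e)%N.
  case: (good P) gP => [gP|[C' gP]].
    by exists 0%N => t /gP[L hL Lt]; exists L => //; rewrite muln1 addn0.
  by exists C' => t /gP[L hL Lt]; exists L => //; rewrite muln0.
exists (C + C')%N => t t0; have [L hL Lt] := hC t t0; have [L' hL' Lt'] := hC' t t0.
exists (L + L')%N; last first.
  rewrite mulnDl mulnDr !mulnDl addnC; apply: leq_trans (leq_add Lt' Lt) _.
  by rewrite addnACA [(C' * _ + _)%N]addnC.
apply: (length_le_add _ _ _ _ _ hL (step t L' hL')); [exact: sA|exact: sA|..].
- exact: saddS.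
- by apply: saddS => //; apply: saddl; exact: (submod0 sc).
- exact: sA.
Qed.

(** The length of [R / (P + (x_1^t, ..., x_d^t))] is [O(t ^ (dim R / P))]: if
    [y] is in [m] but not in [P], this length is at most [n] times the length
    for [P + R y], where [y ^+ n] is in [(x_1^t, ..., x_d^t)] and [n = O(t)]. *)
Lemma prime_growth e (P : set R^o) : prime_set P ->
  (forall k, prime_chain P k -> (k < e)%N) -> exists C, growth_le P C e.
Proof.
elim: e P => [|e IH] P pP chP.
  have : (0 < 0)%N by apply: chP; exists (fun=> P); split=> // i; rewrite leqn0 => /eqP->.
  by [].
have [noeth _ _] := loc; have [sP P1 _] := pP.
have [mP|nmP] := pselect ([set` m] `<=` P).
  exists 1%N => t t0; exists 1%N; last by rewrite expnS !mul1n leq_pmulr // expn_gt0 t0.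
  by apply: length_max; apply: subset_trans mP _; exact: (saddl (submod0 (sxt t))).
have [y ym yP] : exists2 y, y \in m & ~ P y.
  by apply: contrapT => h; apply: nmP => y ym; apply: contrapT => yP; apply: h; exists y.
pose N : set R^o := sadd P (homoth y @` setT).
have sN : submodule N by apply: submod_add => //; apply: submod_homoth; exact: submodT.
have PN : P `<=` N by apply: saddl; exists 0 => //; exact: scaler0.
have [s hs] := prime_filt_cyclic (V := R^o) (e := 1) noeth (submod_preim (orb (1 : R^o)) sN) sN erefl.
have NT : sadd N (range (orb (1 : R^o))) = setT.
  apply/seteqP; split=> // r _; apply: saddr; first exact: (submod0 sN).
  by exists r => //; exact: mulr1.
rewrite NT in hs.
have all_s : all (fun Q : set R^o => `[< prime_set Q /\ N `<=` Q >]) s.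
  apply: (prime_filt_primes sN hs) => r v Nr _.
  by rewrite [_ *: _]mulrC; exact: (submodZ (V := R^o) v sN).
have [C hC] : exists C, forall t, (0 < t)%N -> exists2 L,
    length_le (sadd N (ideal_mul (xt t) [set: R^o])) (sadd setT (ideal_mul (xt t) [set: R^o])) L
  & (L * t <= C * t ^ e)%N.
  (* No prime is good here: those containing [P + R y] lie strictly above [P], so their chains are
     shorter and the induction hypothesis covers them all. *)
  have [|C hC] := prime_filt_growth (good := xpred0) (K := 0) (e := e) sN hs.
    apply: sub_all all_s => Q /asboolP[pQ NQ] /=; apply/asboolP; apply: IH => // k [p [p0 pp pS]].
    apply: chP k.+1 _; exists (fun i => if i is j.+1 then p j else P); split=> //.
      by case=> // i; exact: pp.
    case=> [_|i ik]; last exact: pS.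
    rewrite p0; split; first exact: subset_trans NQ.
    move=> QP; apply/yP/QP/NQ; apply: saddr; first exact: (submod0 sP).
    by exists 1 => //; exact: mulr1.
  by exists C => t /hC[L hL]; rewrite !mul0n add0n; exists L.
have [c hc] := ideal_gen_exp ym.
(* The length for [P] is at most [c t] times the length [L] for [P + R y], and [L t <= C t^e]. *)
exists (c * C)%N => t t0; have [L hL Lt] := hC t t0.
exists (c * t * L)%N; last first.
  by rewrite -mulnA expnS [(c * C * _)%N]mulnACA leq_mul2l Lt orbT.
have sPt : submodule (sadd P (xt t)) by exact: submod_add.
have hy : length_le (im_plus (sadd P (xt t)) setT y) setT L.
  apply: length_leS hL; last by apply: saddl; exact: (submod0 (submod_ideal_mul _ _)).
  apply: sadd_sub; first by apply: submod_im_plus => //; exact: submodT.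
    apply: saddS => //; apply: saddl; exact: (submod0 (sxt t)).
  apply: ideal_mul_sub; first by apply: submod_im_plus => //; exact: submodT.
  move=> a v ta; apply: saddl; first by exists 0 => //; exact: scaler0.
  apply: saddr; first exact: (submod0 sP).
  by rewrite [_ *: _]mulrC; exact: (submodZ (V := R^o) _ (sxt t)).
apply: length_leS (length_im_exp sPt (@submodT _ _) (fun _ _ => I) (t := c * t) hy) => //.
apply: sadd_sub => // _ [v _ <-]; apply: saddr; first exact: (submod0 sP).
by rewrite /homoth [_ *: _]mulrC; apply: (submodZ (V := R^o) _ (sxt t)); exact: hc.
Qed.

End Growth.

(** * Comparison of [nu] with the rank *)

Section LowerBound.
Variables (R : comNzRingType) (V : lmodType R).

(** Since [y] induces an isomorphism from [B / ann] to [im / A], additivity of the finite length of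
    [B / A] makes the kernel and the cokernel equally long. *)
Lemma length_coker (A B : set V) y h : submodule A -> submodule B -> A `<=` B ->
  finite_len A B -> length_le A (ann_in A B y) h -> length_le (im_plus A B y) B h.
Proof.
move=> sA sB AB fl /len_le hh.
have sann := submod_ann y sA sB; have sim := submod_im_plus y sA sB.
have Aann : A `<=` ann_in A B y by move=> v Av; split; [exact: AB|exact: submodZ].
have annB : ann_in A B y `<=` B by move=> v [].
have Aim : A `<=` im_plus A B y by apply: saddl; exact: (submod0 (submod_homoth y sB)).
have imB : im_plus A B y `<=` B by apply: sadd_sub => //; exact: homoth_sub.
apply/length_len; split; first exact: finite_len_sub fl.
have e : len (ann_in A B y) B = len A (im_plus A B y).
  apply: (len_iso (homoth y)) => //.
    by move=> v Bv; split=> [[]|].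
  by move=> _ [v Bv <-]; apply: saddr; [exact: submod0|exists v].
have := lenD sA sann sB Aann annB fl; rewrite (lenD sA sim sB Aim imB fl) e.
by rewrite addnC => /addIn ->.
Qed.

(** Multiplication by [y^k] maps [V / Y 1] onto the layer [Y k / Y k.+1]; each of the [t] layers
    falls short of [V / Y 1] by at most [h]. *)
Lemma len_exp (Z : set V) y h L t : submodule Z -> (0 < t)%N ->
  length_le Z (homoth y @^-1` Z) h -> length_le (im_plus Z setT (y ^+ t)) setT L ->
  finite_len (im_plus Z setT y) setT /\
  (t * len (im_plus Z setT y) setT <= L + t * h)%N.
Proof.
move=> sZ t0 hy hL; have sT : submodule [set: V] by exact: submodT.
pose Y k := im_plus Z setT (y ^+ k).
have sY k : submodule (Y k) by exact: submod_im_plus.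
have YS k k' : (k <= k')%N -> Y k' `<=` Y k.
  move=> kk; apply: saddS => // _ [v _ <-]; exists (y ^+ (k' - k) *: v) => //.
  by rewrite /homoth scalerA -exprD subnKC.
have fl k : (k <= t)%N -> finite_len (Y k) setT.
  by move=> kt; apply: finite_len_sub (ex_intro _ L hL) => //; exact: YS.
have ZY k : Z `<=` Y k by apply: saddl; exact: (submod0 (submod_homoth _ sT)).
have im1 : im_plus Z setT y = Y 1%N by rewrite /Y expr1.
split; first by rewrite im1; exact: fl.
have hann k : length_le Z (ann_in Z setT (y ^+ k)) (k * h).
  by apply: length_ann_exp => //; apply: length_leS hy => // v [].
have step k : (k < t)%N -> (len (Y 1%N) setT <= len (Y k.+1) (Y k) + h)%N.
  move=> kt; pose H := ann_in Z setT (y ^+ k).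
  have sH : submodule H by exact: submod_ann.
  have ZH : Z `<=` H by move=> v Zv; split=> //; exact: submodZ.
  have sHY : submodule (sadd H (Y 1%N)) by exact: submod_add.
  have YHY : Y 1%N `<=` sadd H (Y 1%N) by apply: saddr; exact: submod0.
  have flY : finite_len (Y 1%N) setT by apply: fl; exact: leq_ltn_trans kt.
  rewrite (lenD (sY 1%N) sHY sT YHY _ flY) // addnC leq_add //.
    apply: len_le; apply: (length_le_inj (homoth (y ^+ k)) sT (sY k.+1) (sY k)).
    - exact: YS.
    - by move=> _ [v _ <-]; apply: saddr; [exact: submod0|exists v].
    - move=> v _ [z Zz [_ [w _ <-] e]]; exists (v - y *: w).
        split=> //; rewrite /preimage /= /homoth scalerBr scalerA -exprSr.
        by move: e; rewrite /homoth => <-; rewrite addrK.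
      exists (y *: w); last by rewrite subrK.
      by apply: saddr; [exact: submod0|exists w; rewrite /homoth ?expr1].
    apply: lenP; apply: finite_len_sub (fl k.+1 kt) => //.
  (* The kernel of the map to the layer is a quotient of [H / y H], with [H] the annihilator of
     [y^k]. This cokernel is as long as the kernel of [y] on [H], so the bound is [h] and not
     [k h]. *)
  apply: len_le; have hH : length_le (im_plus Z H y) H h.
    apply: length_coker => //; first by exists (k * h)%N; exact: hann.
    by apply: length_leS hy => // v [].
  apply: (length_le_surj idfun sH _ _ _ hH).
  - by apply: sadd_sub => //; exact: homoth_sub.
  - by apply: saddS => // _ [v _ <-]; exists v; rewrite // /homoth expr1.
  - move=> _ [v Hv [w Yw <-]]; exists w => //; exists v; last by rewrite addrC.
    by exists v.
rewrite im1; have main k : (k <= t)%N -> (k * len (Y 1%N) setT <= len (Y k) setT + k * h)%N.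
  elim: k => [//|k IH] kt.
  rewrite !mulSn (lenD (sY k.+1) (sY k) sT (YS _ _ (leqnSn k)) _ (fl _ kt)) //.
  by rewrite addnACA; apply: leq_add (step k kt) (IH (ltnW kt)).
by apply: leq_trans (main t (leqnn t)) _; rewrite leq_add2r; apply: len_le.
Qed.

End LowerBound.

Section KoszulLowerBound.
Variables (R : comNzRingType) (M : lmodType R) (d : nat) (x : 'I_d -> R) (h t : nat).
Hypotheses (hx : homology_le M x [set: 'I_d]%SET 1 h) (t0 : (0 < t)%N).

(** The exponents are raised to [t] one at a time. With [S] already raised, the annihilator has
    length at most [t^#|S| h]; after the remaining factors [t], each of the [d] steps contributes
    [t^d h]. *)
Lemma gen_mul_exp_len L :
  length_le (gen_mul (fun l => x l ^+ t) [set: 'I_d]%SET) [set: M] L ->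
  finite_len (gen_mul x [set: 'I_d]%SET) [set: M] /\
  (t ^ d * len (gen_mul x [set: 'I_d]%SET) [set: M] <= L + d * (t ^ d * h))%N.
Proof.
pose e (S : {set 'I_d}) l : nat := if l \in S then t else 1%N.
pose G (S : {set 'I_d}) := @gen_mul R M d (fun l => x l ^+ e S l) [set: 'I_d]%SET.
suff main S L' : length_le (G S) setT L' -> finite_len (G finset.set0) setT /\
    (t ^ #|S| * len (G finset.set0) setT <= L' + #|S| * (t ^ #|S| * h))%N.
  have := main [set: 'I_d]%SET L; rewrite cardsT card_ord /G.
  have -> : e [set: 'I_d]%SET = fun=> t by apply/funext => l; rewrite /e inE.
  by have -> : (fun l => x l ^+ e finset.set0 l) = x by apply/funext => l; rewrite /e inE expr1.
elim/finset_ind: S L' => [|j S jS IH] L' hL'.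
  rewrite cards0 mul1n; split; first by exists L'.
  by rewrite (leq_trans (len_le hL')) ?leq_addr.
pose Z := @gen_mul R M d (fun l => x l ^+ e S l) [set~ j]%SET.
have sZ : submodule Z by exact: submod_gen_mul.
have hZ : length_le Z (homoth (x j) @^-1` Z) (t ^ #|S| * h).
  have := @length_gen_ann R M d (fun l => x l ^+ e S l) j (t ^ #|S| * h).
  have -> : x j ^+ e S j = x j by rewrite /e (negPf jS) expr1.
  apply.
  have := @homology_exp R M d x (e S) 0 h hx.
  congr (homology_le _ _ _ _ (_ * _)); rewrite (bigID (mem S)) /=.
  rewrite [X in (_ * X)%N]big1 => [|l lS]; last by rewrite /e (negPf lS).
  rewrite muln1 (eq_bigr (fun=> t)) => [|l lS]; last by rewrite /e lS.
  by rewrite prod_nat_const.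
have GE (S' : {set 'I_d}) : (forall l, l != j -> e S' l = e S l) ->
    im_plus Z setT (x j ^+ e S' j) = G S'.
  move=> eS; apply/seteqP; split.
    apply: sadd_sub; first exact: submod_gen_mul.
      apply: gen_mul_sub; first exact: submod_gen_mul.
      by move=> l v; rewrite !inE => lj; rewrite -eS //; apply: gen_mul_mem; rewrite inE.
    by move=> _ [v _ <-]; apply: (@gen_mul_mem _ _ _ (fun l => x l ^+ e S' l)); rewrite inE.
  apply: gen_mul_sub; first by apply: submod_im_plus => //; exact: submodT.
  move=> l v _; have [->|lj] := eqVneq l j.
    by apply: saddr; [exact: submod0|exists v].
  apply: saddl; first by exists 0 => //; exact: scaler0.
  by rewrite eS //; apply: (@gen_mul_mem _ _ _ (fun l => x l ^+ e S l)); rewrite !inE.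
have GS : im_plus Z setT (x j) = G S by rewrite -[x j]expr1 -GE // /e (negPf jS).
have := len_exp sZ t0 hZ (L := L').
have -> : im_plus Z setT (x j ^+ t) = G (j |: S)%SET.
  rewrite -GE ?/e ?inE ?eqxx //= => l lj; by rewrite /e !inE (negPf lj).
rewrite GS => /(_ hL')[flS leS]; have [fl0 le0] := IH _ (lenP flS).
split=> //; rewrite cardsU1 jS add1n expnS -!mulnA mulSn.
apply: (@leq_trans (t * (len (G S) setT + #|S| * (t ^ #|S| * h)))%N).
  by rewrite leq_mul2l le0 orbT.
by rewrite mulnDr addnA leq_add // mulnCA.
Qed.

End KoszulLowerBound.

(** * Counting the factors [R / p] of a filtration by localization *)

Section LocalizationCount.
Variables (R : comNzRingType) (p : prime_idealr R) (M : lmodType R).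

Definition loc_set (N : set M) : set (localization p M) :=
  [set z | exists2 v, N v & exists s, z = Defs.frac v s].

Lemma submod_loc N : submodule N -> @submodule (local_at p) (localization p M) (loc_set N).
Proof.
move=> sN; apply/submoduleP; split.
  by exists 0; [exact: submod0|exists (denom1 p)].
move=> a _ _ [u Nu [s ->]] [v Nv [t ->]].
rewrite -[a](unfracK (M := R^o)) [_ *: _]Defs.frac_scaleE Defs.fracD.
eexists; last by eexists.
by apply: submodD => //; do ?apply: submodZ.
Qed.

(** A layer [R / p] stays strict in the localization: otherwise an element outside [p] would
    annihilate [e] modulo [N1]. *)
Lemma prime_filt_count N N' s l : submodule N -> prime_filt N N' s ->
  length_le (loc_set N : set (localization p M)) (loc_set N') l ->
  (count (fun P => `[< P = [set` p] >]) s <= l)%N.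
Proof.
move=> sN h; elim: h l => [//|N1 e P s1 h1 IH _ eP] l hl /=.
have [sN1 NN1] := prime_filt_sub sN h1.
have sN2 : submodule (sadd N1 (range (orb e))).
  by apply: submod_add => //; exact: submod_cyclic.
have sub12 : N1 `<=` sadd N1 (range (orb e)) by apply: saddl; exact: (submod0 (submod_cyclic e)).
have locS A B : A `<=` B -> loc_set A `<=` loc_set B.
  by move=> AB _ [v /AB Bv [t ->]]; exists v => //; exists t.
have [a [b [ab /IH ha hb]]] := length_le_split (locS _ _ NN1) (locS _ _ sub12) (submod_loc sN1) hl.
apply: leq_trans ab; rewrite addnC leq_add //; case: asboolP => // Pp.
apply: (length_le_strict hb (N := fun i => if i is 0 then loc_set N1 else loc_set (sadd N1 (range (orb e))))) => [[|i] _|[|//] _].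
- by split=> //; [exact: submod_loc|exact: locS].
- by split=> //; [exact: submod_loc|exact: locS].
split; first exact: locS.
move/(_ (Defs.frac e (denom1 p))); case.
  exists e; last by exists (denom1 p).
  by apply: saddr; [exact: submod0|exists 1; rewrite // /orb scale1r].
move=> v N1v [t /Defs.fracP[u]]; rewrite /= scale1r => /eqP.
rewrite scalerBr subr_eq0 scalerA => /eqP ue.
have : P (val u * val t).
  rewrite -eP /preimage /= /orb ue; exact: (submodZ _ sN1 N1v).
by rewrite Pp /= prime_idealrM (negPf (valP u)) (negPf (valP t)).
Qed.

End LocalizationCount.

(** * Primes of [R / p] and chains of maximal length *)

Section QuotientPrimes.
Variables (R : comNzRingType) (p : prime_idealr R).

Lemma pi_ringP (a b : R) : pi_ring p a = pi_ring p b <-> a - b \in p.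
Proof. by rewrite (Quotient.idealrBE p); split=> [/eqP|/eqP]. Qed.

Lemma pi_ring_surj (z : quot_ring p) : exists r, pi_ring p r = z.
Proof. by exists (repr z); exact: reprK. Qed.

Lemma prime_pull (Q : set (quot_ring p)^o) : prime_set Q -> prime_set (pi_ring p @^-1` Q : set R^o).
Proof.
move=> [sQ Q1 QM]; split=> [||a b].
- apply/submoduleP; split=> [|a u v Qu Qv]; rewrite /preimage /=.
    by rewrite /pi_ring rmorph0; exact: (submod0 sQ).
  rewrite pi_ringD pi_ringM.
  by apply: (submodD sQ) => //; exact: (submodZ (V := (quot_ring p)^o) _ sQ).
- by rewrite /preimage /= pi_ring1.
- by rewrite /preimage /= pi_ringM => /QM.
Qed.

Lemma prime_push (P : set R^o) : [set` p] `<=` P -> prime_set P ->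
  prime_set (pi_ring p @` P : set (quot_ring p)^o).
Proof.
move=> pP [sP P1 PM]; have inP r : (pi_ring p @` P) (pi_ring p r) -> P r.
  move=> [a Pa /esym/pi_ringP/pP]; rewrite -[r](subrK a) addrK => Pra.
  exact: (submodD sP).
split=> [||a b].
- apply/submoduleP; split=> [|a _ _ [u Pu <-] [v Pv <-]].
    by exists 0; [exact: (submod0 sP)|rewrite /pi_ring rmorph0].
  have [r <-] := pi_ring_surj a; exists (r * u + v); last by rewrite pi_ringD pi_ringM.
  by apply: (submodD sP) => //; exact: (submodZ (V := R^o) _ sP).
- by rewrite -(pi_ring1 p) => /inP.
- have [r <-] := pi_ring_surj a; have [s <-] := pi_ring_surj b.
  by rewrite -pi_ringM => /inP/PM[]; [left; exists r|right; exists s].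
Qed.

Lemma push_strict (P P' : set R^o) : submodule P -> [set` p] `<=` P -> P `<` P' ->
  pi_ring p @` P `<` pi_ring p @` P'.
Proof.
move=> sP pP [PP' nPP]; split; first exact: image_subset.
move=> h; apply: nPP => r P'r.
have [a Pa /esym/pi_ringP/pP Pra] := h (pi_ring p r) (imageP _ P'r).
by rewrite -[r](subrK a); exact: (submodD sP).
Qed.

Lemma pull_strict (Q Q' : set (quot_ring p)^o) : Q `<` Q' ->
  (pi_ring p @^-1` Q : set R^o) `<` pi_ring p @^-1` Q'.
Proof.
move=> [QQ nQQ]; split; first by move=> r; exact: QQ.
by move=> h; apply: nQQ => z; have [r <-] := pi_ring_surj z; exact: h.
Qed.

End QuotientPrimes.

Section TopPrimes.
Variables (R : comNzRingType) (d : nat).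
Hypothesis dimR : krull_dim R d.

Lemma prime_chain_idealr (S : comNzRingType) (P : set S^o) k : prime_chain P k ->
  exists p : nat -> prime_idealr S, [set` p 0%N] = P /\
    forall i, (i < k)%N -> [set` p i] `<` [set` p i.+1].
Proof.
move=> [q [q0 qP qS]].
have ex i : exists p : prime_idealr S, (i <= k)%N -> [set` p] = q i.
  have [ik|ki] := leqP i k; first by have /prime_setP[p pq] := qP i ik; exists p.
  by have /prime_setP[p _] := qP 0%N isT; exists p.
have [p hp] := choice ex; exists p; split; first by rewrite hp.
by move=> i ik; rewrite !hp ?(ltnW ik) //; exact: qS.
Qed.

Lemma prime_chain_le (P : set R^o) k : prime_chain P k -> (k <= d)%N.
Proof.
by move=> /prime_chain_idealr[p [_ pS]]; have [_] := dimR; apply; exists p.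
Qed.

Lemma top_prime_minimal (p : prime_idealr R) :
  prime_chain ([set` p] : set R^o) d -> minimal_prime p.
Proof.
move=> [q [q0 qP qS]] p' p'p; apply: contrapT => npp.
have : prime_chain ([set` p'] : set R^o) d.+1.
  exists (fun i => if i is j.+1 then q j else [set` p']); split=> //.
    by case=> [_|i ik]; [apply/prime_setP; exists p'|exact: qP].
  by case=> [_|i ik]; [rewrite q0; split|exact: qS].
by move=> /prime_chain_le; rewrite ltnn.
Qed.

Lemma top_prime_dim (p : prime_idealr R) :
  prime_chain ([set` p] : set R^o) d -> krull_dim (quot_ring p) d.
Proof.
move=> [q [q0 qP qS]].
have pq i : (i <= d)%N -> [set` p] `<=` q i.
  elim: i => [|i IH] id; first by rewrite q0.
  by apply: subset_trans (IH (ltnW id)) _; case: (qS i id).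
split.
  have [|r [_ rS]] := @prime_chain_idealr (quot_ring p) (pi_ring p @` q 0%N) d; last by exists r.
  exists (fun i => pi_ring p @` q i); split=> // i id.
    by apply: prime_push; [exact: pq|exact: qP].
  apply: push_strict; [by case: (qP i (ltnW id))|by apply: pq; exact: ltnW|exact: qS].
move=> k [r rS]; have [_ dmax] := dimR.
have : prime_chain (pi_ring p @^-1` [set` r 0%N] : set R^o) k; last exact: prime_chain_le.
exists (fun i => pi_ring p @^-1` [set` r i]); split=> // i ik.
  by apply: prime_pull; apply/prime_setP; exists (r i).
by apply: pull_strict; exact: rS.
Qed.

End TopPrimes.

Section Nu.
Variables (R : comNzRingType) (m : idealr R) (M : lmodType R).
Variables (d : nat) (x : 'I_d -> R).
Hypothesis xm : forall i, x i \in m.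

Local Notation K := (quot_ring m).

Let proj (v : M) : extension K M := tens (1 : K) v.

Let projZ (a : R) v : proj (a *: v) = (pi_ring m a : K) *: proj v.
Proof.
rewrite /proj tensZr -tensZl; symmetry.
by rewrite [LHS]ext_scale_tens mulr1; congr tens; rewrite /GRing.scale /= /quot_ring_scale mulr1.
Qed.

Let projD u v : proj (u + v) = proj u + proj v.
Proof. exact: tensDr. Qed.

Let proj_surj (t : extension K M) : exists v, proj v = t.
Proof.
have [s ->] := tensE t; elim: s => [|z s [v IH]].
  by exists 0; rewrite big_nil; have := tensZr 0 (1 : K) (0 : M); rewrite !scale0r.
have [r hr] : exists r, pi_ring m r = z.2.1 by exists (repr z.2.1); exact: reprK.
exists (z.1 *: (r *: z.2.2) + v); rewrite big_cons projD IH; congr (_ + _).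
rewrite /proj tensZr; apply: (congr1 (fun u => z.1 *: u)).
rewrite tensZr -tensZl; congr tens.
by rewrite /GRing.scale /= /quot_ring_scale mulr1.
Qed.

Let pi0 a : a \in m -> pi_ring m a = 0.
Proof.
move=> am; transitivity (pi_ring m 0); last exact: rmorph0.
by apply/eqP; rewrite -Quotient.idealrBE subr0.
Qed.

(** The flag of [K^k] pulls back to [k] strict steps in [M], all above [(x) M] because the [x i] act
    as zero on the target. Without a finite basis [nu] takes its default [0]. *)
Lemma nu_le L : length_le (gen_mul x [set: 'I_d]%SET) [set: M] L -> (nu m M <= L)%N.
Proof.
rewrite /nu => hL; case: xgetP => [k _ [[f lf bf]]|_ //].
pose fL : {linear extension K M -> 'rV[K]_k} := HB.pack f (GRing.isLinear.Build _ _ _ _ f lf).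
pose N (i : nat) : set M := [set v | forall j : 'I_k, (i <= j)%N -> fL (proj v) 0 j = 0].
apply: (length_le_strict hL (N := N)) => [i _|i ik].
  have sN : submodule (N i).
    apply/submoduleP; split=> [j _|a u v Nu Nv j ij].
      have -> : proj 0 = 0 by rewrite -[X in proj X](scale0r (0 : M)) projZ pi0 ?scale0r ?idealr0.
      by rewrite linear0 mxE.
    by rewrite projD projZ linearP !mxE Nu // Nv // mulr0 addr0.
  split=> //; apply: gen_mul_sub => // l v _ j _.
  by rewrite projZ pi0 // scale0r linear0 mxE.
split=> [v Nv j ij|h]; first by apply: Nv; exact: ltnW.
have [g fK gK] := bf; have [v hv] := proj_surj (g (delta_mx 0 (Ordinal ik))).
have fv : fL (proj v) = delta_mx 0 (Ordinal ik) by rewrite hv; exact: gK.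
have /(_ (Ordinal ik) (leqnn _)) : N i v.
  apply: h => j ij; rewrite fv mxE eqxx /=.
  by case: eqP => // jk; move: ij; rewrite jk ltnn.
by rewrite fv mxE !eqxx => /eqP; rewrite oner_eq0.
Qed.

End Nu.

(** * Systems of parameters and lim Cohen-Macaulay sequences *)

Section SystemsOfParameters.
Variables (R : comNzRingType) (m : idealr R) (d : nat) (x : 'I_d -> R).
Hypothesis sx : sop m x.

Lemma sop_mem i : x i \in m.
Proof.
by have [_ xm] := sx; apply/xm; exists 1%N; rewrite expr1; apply: mem_span; exists i.
Qed.

Lemma sop_exp d' (w : 'I_d' -> R) : (forall i, w i \in m) ->
  exists s, forall i, ideal_gen x (w i ^+ s).
Proof.
move=> wm; have [_ xm] := sx.
have ex i : exists s, ideal_gen x (w i ^+ s) by apply/xm.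
have [s hs] := choice ex.
exists (\sum_i s i)%N => i; rewrite (bigD1 i) //= exprD mulrC.
exact: (submodZ (V := R^o) _ (submod_span _) (hs i)).
Qed.

(** Every prime in a filtration of [R / (x^c)] contains the [x l], hence [m]; the number of layers
    is then a suitable exponent. *)
Lemma ideal_exp_sub_powers (c : 'I_d -> nat) : local_ring m ->
  exists s, ideal_mul (ideal_exp [set` m] s) [set: R^o] `<=` ideal_gen (fun l => x l ^+ c l).
Proof.
case=> noeth _ _; have [_ xm] := sx; set Q := ideal_gen _.
have sQ : submodule Q by exact: submod_span.
have [s hs] := prime_filt_cyclic noeth (submod_preim (orb (1 : R^o)) sQ) sQ erefl.
have [_ QT] := prime_filt_sub sQ hs.
have hT v : sadd Q (range (orb (1 : R^o))) v.
  by apply: saddr; [exact: (submod0 sQ)|exists v => //; exact: mulr1].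
have all_s : all (fun P : set R^o => `[< prime_set P /\ Q `<=` P >]) s.
  apply: (prime_filt_primes sQ hs) => r v Qr _.
  by rewrite [_ *: _]mulrC; exact: (submodZ (V := R^o) v sQ).
exists (size s); apply: ideal_mul_sub => // z v Iz.
apply: (prime_filt_exp sQ hs _ Iz) => //.
apply: sub_all all_s => P /asboolP[pP QP]; apply/asboolP => r /= /xm[n rn].
have [sP _ _] := pP; apply: (prime_set_exp (n := n) pP).
apply: (span_sub sP _ rn) => _ [l _ <-]; apply: (prime_set_exp (n := c l) pP).
by apply: QP; apply: mem_span; exists l.
Qed.

End SystemsOfParameters.

Lemma krull_dim_uniq (R : comNzRingType) d d' : krull_dim R d -> krull_dim R d' -> d = d'.
Proof. by case=> h hm [h' hm']; apply/eqP; rewrite eqn_leq hm // hm'. Qed.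

(** The exchange needs one bound for all positive degrees, the hypothesis gives one for each;
    homology vanishes above degree [d], so finitely many are combined. *)
Lemma lim_CM_homology (R : comNzRingType) (m : idealr R) (M : nat -> lmodType R)
    d (x : 'I_d -> R) : lim_CM m M -> sop m x ->
  negligible (fun n => (nu m (M n))%:R)
    (fun n => homology_le (M n) x [set: 'I_d]%SET 1).
Proof.
move=> [_ [d' [w [sw hw]]]] sx.
have dd : d' = d by case: sw sx => hd _ [hd' _]; exact: krull_dim_uniq hd hd'.
subst d'; have [s ws] := sop_exp sx (sop_mem sw).
apply: (@negligible_bound _ (fun n l => forall q, (q < d.+1)%N -> (0 < q)%N ->
    homology_le (M n) w [set: 'I_d]%SET q l) _ (s ^ d * 2 ^ d)).
  move=> n l h; rewrite -mulnA; apply: (homology_exchange ws) => // q q0.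
  have [qd|dq] := ltnP q d.+1; first exact: h.
  by apply: homology_big; rewrite cardsT card_ord.
apply: (@negligible_all _ _ (fun q n l => (0 < q)%N -> homology_le (M n) w [set: 'I_d]%SET q l)).
  by move=> q n l l' ll h /h; exact: length_leW.
move=> q _; have [q0|q0] := posnP q.
  rewrite q0; exists (fun=> 0%N); first by exists 0%N.
  by move=> e e0; exists 0%N => n _; rewrite mulr_ge0 // ltW.
have /length_littleoP := hw q q0; apply: negligible_imp => n l h _.
exact: has_length_koszul.
Qed.

(** * The colon formula for closures *)

Section ColonClosure.
Variables (R : comNzRingType) (m : idealr R) (M : nat -> lmodType R).
Variables (alpha : nat -> rat) (d k : nat) (x : 'I_d -> R) (f : 'I_k -> 'I_d).
Variables (a b : 'I_k -> nat).
Hypotheses (loc : local_ring m) (sx : sop m x) (finj : injective f).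
Hypothesis hx : negligible alpha (fun n => homology_le (M n) x [set: 'I_d]%SET 1).

Let mpow t : set R^o := ideal_mul (ideal_exp [set` m] t) [set: R^o].

Lemma MclosureP (A : set R^o) (u : R) : submodule A ->
  Mclosure m M alpha A u <-> forall t, small M alpha (sadd A (mpow t)) u.
Proof.
move=> sA; have sAt t : submodule (sadd A (mpow t)).
  by apply: submod_add => //; exact: submod_ideal_mul.
split=> [h t|h t _]; first by apply/(fl_closureP _ _ _ (sAt t)); exact: h.
by apply/(fl_closureP _ _ _ (sAt t)); exact: h.
Qed.

(** Let [U = I + u M]. The part of [U / I] killed by [y] in [M / J] lies in a negligible kernel, and
    [y] embeds the rest of [U] into [(J + u y M) / J]. *)
Lemma small_colon (A B : 'I_d -> nat) u :
  small M alpha (ideal_gen (fun l => x l ^+ (A l + B l))) (u * \prod_l x l ^+ B l) ->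
  small M alpha (ideal_gen (fun l => x l ^+ A l)) u.
Proof.
set y := \prod_l _ => hu; pose C := (\prod_l (A l + B l))%N.
have hc : negligible alpha (fun n => length_le
    (gen_mul (fun l => x l ^+ A l) [set: 'I_d]%SET)
    (homoth y @^-1` @gen_mul R (M n) d (fun l => x l ^+ (A l + B l)) [set: 'I_d]%SET)).
  apply: (@negligible_bound _ _ _ (d * C) _ hx) => n l h; rewrite -mulnA.
  apply: length_colon => c cAB.
  have le : (\prod_l c l * l <= C * l)%N.
    by rewrite leq_mul2r; apply/orP; right; apply: leq_prod => i _; exact: cAB.
  exact: length_leW le (@homology_exp _ _ _ x c 0 l h).
apply: (negligible_add _ hc hu) => n p q; rewrite !ideal_mul_gen.
set I := gen_mul _ _; set J := gen_mul _ _ => hp hq.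
have sI : submodule I by exact: submod_gen_mul.
have sJ : submodule J by exact: submod_gen_mul.
have su N r : submodule N -> submodule (sadd N (range (homoth r : M n -> M n))).
  by move=> sN; apply: submod_add => //; apply: submod_im; exact: submodT.
have IJ v : I v -> J (y *: v).
  move: v; apply: (gen_mul_sub (submod_preim (homoth y) sJ)) => l v _.
  rewrite /preimage /= /homoth /y (bigD1 l) //= scalerA mulrAC -exprD addnC -scalerA.
  by apply: (@gen_mul_mem R (M n) d (fun l => x l ^+ (A l + B l))); rewrite inE.
pose K := sadd I (range (homoth u : M n -> M n)) `&` homoth y @^-1` J.
have sK : submodule K by apply: submodI; [exact: su|exact: submod_preim].
have IU : I `<=` sadd I (range (homoth u : M n -> M n)).
  by apply: saddl; exists 0 => //; exact: scaler0.
have IK : I `<=` K by move=> v Iv; split; [exact: IU|exact: IJ].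
have KU : K `<=` sadd I (range (homoth u : M n -> M n)) by move=> v [].
have hp' : length_le I K p by apply: length_leS hp => // v [].
apply: (length_le_add sI sK IK KU (su _ _ sI) hp').
apply: (length_le_inj (homoth y) (su _ _ sI) sJ (su _ _ sJ) _ _ _ hq).
- by apply: saddl; exists 0 => //; exact: scaler0.
- move=> _ [_ [v Iv [_ [w _ <-] <-]] <-]; exists (y *: v); first exact: IJ.
  exists (homoth (u * y) w); first by exists w.
  by rewrite /= /homoth scalerDr scalerA [y * u]mulrC.
- by move=> v Uv Jv; split.
Qed.

Lemma colon_Mclosure :
  colon (Mclosure m M alpha (ideal_gen (fun i => x (f i) ^+ (a i + b i))))
        (\prod_i x (f i) ^+ b i)
  = Mclosure m M alpha (ideal_gen (fun i => x (f i) ^+ a i)).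
Proof.
set y := \prod_i _; set I := ideal_gen _; set J := ideal_gen _.
have sI : submodule I by exact: submod_span.
have sJ : submodule J by exact: submod_span.
have st t : submodule (mpow t) by exact: submod_ideal_mul.
apply/seteqP; split=> u; last first.
  move/(MclosureP _ sJ) => hu; apply/(MclosureP _ sI) => t.
  apply: small_mul (hu t) => _ [j Jj [z mz <-]]; rewrite mulrDl.
  exists (j * y); last first.
    by exists (z * y) => //; rewrite mulrC; exact: (submodZ (V := R^o) y (st t)).
  have /= sP := submod_preim (homoth y : R^o -> R^o) sI.
  rewrite mulrC; apply: (span_sub sP _ Jj) => _ [i _ <-]; rewrite /preimage /= /homoth.
  rewrite /y (bigD1 i) //= /GRing.scale /= mulrAC -exprD addnC mulrC.
  by apply: (submodZ (V := R^o) _ sI); apply: mem_span; exists i.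
move/(MclosureP _ sI) => hu; apply/(MclosureP _ sJ) => t.
pose pre l := [pick i | f i == l].
have pref i : pre (f i) = Some i.
  rewrite /pre; case: pickP => [j /eqP/finj->//|/(_ i)]; by rewrite eqxx.
(* The other parameters get exponent [t] and stay out of the monomial. Then [(x^A)] lies in
   [J + m^t], while [m^s] lies in [(x^(A + B))] for large [s], so that [I + m^s] does too. *)
pose A l := if pre l is Some i then a i else t.
pose B l := if pre l is Some i then b i else 0%N.
have [s hs] := ideal_exp_sub_powers sx (fun l => A l + B l)%N loc.
have sQ := submod_span (V := R^o) (range (fun l => x l ^+ (A l + B l))).
have yE : y = \prod_l x l ^+ B l.
  rewrite [RHS](bigID (mem (f @: [set: 'I_k])%SET)) /= [X in _ * X]big1 ?mulr1.
    rewrite big_imset /=; last by move=> i j _ _; exact: finj.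
    by apply: eq_big => [i|i _]; [rewrite inE|rewrite /B pref].
  move=> l lf; rewrite /B /pre; case: pickP => [i /eqP fil|_]; last by rewrite expr0.
  by case/negP: lf; rewrite -fil imset_f.
have : small M alpha (ideal_gen (fun l => x l ^+ A l)) u.
  apply: (@small_colon _ B); rewrite -yE; apply: smallS (hu s).
  apply: sadd_sub => //; apply: span_sub => // _ [i _ <-]; apply: mem_span.
  by exists (f i); rewrite // /A /B pref.
apply: smallS; apply: span_sub; first exact: submod_add.
move=> _ [l _ <-]; rewrite /A; case: (pickP (fun i => f i == l)) => [i /eqP <-|nl].
  by rewrite pref; apply: saddl; [exact: (submod0 (st t))|apply: mem_span; exists i].
have -> : pre l = None by rewrite /pre; case: pickP => // i; rewrite nl.
apply: saddr; first exact: (submod0 sJ).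
have {nl} : ideal_exp [set` m] t (x l ^+ t).
  elim: t {hu A hs sQ} => [//|t IH] /=; apply: mem_span.
  exists (x l); first exact: sop_mem sx l.
  by exists (x l ^+ t) => //; rewrite exprS.
move/(ideal_mul_mem (1 : R^o)); congr (mpow t); exact: mulr1.
Qed.

End ColonClosure.

(** * The bound of [nu] by the rank *)

Section RankBound.
Variables (R : comNzRingType) (m : idealr R) (d : nat) (x : 'I_d -> R).
Hypotheses (loc : local_ring m) (sx : sop m x).

Let dimR : krull_dim R d. Proof. by case: sx. Qed.
Let xm r : r \in m <-> exists n, ideal_gen x (r ^+ n). Proof. by case: sx => _; apply. Qed.

(** The minimal primes [P] with [dim (R / P) = dim R]. *)
Definition top_prime (P : set R^o) := prime_set P /\ prime_chain P d.

Lemma top_primeP P : top_prime P -> exists p : prime_idealr R,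
  [/\ [set` p] = P, minimal_prime p & krull_dim (quot_ring p) d].
Proof.
move=> [/prime_setP[p <-] ch]; exists p; split=> //.
  exact: top_prime_minimal ch.
exact: top_prime_dim ch.
Qed.

(** They all occur in one filtration of [R]: nothing outside [P] kills [1], so some factor [R / Q]
    has [Q] inside [P], and minimality gives equality. *)
Lemma top_primes_finite : exists L : seq (set R^o),
  forall P, top_prime P -> has (fun Q : set R^o => `[< Q = P >]) L.
Proof.
have [noeth _ _] := loc.
have [L hL] := prime_filt_fg (V := R^o) noeth (noeth _ (@submodT _ _)).
exists L => P tP; have [p [pP pmin _]] := top_primeP tP.
have [pP' _] := tP; have [sP _ _] := pP'.
have allp := prime_filt_primes (J := set0) (@submod_0 _ R^o) hL (fun _ _ => False_ind _).
have [|/(prime_filt_avoid pP' (@submod_0 _ _) hL)[u nu /(_ (1 : R) I)]] :=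
    boolP (has (fun Q : set R^o => `[< Q `<=` P >]) L); last first.
  by rewrite [_ *: _]mulr1 => u0; case: nu; rewrite [u]u0; exact: (submod0 sP).
elim: L {hL} allp => //= Q L IH /andP[/asboolP[/prime_setP[q <-] _] /IH{}IH] /orP[/asboolP qP|/IH->].
  apply/orP; left; apply/asboolP/seteqP; split=> //; rewrite -pP => r pr.
  by apply: (pmin q) pr => r' qr'; have := qP r' qr'; rewrite -pP.
exact: orbT.
Qed.

Lemma top_growth (L : seq (set R^o)) : exists K, forall P, top_prime P ->
  has (fun Q : set R^o => `[< Q = P >]) L -> growth_le x P K d.+1.
Proof.
elim: L => [|Q L [K hK]] /=; first by exists 0%N.
have [tQ|nQ] := pselect (top_prime Q); last first.
  by exists K => P tP /orP[/asboolP QP|]; [rewrite QP in nQ|exact: hK].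
have [C hC] : exists C, growth_le x Q C d.+1.
  apply: (prime_growth loc xm); first by case: tQ.
  by move=> k /(prime_chain_le dimR); rewrite ltnS.
exists (maxn K C) => P tP /orP[/asboolP <-|/(hK _ tP)]; apply: growth_leW.
- exact: leq_maxr.
- exact: hC.
- exact: leq_maxl.
Qed.

Lemma count_top (L : seq (set R^o)) : exists C : nat, forall (M : lmodType R) r s,
  has_rank M r -> prime_filt [set 0] [set: M] s ->
  (count (fun P : set R^o => `[< top_prime P >] && has (fun Q : set R^o => `[< Q = P >]) L) s)%:R
    <= C%:R * r.
Proof.
elim: L => [|Q L [C hC]] /=.
  exists 0%N => M r s _ _; rewrite mul0r (eq_count (a2 := pred0)) ?count_pred0 // => P.
  by rewrite /= andbF.
have [tQ|nQ] := pselect (top_prime Q); last first.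
  exists C => M r s hr hs; apply: le_trans (hC M r s hr hs); rewrite ler_nat.
  apply: sub_count => P /= /andP[/asboolP tP /orP[/asboolP QP|->]].
    by rewrite QP in nQ.
  by rewrite andbT; exact/asboolP.
have [p [pQ pmin pdim]] := top_primeP tQ.
(* [C] is a sum of lengths of the [R_p], fixed before [M]; uniqueness of the length identifies [l0]
   with the value supplied by [has_rank]. *)
pose l0 := len [set 0] [set: (local_at p)^o].
exists (l0 + C)%N => M r s hr hs.
have [|l [l0' [hl hl0 lr]]] := hr p pmin; first by exists d.
have l0E : l0' = l0 by rewrite /l0 (has_length_len hl0).
have cl : (count (fun P : set R^o => `[< P = [set` p] >]) s <= l)%N.
  apply: (prime_filt_count (@submod_0 _ _) hs).
  by apply: length_leS (has_length_le hl) => // _ ->; exact: (submod0 (submod_loc _ (@submod_0 _ _))).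
apply: (@le_trans _ _ ((count (fun P : set R^o => `[< P = [set` p] >]) s +
    count (fun P => `[< top_prime P >] && has (fun Q => `[< Q = P >]) L) s)%:R)).
  rewrite ler_nat -count_predUI; apply: leq_trans (leq_addr _ _).
  apply: sub_count => P /= /andP[-> /orP[/asboolP <-|->]]; last exact: orbT.
  by rewrite pQ asboolT.
rewrite !natrD mulrDl; apply: lerD; last exact: (hC M r s hr hs).
by apply: le_trans (_ : l%:R <= _); [rewrite ler_nat|rewrite lr l0E mulrC].
Qed.

(** [dim_K (K (x) M)] is at most the length of [M / (x) M], which differs by
    little from the limit of the length of [M / (x_1^t, ..., x_d^t) M] divided by
    [t ^ d]; only the factors [R / P] with [dim (R / P) = d] of a filtration
    contribute to this limit. *)
Lemma nu_rank_le : exists C : nat, forall (M : lmodType R) r h,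
  finitely_generated [set: M] -> has_rank M r -> homology_le M x [set: 'I_d]%SET 1 h ->
  (nu m M)%:R <= C%:R * r + (d * h)%:R.
Proof.
have [noeth _ _] := loc; have [L hL] := top_primes_finite.
have [K hK] := top_growth L; have [C hC] := count_top L.
exists (K * C)%N => M r h fg hr hh.
have [s hs] := prime_filt_fg noeth fg.
pose good (P : set R^o) := `[< top_prime P >].
have count_good : (count good s)%:R <= C%:R * r.
  apply: le_trans (hC M r s hr hs); rewrite ler_nat; apply: sub_count => P /= /asboolP tP.
  by rewrite (hL P tP) andbT; exact/asboolP.
have all_s := prime_filt_primes (J := set0) (@submod_0 _ _) hs (fun _ _ => False_ind _).
have [|C0 hC0] := prime_filt_growth (x := x) (good := good) (K := K) (e := d) (@submod_0 _ _) hs.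
  apply: sub_all all_s => P /asboolP[pP _]; apply/asboolP.
  rewrite /good; case: asboolP => tP; first exact: hK tP (hL P tP).
  (* A prime that is not top has only chains shorter than [d], hence the lower exponent. *)
  apply: (prime_growth loc xm) => // k ch; rewrite ltn_neqAle (prime_chain_le dimR ch) andbT.
  by apply/eqP => kd; apply: tP; split; rewrite // -kd.
pose L0 := len (gen_mul x [set: 'I_d]%SET) [set: M].
have main t : (0 < t)%N -> finite_len (gen_mul x [set: 'I_d]%SET) [set: M] /\
    (t * L0 <= t * (K * count good s + d * h) + C0)%N.
  move=> t0; have [L1 hL1 L1t] := hC0 t t0.
  have {}hL1 : length_le (gen_mul (fun l => x l ^+ t) [set: 'I_d]%SET) [set: M] L1.
    rewrite -ideal_mul_gen; apply: length_leS hL1 => //.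
      by apply: sadd_sub => // [|_ ->]; [exact: submod_ideal_mul|exact: (submod0 (submod_ideal_mul _ _))].
    by apply: saddl; exact: (submod0 (submod_ideal_mul _ _)).
  have [fl le] := gen_mul_exp_len hh t0 hL1; split=> //.
  have td0 : (0 < t ^ d)%N by rewrite expn_gt0 t0.
  rewrite -/L0 in le; rewrite -(leq_pmul2l td0).
  have : (t ^ d * L0 * t <= (L1 + d * (t ^ d * h)) * t)%N by rewrite leq_mul2r le orbT.
  move: L1t; rewrite expnS => L1t le'.
  apply: leq_trans (_ : _ <= L1 * t + d * (t ^ d * h) * t)%N _.
    by rewrite -mulnDl [(t * L0)%N]mulnC mulnA.
  apply: leq_trans (leq_add L1t (leqnn _)) _.
  by apply: eq_leq; ring.
have L0le : (L0 <= K * count good s + d * h)%N.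
  (* Taking [t] larger than [C0] removes the lower-order term: an excess of [1] in [L0] would
     contribute [t > C0]. *)
  have [_ h1] := main C0.+1 (ltn0Sn _); rewrite leqNgt; apply/negP => lt.
  have : (C0.+1 * (K * count good s + d * h).+1 <= C0.+1 * L0)%N by rewrite leq_mul2l lt orbT.
  by rewrite mulnS => h2; have := leq_trans h2 h1; rewrite addnC leq_add2l ltnn.
have nuL : (nu m M <= L0)%N.
  by apply: (nu_le (sop_mem sx)); apply: lenP; case: (main 1%N isT).
apply: (@le_trans _ _ (K * count good s + d * h)%:R); first by rewrite ler_nat (leq_trans nuL).
by rewrite natrD lerD // !natrM -mulrA; apply: ler_wpM2l.
Qed.

End RankBound.

Lemma lim_CM_nu_rank (R : comNzRingType) (m : idealr R) (M : nat -> lmodType R)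
    d (x : 'I_d -> R) (rk : nat -> rat) :
  local_ring m -> lim_CM m M -> sop m x ->
  (forall n, has_rank (M n) (rk n)) -> (forall n, 0 < rk n) ->
  exists C : rat, exists N, forall n, (N <= n)%N ->
    `|(nu m (M n))%:R : rat| <= C * `|rk n|.
Proof.
move=> loc cm sx hrk rk0; have [C hC] := nu_rank_le loc sx.
have [h [N hN] ho] := lim_CM_homology cm sx.
(* This makes [d h n] at most half of [nu], to be absorbed on the left; [d.+1] instead of [d] keeps
   the quotient meaningful for [d = 0]. *)
have e0 : 0 < (2 * d.+1%:R)^-1 :> rat by rewrite invr_gt0 mulr_gt0 // ltr0n.
have [N' hN'] := ho _ e0; exists (2 * C%:R), (maxn N N') => n.
rewrite geq_max => /andP[/hN hh /hN']; rewrite !ger0_norm ?(ltW (rk0 n)) // => hs.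
have fg : finitely_generated [set: M n] by case: cm => /(_ n)[].
have := hC _ _ _ fg (hrk n) hh; set v := (nu m (M n))%:R in hs *.
have : (d * h n)%:R <= v / 2.
  rewrite natrM; apply: le_trans (_ : d.+1%:R * (h n)%:R <= _).
    by apply: ler_wpM2r; rewrite ?ler_nat.
  apply: le_trans (ler_wpM2l _ hs) _; first exact: ler0n.
  have -> // : d.+1%:R * ((2 * d.+1%:R)^-1 * v) = v / 2.
  by rewrite invfM [2^-1 * _]mulrC !mulrA mulfV ?pnatr_eq0 // mul1r mulrC.
by lra.
Qed.

Theorem theorem8p4 (R : comNzRingType) (m : idealr R) (M : nat -> lmodType R)
    (k : nat) (x : 'I_k -> R) (a b : 'I_k -> nat) :
  local_ring m -> lim_CM m M -> part_of_sop m x -> (forall i, (0 < a i)%N) ->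
  (let alpha n := (nu m (M n))%:R : rat in
   colon (Mclosure m M alpha (ideal_gen (fun i => x i ^+ (a i + b i))))
         (\prod_i x i ^+ b i)
   = Mclosure m M alpha (ideal_gen (fun i => x i ^+ a i)))
  /\
  (forall rk : nat -> rat,
   (forall n, has_rank (M n) (rk n)) -> (forall n, 0 < rk n) ->
   colon (Mclosure m M rk (ideal_gen (fun i => x i ^+ (a i + b i))))
         (\prod_i x i ^+ b i)
   = Mclosure m M rk (ideal_gen (fun i => x i ^+ a i))).
Proof.
move=> loc cm [d [y [f [sy finj xE]]]] _.
have {xE} -> : x = y \o f by exact/funext.
have hnu := lim_CM_homology cm sy.
split=> [|rk hrk rk0]; first exact: (colon_Mclosure _ _ loc sy finj hnu).
have [C hC] := lim_CM_nu_rank loc cm sy hrk rk0.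
exact: (colon_Mclosure _ _ loc sy finj (negligible_dom hC hnu)).
Qed.
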